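(* Consider the two-dimensional regenerative process $\boldsymbol Z(t)=(Z_1(t),Z_2(t))$, $t\ge0$, with regeneration epochs $V_0=0<V_1<V_2<\cdots$, constructed in the context from fractional Brownian motions with drifts $p_j>0$ (on $T$-stages) and $-q_j<0$ (on $S$-stages), $j=1,2$, and from stage lengths distributed as $T$ and $S$, where $T$ is regularly varying with index $\lambda>1$, $\mathbb P\{S>x\}=o(\mathbb P\{T>x\})$ as $x\to\infty$, and $p_j\mathbb E\{T\}<q_j\mathbb E\{S\}<\infty$ for $j=1,2$. Let $\boldsymbol a=(a_1,a_2)$ with $a_1,a_2>0$, and $$Q(u)=\mathbb P\Big\{\exists\, n\ge1:\ \sup_{t\in[V_{n-1},V_n]}Z_1(t)>a_1u,\ \sup_{s\in[V_{n-1},V_n]}Z_2(s)>a_2u\Big\}.$$ Let $\boldsymbol c=(q_1\mathbb E\{S\}-p_1\mathbb E\{T\},\ q_2\mathbb E\{S\}-p_2\mathbb E\{T\})$, let $\widetilde{\boldsymbol T}=(p_1T,p_2T)$, and let $\mu$ be the limiting measure of the regularly varying vector $\widetilde{\boldsymbol T}$ (which has index $\lambda$). Then, as $u\to\infty$, $$Q(u)\sim \int_0^\infty \mu\big((v\boldsymbol c+\boldsymbol a,\boldsymbol\infty]\big)\,dv\ \cdot\ u\,\mathbb P\{|\widetilde{\boldsymbol T}|>u\}.$$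
   Context: The model. Let $\{T_i\}_{i\ge1}$ and $\{S_i\}_{i\ge1}$ be sequences of strictly positive random variables and $\{\boldsymbol X^{(i)}\}_{i\ge1}$, $\{\boldsymbol Y^{(i)}\}_{i\ge1}$ sequences of two-dimensional processes; these four elements are mutually independent. The pairs $(T_i,S_i)$ are independent copies of $(T,S)$. The processes $\boldsymbol X^{(i)}$, resp. $\boldsymbol Y^{(i)}$, are independent copies of $\boldsymbol X=(X_1,X_2)$, resp. $\boldsymbol Y=(Y_1,Y_2)$, where for $j=1,2$ and $t\ge0$ $$X_j(t)=B_{H_j}(t)+p_jt,\qquad Y_j(t)=\widetilde B_{\widetilde H_j}(t)-q_jt,$$ with $p_j,q_j>0$ and $B_{H_1},B_{H_2},\widetilde B_{\widetilde H_1},\widetilde B_{\widetilde H_2}$ mutually independent standard fractional Brownian motions with Hurst indices $H_j,\widetilde H_j\in(0,1)$ (centered Gaussian, continuous paths, covariance $\frac12(|t|^{2H}+|s|^{2H}-|t-s|^{2H})$). Put $V_0=0$, $V_i=(T_1+S_1)+\cdots+(T_i+S_i)$, $\boldsymbol Z(0)=\boldsymbol 0$, and for $i\ge0$ $$\boldsymbol Z(t)=\begin{cases}\boldsymbol Z(V_i)+\boldsymbol X^{(i+1)}(t-V_i),& V_i<t\le V_i+T_{i+1},\\ \boldsymbol Z(V_i)+\boldsymbol X^{(i+1)}(T_{i+1})+\boldsymbol Y^{(i+1)}(t-V_i-T_{i+1}),& V_i+T_{i+1}<t\le V_{i+1}.\end{cases}$$ Regular variation: $T$ is regularly varying with index $\lambda$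 if $\mathbb P\{T>x\}=x^{-\lambda}L(x)$ with $L$ slowly varying at infinity. Let $|\cdot|$ be a fixed norm on $\mathbb R^2$, $\overline{\mathbb R}=\mathbb R\cup\{\pm\infty\}$, $\overline{\mathbb R}_0^2=\overline{\mathbb R}^2\setminus\{\boldsymbol 0\}$. A random vector $\boldsymbol W$ in $\mathbb R^2$ is regularly varying with index $\lambda$ and limiting measure $\mu$ if $\mu$ is a non-null Radon measure on $\mathcal B(\overline{\mathbb R}_0^2)$ with $\mu(\overline{\mathbb R}^2\setminus\mathbb R^2)=0$, $\mathbb P\{x^{-1}\boldsymbol W\in\cdot\}/\mathbb P\{|\boldsymbol W|>x\}\to\mu(\cdot)$ vaguely as $x\to\infty$, and $\mu(sK)=s^{-\lambda}\mu(K)$ for $s>0$ and Borel $K$. $(\boldsymbol x,\boldsymbol\infty]=(x_1,\infty]\times(x_2,\infty]$; $f\sim h$ means $f/h\to1$. *)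

(* Defs.v *)
(* [measurable_realfun], which carries the Borel structure
   of [\bar R], is not re-exported by [all_analysis]. *)
From HB Require Import structures.
From mathcomp Require Export all_boot all_order all_algebra.
From mathcomp Require Export all_classical all_reals all_analysis.
From mathcomp Require Export finmap measurable_realfun.

Set Implicit Arguments.
Unset Strict Implicit.
Unset Printing Implicit Defensive.

Export Order.TTheory GRing.Theory Num.Theory.
Export numFieldNormedType.Exports.

Local Open Scope classical_set_scope.
Local Open Scope ring_scope.

Definition asymp_equiv (R : realType) (f h : R -> R) : Prop :=
  f u / h u @[u --> +oo] --> (1 : R).

Definition slowly_varying (R : realType) (L : R -> R) : Prop :=
  [/\ measurable_fun (`]0, +oo[ : set R) L,
      \forall x \near +oo, 0 < L x &
      forall t : R, 0 < t -> L (t * x) / L x @[x --> +oo] --> (1 : R)].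

Definition pr (d : measure_display) (Omega : measurableType d) (R : realType)
    (P : probability Omega R) (A : set Omega) : R := fine (P A).

Definition tail (d : measure_display) (Omega : measurableType d)
    (R : realType) (P : probability Omega R) (X : Omega -> R) (x : R) : R :=
  pr P [set w | x < X w].

Definition regularly_varying (d : measure_display) (Omega : measurableType d)
    (R : realType) (P : probability Omega R) (X : {RV P >-> R}) (lambda : R) :
    Prop :=
  exists2 L : R -> R, slowly_varying L &
    forall x : R, 0 < x -> tail P X x = x `^ (- lambda) * L x.

(* The factory [Lmodule_isNormed] would install a second norm structure on
   [R * R], which already carries the sup norm; hence a predicate. *)
Record is_norm (R : realType) (N : R * R -> R) : Prop := IsNorm {
  norm_triangle : forall x y, N (x + y) <= N x + N y ;
  norm_homogeneous : forall s x, N (s * x.1, s * x.2) = `|s| * N x ;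
  norm_definite : forall x, N x = 0 -> x = 0
}.

(* Measures on the punctured extended plane are represented by measures on
   [\bar R * \bar R] without mass at the origin. *)
Definition origin (R : realType) : \bar R * \bar R := (0%E, 0%E).

(* A subset of the punctured plane is compact there iff it is compact in
   [\bar R * \bar R]. *)
Definition radon (R : realType) (mu : {measure set (\bar R * \bar R) -> \bar R})
    : Prop :=
  forall K : set (\bar R * \bar R), compact K -> ~ K (origin R) ->
    (mu K < +oo)%E.

(* Test functions are the nonnegative continuous functions with compact support
   in the punctured plane, extended by 0 at the origin. *)
Definition vague_cvg (R : realType) (nu : R -> set (\bar R * \bar R) -> \bar R)
    (mu : set (\bar R * \bar R) -> \bar R) : Prop :=
  forall f : \bar R * \bar R -> R,
    continuous f -> (forall y, 0 <= f y) ->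
    compact (closure [set y | f y != 0]) ->
    ~ closure [set y | f y != 0] (origin R) ->
    (\int[nu x]_y (f y)%:E)%E @[x --> +oo] --> (\int[mu]_y (f y)%:E)%E.

Definition normalized_law (d : measure_display) (Omega : measurableType d)
    (R : realType) (P : probability Omega R) (N : R * R -> R)
    (W : Omega -> R * R) (x : R) (A : set (\bar R * \bar R)) : \bar R :=
  (((tail P (N \o W) x)^-1)%:E *
   P [set w | A ((x^-1 * (W w).1)%:E, (x^-1 * (W w).2)%:E)])%E.

Record regularly_varying_vector (d : measure_display)
    (Omega : measurableType d) (R : realType) (P : probability Omega R)
    (N : R * R -> R) (W : Omega -> R * R) (lambda : R)
    (mu : {measure set (\bar R * \bar R) -> \bar R}) : Prop :=
  RegularlyVaryingVector {
  rvv_measurable : measurable_fun setT W ;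
  rvv_origin : mu [set origin R] = 0%E ;
  rvv_nonnull : mu setT != 0%E ;
  rvv_radon : radon mu ;
  rvv_finite :
    mu [set y | ~ (y.1 \is a fin_num /\ y.2 \is a fin_num)] = 0%E ;
  rvv_cvg : vague_cvg (normalized_law P N W) mu ;
  rvv_scaling : forall (s : R) (K : set (\bar R * \bar R)),
    0 < s -> measurable K -> ~ K (origin R) ->
    mu [set (s%:E * y.1, s%:E * y.2)%E | y in K] =
      ((s `^ (- lambda))%:E * mu K)%E
}.

Definition upper_quadrant (R : realType) (x : 'I_2 -> R) :
    set (\bar R * \bar R) :=
  [set y | ((x ord0)%:E < y.1)%E /\ ((x ord_max)%:E < y.2)%E].

Definition sigma_of (Omega : Type) (R : realType) (I : Type) (D : set I)
    (F : I -> Omega -> R) : set_system Omega :=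
  <<s \bigcup_(i in D) preimage_set_system setT (F i) measurable >>.

Definition mutually_independent (d : measure_display)
    (Omega : measurableType d) (R : realType) (P : probability Omega R)
    (I : choiceType) (F : I -> set_system Omega) : Prop :=
  forall (J : {fset I}) (A : I -> set Omega),
    (forall i, i \in J -> F i (A i)) ->
    pr P (\bigcap_(i in [set` J]) A i) = \prod_(i <- J) pr P (A i).

Definition same_fdd (d : measure_display) (Omega : measurableType d)
    (R : realType) (P : probability Omega R) (I : Type) (D : set I)
    (F G : I -> Omega -> R) : Prop :=
  forall (n : nat) (t : 'I_n -> I) (A : set (n.-tuple R)),
    (forall k, D (t k)) -> measurable A ->
    P [set w | A [tuple F (t k) w | k < n]] =
    P [set w | A [tuple G (t k) w | k < n]].

(* [normal_prob m 0] is not the Dirac mass at [m], so that the degenerate case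
   has to be treated apart. *)
Definition gaussian (d : measure_display) (Omega : measurableType d)
    (R : realType) (P : probability Omega R) (X : Omega -> R) : Prop :=
  exists m s : R, forall A : set R, measurable A ->
    P (X @^-1` A) = if s == 0 then \d_m A else normal_prob m s A.

(* Time is all of [R] in the types; every requirement, here and below, bears on
   [0 <= t] only (apart from measurability, which comes with [{RV P >-> R}]). *)
Record standard_fbm (d : measure_display) (Omega : measurableType d)
    (R : realType) (P : probability Omega R) (H : R) (B : R -> {RV P >-> R}) :
    Prop := StandardFbm {
  fbm_gaussian : forall (n : nat) (t l : 'I_n -> R), (forall k, 0 <= t k) ->
    gaussian P (fun w => \sum_(k < n) l k * B (t k) w) ;
  fbm_centered : forall t, 0 <= t -> ('E_P[B t] = 0)%E ;
  fbm_covariance : forall t s, 0 <= t -> 0 <= s ->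
    covariance P (B t) (B s) =
      (2^-1 * (`|t| `^ (2 * H) + `|s| `^ (2 * H) - `|t - s| `^ (2 * H)))%:E ;
  fbm_continuous : forall w, {within `[0, +oo[, continuous (fun t => B t w)}
}.

Definition nonneg_time (R : realType) : set ('I_2 * R) := [set k | 0 <= k.2].

Definition drifted (d : measure_display) (Omega : measurableType d)
    (R : realType) (P : probability Omega R) (B : 'I_2 -> R -> {RV P >-> R})
    (r : 'I_2 -> R) (k : 'I_2 * R) (w : Omega) : R :=
  B k.1 k.2 w + r k.1 * k.2.

Definition uncurried (d : measure_display) (Omega : measurableType d)
    (R : realType) (P : probability Omega R) (X : 'I_2 -> R -> {RV P >-> R})
    (k : 'I_2 * R) (w : Omega) : R := X k.1 k.2 w.

(* The sequences are indexed from 0: [Tn i] is T_(i+1), [Xn i] is X^(i+1),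
   etc., while [epoch Tn Sn i] is V_i. *)
Definition epoch (Omega : Type) (R : realType) (Tn Sn : nat -> Omega -> R)
    (i : nat) (w : Omega) : R :=
  \sum_(k < i) (Tn k w + Sn k w).

Definition independent_copies (d : measure_display) (Omega : measurableType d)
    (R : realType) (P : probability Omega R)
    (Xn : nat -> 'I_2 -> R -> {RV P >-> R}) (X : 'I_2 * R -> Omega -> R) :
    Prop :=
  [/\ mutually_independent P
        (fun i => sigma_of (@nonneg_time R) (uncurried (Xn i))),
      forall i, same_fdd P (@nonneg_time R) (uncurried (Xn i)) X &
      forall i j w, {within `[0, +oo[, continuous (fun t => Xn i j t w)}].

Definition sigma_of_processes (d : measure_display) (Omega : measurableType d)
    (R : realType) (P : probability Omega R)
    (Xn : nat -> 'I_2 -> R -> {RV P >-> R}) : set_system Omega :=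
  sigma_of [set k : nat * ('I_2 * R) | nonneg_time k.2]
    (fun k => uncurried (Xn k.1) k.2).

(* [T], [S], [drifted B p] and [drifted Bt (- q)] are the generic elements, of
   which [Tn i], [Sn i], [Xn i] and [Yn i] are copies. *)
Record regenerative_model (d : measure_display) (Omega : measurableType d)
    (R : realType) (P : probability Omega R)
    (H Ht p q : 'I_2 -> R) (B Bt : 'I_2 -> R -> {RV P >-> R})
    (T S : {RV P >-> R}) (Tn Sn : nat -> {RV P >-> R})
    (Xn Yn : nat -> 'I_2 -> R -> {RV P >-> R}) (Z : 'I_2 -> R -> Omega -> R) :
    Prop := RegenerativeModel {
  model_hurst : forall j, 0 < H j < 1 ;
  model_hurst' : forall j, 0 < Ht j < 1 ;
  model_p_gt0 : forall j, 0 < p j ;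
  model_q_gt0 : forall j, 0 < q j ;
  model_fbm : forall j, standard_fbm (H j) (B j) ;
  model_fbm' : forall j, standard_fbm (Ht j) (Bt j) ;
  model_fbm_indep : mutually_independent P (fun k : 'I_2 + 'I_2 =>
    match k with
    | inl j => sigma_of [set t | 0 <= t] (B j)
    | inr j => sigma_of [set t | 0 <= t] (Bt j)
    end) ;
  model_T_gt0 : forall i w, 0 < Tn i w ;
  model_S_gt0 : forall i w, 0 < Sn i w ;
  model_TS_indep : mutually_independent P (fun i : nat =>
    sigma_of setT (fun b : bool => if b then Tn i else Sn i)) ;
  model_TS_law : forall i (A : set (R * R)), measurable A ->
    P [set w | A (Tn i w, Sn i w)] = P [set w | A (T w, S w)] ;
  model_X : independent_copies Xn (drifted B p) ;
  model_Y : independent_copies Yn (drifted Bt (fun j => - q j)) ;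
  model_indep : mutually_independent P (fun k : 'I_4 => nth set0
    [:: sigma_of setT Tn; sigma_of setT Sn;
        sigma_of_processes Xn; sigma_of_processes Yn] k) ;
  model_Z0 : forall j w, Z j 0 w = 0 ;
  model_ZT : forall i j t w,
    epoch Tn Sn i w < t <= epoch Tn Sn i w + Tn i w ->
    Z j t w = Z j (epoch Tn Sn i w) w + Xn i j (t - epoch Tn Sn i w) w ;
  model_ZS : forall i j t w,
    epoch Tn Sn i w + Tn i w < t <= epoch Tn Sn i.+1 w ->
    Z j t w = Z j (epoch Tn Sn i w) w + Xn i j (Tn i w) w
              + Yn i j (t - epoch Tn Sn i w - Tn i w) w
}.

(* The suprema are taken in [\bar R], where they always exist. *)
Definition ruin_prob (d : measure_display) (Omega : measurableType d)
    (R : realType) (P : probability Omega R) (Tn Sn : nat -> {RV P >-> R})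
    (Z : 'I_2 -> R -> Omega -> R) (a : 'I_2 -> R) (u : R) : R :=
  pr P [set w | exists n : nat, forall j : 'I_2,
    ((a j * u)%:E <
     ereal_sup [set (Z j t w)%:E | t in
       `[epoch Tn Sn n w, epoch Tn Sn n.+1 w]])%E].

(* Main.v *)
(* Ruin at a high level [u] is caused by a single long [T]-stage.  Outside an event
   of probability [o(u P(T > u))], the fractional Brownian motions stay below
   [eps t + dl u], no [S]-stage and at most one [T]-stage is longer than [dl u], and
   the sum of the increments over the other blocks deviates from its mean by at most
   [eps u]: for increments truncated at [dl u] this is a Chernoff bound with rate
   [kappa ln u / u], polynomially small of any order when [dl] is small.  On the
   complement, ruin happens near the k-th block iff, up to a factor close to 1,
   [p_j T_k > a_j u + c_j k] for both j, that is [T_k > u g (k / u)] with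
   [g v = max_j (a_j + c_j v) / p_j].  By regular variation the sum over k of these
   probabilities is a Riemann sum, equivalent to [u P(T > u)] times the integral of
   [g v ^ (- lambda)]; the blocks of index beyond [K u] contribute
   [O(K ^ (1 - lambda))], by dyadic decomposition.  Finally, with [n] the norm of
   [(p_1, p_2)], testing the vague convergence against bump functions between two
   homothetic quadrants gives the quadrant at [v c + a] the mass
   [n ^ (- lambda) g v ^ (- lambda)], while [P(n T > u) / P(T > u)] tends to
   [n ^ lambda]. *)
Require Import Defs.
From HB Require Import structures.
From mathcomp Require Import ring lra.

Set Implicit Arguments.
Unset Strict Implicit.
Unset Printing Implicit Defensive.

Local Open Scope classical_set_scope.
Local Open Scope ring_scope.
Import Num.Def.

(** * Independence *)

(** Several obstacles shape the proof. A block increment evaluates fractional Brownian paths at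
    random stage lengths: exponential moments are bounded at deterministic times and transferred by
    [random_time_le], which requires the sigma-algebras of all ingredients of all blocks to be
    jointly independent ([atoms_indep]). The copies are known only through finite-dimensional laws
    and continuity, so path events are reduced to dyadic times and path estimates to laws at two
    times. For [lambda < 2] the variance of [T] may be infinite, so expansions stop at a moment of
    order [1 + eta]. Since [F u] is eventually at least [c / u ^ m0], only polynomial decay has to
    be beaten: Gaussian tails are used as power bounds of large order, and union bounds over [O(u)]
    indices or [O(u ^ 2)] pairs are paid for with extra powers. The index of the long stage is
    random, so partial sums with any one block left out are controlled simultaneously. Finally, the
    integral is not known to be finite beforehand: this comes out of comparing the upper and the
    lower bound for the ruin probability. *)

Section sub_sigma_algebra.
Context (d : measure_display) (Omega : measurableType d).

Lemma measurable_fun_sub_sigma d' (T' : measurableType d') (A B : set_system Omega)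
    (f : Omega -> T') : A `<=` B ->
  measurable_fun setT (f : g_sigma_algebraType A -> T') ->
  measurable_fun setT (f : g_sigma_algebraType B -> T').
Proof.
move=> AB mf _ C mC; have := mf measurableT C mC.
by rewrite !setTI; exact: sub_sigma_algebra2.
Qed.

Lemma measurable_fun_sigma d' (T' : measurableType d') (A : set_system Omega)
    (f : Omega -> T') : A `<=` measurable ->
  measurable_fun setT (f : g_sigma_algebraType A -> T') ->
  measurable_fun setT f.
Proof.
move=> AB mf _ C mC; have := mf measurableT C mC.
rewrite !setTI; apply: smallest_sub => //.
exact: sigma_algebra_measurable.
Qed.

End sub_sigma_algebra.

Section independence.
Context (d : measure_display) (Omega : measurableType d) (R : realType)
  (P : probability Omega R).
Implicit Types A B : set_system Omega.

Definition indep A B : Prop :=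
  forall a b, A a -> B b -> P (a `&` b) = (P a * P b)%E.

(** For fixed [b], the sets satisfying the product formula with [b] form a Dynkin system; it
    contains the intersection-stable class [A], hence the sigma-algebra generated by [A]. *)
Lemma indep_sigma A B : A `<=` measurable -> B `<=` measurable ->
  setI_closed A -> indep A B -> indep <<s A>> B.
Proof.
move=> mA mB AI AB a b sAa Bb.
pose H := [set a | measurable a /\ P (a `&` b) = (P a * P b)%E].
suff /(_ _ sAa) [] : <<s A>> `<=` H by [].
have mb := mB _ Bb.
apply: lambda_system_subset => //; last first.
  by move=> c Ac; split; [exact: mA|exact: AB].
apply/dynkin_lambda_system; split.
- by split => //; rewrite setTI probability_setT mul1e.
- move=> c [mc Pc]; split; first exact: measurableC.
  rewrite probability_setC// setIC -setDE measureD//; last first.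
    by rewrite (le_lt_trans (probability_le1 _ mb))// ltry.
  rewrite [X in (_ - X)%E](_ : _ = P c * P b)%E; last by rewrite -Pc setIC.
  by rewrite muleBl ?mul1e ?fin_num_measure// fin_num_adde_defr.
- move=> F tF HF; have mF k : measurable (F k) by case: (HF k).
  split; first exact: bigcup_measurable.
  rewrite setI_bigcupl measure_bigcup//; last 2 first.
    by move=> k _; apply: measurableI.
    apply: trivIset_setIr => //.
  rewrite [X in (X * _)%E]measure_bigcup// muleC.
  rewrite -[X in (X * _)%E]fineK ?fin_num_measure// -nneseriesZl//.
  apply: eq_eseriesr => k _.
  have [_ HFk] := HF k.
  by apply: etrans HFk _; rewrite muleC fineK// fin_num_measure.
Qed.

Lemma indep_sub A A' B B' : A' `<=` A -> B' `<=` B -> indep A B -> indep A' B'.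
Proof. by move=> sA sB AB a b /sA Aa /sB Bb; exact: AB. Qed.

Lemma pr_fin (a : set Omega) : measurable a -> P a = (pr P a)%:E.
Proof. by move=> ma; rewrite /pr fineK// fin_num_measure. Qed.

(** The finite intersections of events taken from the [F k], [k] in [J], are an intersection-stable
    class generating the left-hand sigma-algebra, so that [indep_sigma] applies. *)
Lemma mutually_independent_indep (I : choiceType) (F : I -> set_system Omega)
    (J : set I) (i : I) :
  (forall k, sigma_algebra setT (F k)) -> (forall k, F k `<=` measurable) ->
  mutually_independent P F -> ~ J i ->
  indep <<s \bigcup_(k in J) F k>> <<s F i>>.
Proof.
move=> sF mF Findep Ji; rewrite (sigma_algebra_id (sF i)).
have FT k : F k setT by case: (sF k) => + FD _ => /FD; rewrite setD0.
have FI k a b : F k a -> F k b -> F k (a `&` b).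
  move=> Fa Fb; have [_ _ FdI] := sigma_algebra_dynkin (sF k).
  have := sigma_algebra_id (sF k) => E; rewrite -E in Fa Fb *.
  have:= @measurableI _ (g_sigma_algebraType (F k)) a b Fa Fb; exact.
pose G := [set A | exists2 L : {fset I}, (forall k, k \in L -> J k) &
  exists2 a : I -> set Omega, (forall k, F k (a k)) &
    A = \bigcap_(k in [set` L]) a k].
have mG : G `<=` measurable.
  move=> _ [L _ [a Fa ->]]; apply: fin_bigcap_measurable => //.
  by move=> k _; exact/mF/Fa.
apply: (@indep_sub <<s G>> _ (F i) _ _ (@subset_refl _ _)) => //.
  apply: sub_sigma_algebra2 => a [k Jk Fa].
  exists [fset k]%fset; first by move=> l; rewrite inE => /eqP ->.
  exists (fun l => if l == k then a else setT).
    by move=> l; case: eqP => // ->.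
  rewrite (_ : [set` [fset k]%fset] = [set k]) ?bigcap_set1 ?eqxx//.
  by apply/seteqP; split => l /=; rewrite inE => /eqP.
apply: indep_sigma => //.
- move=> _ _ [L LJ [a Fa ->]] [M MJ [b Fb ->]].
  exists (L `|` M)%fset.
    by move=> k; rewrite inE => /orP[/LJ|/MJ].
  (* Missing indices are filled with [setT], which merges two intersections over different index
     sets into a single one. *)
  exists (fun k => (if k \in L then a k else setT) `&`
                   (if k \in M then b k else setT)).
    by move=> k; apply: FI; case: ifP.
  apply/seteqP; split => [w [La Mb] k _|w H] /=.
    by split; case: ifPn => // ?; [exact: La|exact: Mb].
  split => k /= kL.
    by have := H k; rewrite /= inE kL => /(_ isT) [].
  by have := H k; rewrite /= inE kL orbT => /(_ isT) [].
- move=> _ b [L LJ [a Fa ->]] Fb.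
  have iL : i \notin L by apply/negP => /LJ.
  have mb := mF _ _ Fb.
  have mL : measurable (\bigcap_(k in [set` L]) a k).
    by apply: mG; exists L => //; exists a.
  (* The product formula is used for [L] and for [L] enlarged by [i]; comparing the two gives
     independence from [b]. *)
  pose a' k := if k == i then b else a k.
  have H1 := Findep L a (fun k _ => Fa k).
  have : pr P (\bigcap_(k in [set` (i |` L)%fset]) a' k) =
         \prod_(k <- (i |` L)%fset) pr P (a' k).
    by apply: Findep => k _; rewrite /a'; case: eqP => // ->.
  have a'i : a' i = b by rewrite /a' eqxx.
  rewrite big_fsetU1//= a'i.
  rewrite (eq_big_seq (fun k => pr P (a k))); last first.
    by move=> k kL; rewrite /a'; case: eqP => // E; rewrite -E kL in iL.
  rewrite -H1 => H2.
  rewrite (pr_fin mL) (pr_fin mb) -EFinM mulrC -H2 -pr_fin.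
    congr (P _); apply/seteqP; split => [w [La wb] k|w H].
      rewrite /= !inE => /orP[/eqP ->|kL]; rewrite ?a'i// /a'.
      by case: eqP => // _; exact: La.
    split; last by have := H i; rewrite a'i /= fset1U1; exact.
    move=> k kL; have := H k; rewrite /a' /= inE (kL : k \in L) orbT => /(_ isT).
    by case: eqP => // E; rewrite -E (kL : k \in L) in iL.
  apply: fin_bigcap_measurable => // k _.
  by rewrite /a'; case: eqP => // _; exact/mF/Fa.
Qed.

End independence.

(** * Products of independent variables and random times *)

Section product_expectation.
Context (d : measure_display) (Omega : measurableType d) (R : realType)
  (P : probability Omega R).
Local Open Scope ereal_scope.

(** The product formula on rectangles identifies the joint law with the product of the marginals, by
    uniqueness of the product measure; Tonelli's theorem then separates the integrals. *)
Lemma ge0_expectationM_joint (f g : Omega -> R) :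
  measurable_fun setT f -> measurable_fun setT g ->
  (forall w, 0 <= f w)%R -> (forall w, 0 <= g w)%R ->
  (forall A B : set R, measurable A -> measurable B ->
    P (f @^-1` A `&` g @^-1` B) = P (f @^-1` A) * P (g @^-1` B)) ->
  \int[P]_w (f w * g w)%:E = (\int[P]_w (f w)%:E) * (\int[P]_w (g w)%:E).
Proof.
move=> mf mg f0 g0 fg.
pose F : {RV P >-> R} := mfun_Sub (mem_set mf).
pose G : {RV P >-> R} := mfun_Sub (mem_set mg).
have mh : measurable_fun setT (fun w => (f w, g w)) by exact: measurable_fun_pair.
have mE : measurable_fun setT (EFin : R -> \bar R) by exact: EFin_measurable.
have mN : measurable_fun setT (fun x : R => (maxr x 0)%:E).
  by apply: measurableT_comp => //; exact: measurable_maxr.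
have mM : measurable_fun setT (fun z : R * R => (maxr z.1 0 * maxr z.2 0)%:E).
  apply: measurableT_comp => //; apply: measurable_funM.
    by apply: measurable_maxr => //; exact: measurable_fst.
  by apply: measurable_maxr => //; exact: measurable_snd.
have pos (x : R) : 0 <= (maxr x 0)%:E by rewrite lee_fin le_max lexx orbT.
(* Positive parts make the integrand nonnegative on the whole plane; on the range of [(f, g)] they
   change nothing. *)
transitivity (\int[pushforward P (fun w => (f w, g w))]_z
    (maxr z.1 0 * maxr z.2 0)%:E).
  rewrite ge0_integral_pushforward//.
    by apply: eq_integral => w _ /=; rewrite !max_l.
  by move=> z _; rewrite EFinM mule_ge0.
transitivity (\int[distribution P F \x distribution P G]_z
    (maxr z.1 0 * maxr z.2 0)%:E).
  apply: eq_measure_integral => A mA _.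
  apply/esym/(@product_measure_unique _ _ _ _ _ (distribution P F)
    (distribution P G) (pushforward P (fun w => (f w, g w)))) => // B C mB mC.
rewrite fubini_tonelli1//; last by move=> z; rewrite EFinM mule_ge0.
rewrite /fubini_F /=.
transitivity (\int[distribution P F]_x ((maxr x 0)%:E * \int[P]_w (g w)%:E)).
  apply: eq_integral => x _.
  under eq_integral do rewrite EFinM.
  rewrite ge0_integralZl//; congr (_ * _).
  rewrite ge0_integral_distribution//.
  by apply: eq_integral => w _ /=; rewrite max_l.
rewrite ge0_integralZr//; last by apply: integral_ge0 => w _; rewrite lee_fin.
congr (_ * _); rewrite ge0_integral_distribution//.
by apply: eq_integral => w _ /=; rewrite max_l.
Qed.

Lemma ge0_expectationM_indep (A B : set_system Omega) (f g : Omega -> R) :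
  A `<=` measurable -> B `<=` measurable -> indep P <<s A>> <<s B>> ->
  measurable_fun setT (f : g_sigma_algebraType A -> R) ->
  measurable_fun setT (g : g_sigma_algebraType B -> R) ->
  (forall w, 0 <= f w)%R -> (forall w, 0 <= g w)%R ->
  \int[P]_w (f w * g w)%:E = (\int[P]_w (f w)%:E) * (\int[P]_w (g w)%:E).
Proof.
move=> mA mB AB mf mg f0 g0.
apply: ge0_expectationM_joint => //.
- exact: measurable_fun_sigma mf.
- exact: measurable_fun_sigma mg.
move=> C D mC mD; apply: AB.
  by have := mf measurableT _ mC; rewrite setTI.
by have := mg measurableT _ mD; rewrite setTI.
Qed.

End product_expectation.

Section grid.
Context (R : realType).
Implicit Types (x : R) (n : nat).

Definition grid n x : R := (truncn (n.+1%:R * x))%:R / n.+1%:R.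

Lemma grid_ge0 n x : 0 <= grid n x.
Proof. by rewrite divr_ge0. Qed.

Lemma grid_le n x : 0 <= x -> grid n x <= x.
Proof.
by move=> x0; rewrite ler_pdivrMr// mulrC truncn_le mulr_ge0.
Qed.

Lemma grid_cvg x : 0 <= x -> grid n x @[n --> \oo] --> x.
Proof.
move=> x0; apply: (@squeeze_cvgr _ _ _ _ (fun n => x - n.+1%:R^-1) (cst x)).
- near=> n; rewrite grid_le// andbT lerBlDr /grid -[X in _ + X]mul1r -mulrDl.
  rewrite ler_pdivlMr// mulrC natr1 ltW//.
  by have /andP[] := truncn_itv (mulr_ge0 (ler0n R n.+1) x0).
- rewrite -[X in _ --> X]subr0; apply: cvgB; first exact: cvg_cst.
  exact: cvg_harmonic.
- exact: cvg_cst.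
Unshelve. all: by end_near. Qed.

Lemma preimage_gridM n (k : nat) x : 0 <= x ->
  (truncn (n.+1%:R * x) == k) = (k%:R / n.+1%:R <= x < k.+1%:R / n.+1%:R).
Proof.
move=> x0; rewrite truncn_eq ?mulr_ge0//.
by rewrite ler_pdivrMr// ltr_pdivlMr// ![x * _]mulrC.
Qed.

End grid.

Section random_time.
Context (R : realType).

Lemma measurable_truncn_eq d (T : measurableType d) (U : T -> R) (n k : nat) :
  measurable_fun setT U -> (forall w, 0 <= U w) ->
  measurable [set w | truncn (n.+1%:R * U w) = k].
Proof.
move=> mU U0.
rewrite (_ : [set w | _] = U @^-1` `[k%:R / n.+1%:R, k.+1%:R / n.+1%:R[).
  by rewrite -[X in measurable X]setTI; exact: mU.
apply/seteqP; split => w /=; rewrite in_itv/= -preimage_gridM//.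
  by move=> ->.
by move/eqP.
Qed.

Lemma measurable_grid_time d (T : measurableType d) (f : R -> T -> R)
    (U : T -> R) (n : nat) :
  (forall t, 0 <= t -> measurable_fun setT (f t)) ->
  measurable_fun setT U -> (forall w, 0 <= U w) ->
  measurable_fun setT (fun w => f (grid n (U w)) w).
Proof.
move=> mf mU U0 _ B mB; rewrite setTI.
rewrite (_ : _ @^-1` _ = \bigcup_k ([set w | truncn (n.+1%:R * U w) = k] `&`
   f (k%:R / n.+1%:R) @^-1` B)).
  apply: bigcup_measurable => k _; apply: measurableI.
    exact: measurable_truncn_eq.
  by rewrite -[X in measurable X]setTI; apply: mf => //; rewrite divr_ge0.
apply/seteqP; split => w /=.
  by move=> H; exists (truncn (n.+1%:R * U w)).
by move=> [k _ [<-]].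
Qed.

(** The value at [U] is the pointwise limit of the values at the grid roundings of [U], which stay
    in the half-line where the paths are continuous. *)
Lemma measurable_random_time d (T : measurableType d) (f : R -> T -> R)
    (U : T -> R) :
  (forall t, 0 <= t -> measurable_fun setT (f t)) ->
  (forall w, {within `[0, +oo[, continuous (fun t => f t w)}) ->
  measurable_fun setT U -> (forall w, 0 <= U w) ->
  measurable_fun setT (fun w => f (U w) w).
Proof.
move=> mf cf mU U0.
apply: (@measurable_fun_cvg _ _ _ _ (fun n w => f (grid n (U w)) w)); last first.
  move=> w _; apply: (@cvg_comp _ _ _ (fun n => grid n (U w)) (fun t => f t w)
    _ (within `[0, +oo[%classic (nbhs (U w)))).
    move=> A /= [e /= e0 He].
    have := grid_cvg (U0 w) => /cvgrPdist_lt /(_ _ e0).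
    apply: filterS => n /= Hn; apply: He => //=.
    by rewrite in_itv/= grid_ge0.
  have /subspace_continuousP := cf w; apply.
  by rewrite /= in_itv/= U0.
by move=> n; exact: measurable_grid_time.
Qed.

End random_time.

Section random_time_expectation.
Context (d : measure_display) (Omega : measurableType d) (R : realType)
  (P : probability Omega R).
Local Open Scope ereal_scope.

(* Round the random time down to a grid: it then takes countably many values,
   each handled by independence; Fatou's lemma passes to the limit, and the
   monotonicity of [g] absorbs the rounding. *)
Lemma random_time_le (A B : set_system Omega) (F : R -> Omega -> R)
    (phi U : Omega -> R) (g : R -> R) :
  A `<=` measurable -> B `<=` measurable -> indep P <<s A>> <<s B>> ->
  measurable_fun setT (phi : g_sigma_algebraType A -> R) ->
  measurable_fun setT (U : g_sigma_algebraType A -> R) ->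
  (forall w, 0 <= phi w)%R -> (forall w, 0 <= U w)%R ->
  (forall t, 0 <= t -> measurable_fun setT (F t : g_sigma_algebraType B -> R))%R ->
  (forall w, {within `[0%R, +oo[, continuous (fun t => F t w)}) ->
  (forall t w, 0 <= t -> 0 <= F t w)%R ->
  (forall t, (0 <= t)%R -> \int[P]_w (F t w)%:E <= (g t)%:E) ->
  measurable_fun setT g ->
  (forall s t, 0 <= s -> s <= t -> g s <= g t)%R ->
  \int[P]_w (phi w * F (U w) w)%:E <= \int[P]_w (phi w * g (U w))%:E.
Proof.
move=> mA mB AB mphi mU phi0 U0 mF cF F0 Fg mg ndg.
have mphi' := measurable_fun_sigma mA mphi.
have mU' := measurable_fun_sigma mA mU.
have mF' t : (0 <= t)%R -> measurable_fun setT (F t).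
  by move=> t0; exact: measurable_fun_sigma (mF t t0).
have g0 t : (0 <= t)%R -> (0 <= g t)%R.
  move=> t0; rewrite -lee_fin; apply: le_trans (Fg _ t0).
  by apply: integral_ge0 => w _; rewrite lee_fin F0.
have mgrid n : measurable_fun setT (fun w => F (grid n (U w)) w).
  exact: measurable_grid_time.
have mind n k : measurable [set w | truncn (n.+1%:R * U w)%R = k].
  exact: (measurable_truncn_eq (T := Omega)).
have mindA n k : measurable_fun setT
    (\1_[set w | truncn (n.+1%:R * U w)%R = k] : g_sigma_algebraType A -> R).
  by apply: measurable_indic; exact: (measurable_truncn_eq (T := g_sigma_algebraType A)).
have step n : \int[P]_w (phi w * F (grid n (U w)) w)%:E <=
              \int[P]_w (phi w * g (U w))%:E.
  pose C k := [set w | truncn (n.+1%:R * U w)%R = k].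
  pose t k : R := (k%:R / n.+1%:R)%R.
  have t0 k : (0 <= t k)%R by rewrite divr_ge0.
  have m1C k : measurable_fun setT (\1_(C k) : Omega -> R).
    by apply: measurable_indic; exact: mind.
  have decomp (h : Omega -> R) : measurable_fun setT h -> (forall w, 0 <= h w)%R ->
      \int[P]_w (h w)%:E = \sum_(k <oo) \int[P]_(w in C k) (h w)%:E.
    move=> mh h0; rewrite -ge0_integral_bigcup//.
    - congr (integral _ _ _); apply/esym/seteqP; split => // w _.
      by exists (truncn (n.+1%:R * U w)%R).
    - by move=> k; exact: mind.
    - apply: measurable_funTS; exact/measurable_EFinP.
    - by move=> w _; rewrite lee_fin.
    - by apply/trivIsetP => i j _ _ /eqP ij; apply/seteqP; split => // w [/= Ci Cj]; apply: ij; rewrite -Ci -Cj.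
  have mpF : measurable_fun setT (fun w => phi w * F (grid n (U w)) w)%R.
    exact: measurable_funM.
  have mpg : measurable_fun setT (fun w => phi w * g (U w))%R.
    by apply: measurable_funM => //; exact: measurableT_comp.
  rewrite !decomp//; last 2 first.
  - by move=> w; rewrite mulr_ge0// g0.
  - by move=> w; rewrite mulr_ge0// F0// grid_ge0.
  apply: lee_nneseries => [k _ _|k _].
    by apply: integral_ge0 => w _; rewrite lee_fin mulr_ge0// F0// grid_ge0.
  have intC (h : Omega -> R) : \int[P]_(w in C k) (h w)%:E =
      \int[P]_w (h w * \1_(C k) w)%:E.
    rewrite integral_mkcond; apply: eq_integral => w _.
    by rewrite /patch indicE; case: ifP => _; rewrite ?mulr1 ?mulr0.
  have -> : \int[P]_(w in C k) (phi w * F (grid n (U w)) w)%:E =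
      \int[P]_w (phi w * \1_(C k) w * F (t k) w)%:E.
    rewrite intC; apply: eq_integral => w _; rewrite indicE.
    have [|_] := boolP (w \in C k); rewrite ?mulr1 ?mulr0 ?mul0r//.
    by move=> /set_mem; rewrite /C /= /grid => ->.
  rewrite (ge0_expectationM_indep mA mB AB)//; last 4 first.
  - by apply: measurable_funM => //; exact: mindA.
  - by apply: mF.
  - by move=> w; rewrite mulr_ge0.
  - by move=> w; exact: F0.
  apply: (@le_trans _ _ (\int[P]_w (phi w * \1_(C k) w)%:E * (g (t k))%:E)).
    apply: lee_wpmul2l; last exact: Fg.
    by apply: integral_ge0 => w _; rewrite lee_fin mulr_ge0.
  rewrite -ge0_integralZr//; last 3 first.
  - by apply/measurable_EFinP; apply: measurable_funM.
  - by move=> w _; rewrite lee_fin mulr_ge0.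
  - by rewrite lee_fin g0.
  rewrite intC; apply: ge0_le_integral => //.
  - by move=> w _; rewrite lee_fin !mulr_ge0// g0.
  - by apply/measurable_EFinP; apply: measurable_funM => //; apply: measurable_funM.
  - by apply/measurable_EFinP; apply: measurable_funM.
  move=> w _; rewrite lee_fin indicE.
  have [|_] := boolP (w \in C k); rewrite ?mulr0 ?mul0r//.
  rewrite !mulr1 => /set_mem /= Cw; apply: ler_wpM2l => //; apply: ndg => //.
  by rewrite /t -Cw; exact: grid_le.
pose f n w := (phi w * F (grid n (U w)) w)%:E.
have fE w : (phi w * F (U w) w)%:E = limn_einf (f ^~ w).
  apply/esym; rewrite limn_einf_lim.
  have : f ^~ w @ \oo --> (phi w * F (U w) w)%:E.
    apply: cvg_EFin; first by near=> n.
    apply: cvgMr; rewrite /=.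
    apply: (@cvg_comp _ _ _ (fun n => grid n (U w)) (fun t => F t w)
      _ (within `[0%R, +oo[%classic (nbhs (U w)))).
      move=> D /= [e /= e0 He].
      have := grid_cvg (U0 w) => /cvgrPdist_lt /(_ _ e0).
      apply: filterS => n /= Hn; apply: He => //=.
      by rewrite in_itv/= grid_ge0.
    have /subspace_continuousP := cF w; apply.
    by rewrite /= in_itv/= U0.
  by move=> /cvg_einfs /cvg_lim -> //.
under eq_integral do rewrite fE.
apply: le_trans (fatou P measurableT _ _) _ => //.
- by move=> n; apply/measurable_EFinP; exact: measurable_funM.
- by move=> n w _; rewrite lee_fin mulr_ge0// F0// grid_ge0.
rewrite limn_einf_lim; apply: lime_le; first exact: is_cvg_einfs.
near=> n; apply: ereal_inf_le; exists (\int[P]_w f n w) => //; first by exists n => /=.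
exact: step.
Unshelve. all: by end_near. Qed.

End random_time_expectation.

Section stage_product.
Context (d : measure_display) (Omega : measurableType d) (R : realType)
  (P : probability Omega R) (G : nat * 'I_4 -> set_system Omega).
Hypothesis sG : forall k, sigma_algebra setT (G k).
Hypothesis mG : forall k, G k `<=` measurable.
Hypothesis Gindep : mutually_independent P G.
Variables (kT kS kX kY : 'I_4).
Hypothesis k_uniq : uniq [:: kT; kS; kX; kY].
Variables (T S : nat -> Omega -> R) (X Y : nat -> R -> Omega -> R).
Hypothesis mT : forall i,
  measurable_fun setT (T i : g_sigma_algebraType (G (i, kT)) -> R).
Hypothesis mS : forall i,
  measurable_fun setT (S i : g_sigma_algebraType (G (i, kS)) -> R).
Hypothesis mX : forall i t, 0 <= t ->
  measurable_fun setT (X i t : g_sigma_algebraType (G (i, kX)) -> R).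
Hypothesis mY : forall i t, 0 <= t ->
  measurable_fun setT (Y i t : g_sigma_algebraType (G (i, kY)) -> R).
Hypothesis T0 : forall i w, 0 <= T i w.
Hypothesis S0 : forall i w, 0 <= S i w.
Hypothesis X0 : forall i t w, 0 <= t -> 0 <= X i t w.
Hypothesis Y0 : forall i t w, 0 <= t -> 0 <= Y i t w.
Hypothesis cX : forall i w, {within `[0, +oo[, continuous (fun t => X i t w)}.
Hypothesis cY : forall i w, {within `[0, +oo[, continuous (fun t => Y i t w)}.
Variables (phi psi gx gy : R -> R).
Hypothesis mphi : measurable_fun setT phi.
Hypothesis mpsi : measurable_fun setT psi.
Hypothesis mgx : measurable_fun setT gx.
Hypothesis mgy : measurable_fun setT gy.
Hypothesis phi0 : forall x, 0 <= phi x.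
Hypothesis psi0 : forall x, 0 <= psi x.
Hypothesis gx0 : forall x, 0 <= gx x.
Hypothesis gy0 : forall x, 0 <= gy x.
Hypothesis ndgx : forall s t, 0 <= s -> s <= t -> gx s <= gx t.
Hypothesis ndgy : forall s t, 0 <= s -> s <= t -> gy s <= gy t.
Hypothesis Xgx : forall i t, 0 <= t -> (\int[P]_w (X i t w)%:E <= (gx t)%:E)%E.
Hypothesis Ygy : forall i t, 0 <= t -> (\int[P]_w (Y i t w)%:E <= (gy t)%:E)%E.

(** [G (i, k)] is the information in ingredient [k] of block [i]; [SJ J] generates the joint
    information of the ingredients in [J]. *)
Let SJ (J : set (nat * 'I_4)) : set_system Omega := \bigcup_(k in J) G k.

Let mSJ J : SJ J `<=` measurable.
Proof. by move=> A [k _ GA]; exact: mG GA. Qed.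

Let atom_sub d' (U : measurableType d') (J : set (nat * 'I_4)) k (f : Omega -> U) :
  J k -> measurable_fun setT (f : g_sigma_algebraType (G k) -> U) ->
  measurable_fun setT (f : g_sigma_algebraType (SJ J) -> U).
Proof. by move=> Jk; apply: measurable_fun_sub_sigma => A GA; exists k. Qed.

Let sub_SJ d' (U : measurableType d') (J K : set (nat * 'I_4)) (f : Omega -> U) :
  J `<=` K -> measurable_fun setT (f : g_sigma_algebraType (SJ J) -> U) ->
  measurable_fun setT (f : g_sigma_algebraType (SJ K) -> U).
Proof. by move=> JK; apply: measurable_fun_sub_sigma => A [k /JK Kk GA]; exists k. Qed.

Let indepJ J k : ~ J k -> indep P <<s SJ J>> <<s G k>>.
Proof. exact: mutually_independent_indep. Qed.

(** The shape of an exponential of a block increment: [phi] and [psi] will carry the drift and the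
    truncation of the stage lengths, [X] and [Y] the exponentials of the Gaussian noises. *)
Definition stage_factor (i : nat) (w : Omega) : R :=
  (phi (T i w) * X i (T i w) w) * (psi (S i w) * Y i (S i w) w).

Let J0 (s : seq nat) : set (nat * 'I_4) := [set k | k.1 \in s].

Let stage_factor_ge0 i w : 0 <= stage_factor i w.
Proof. by rewrite /stage_factor !mulr_ge0 ?X0 ?Y0. Qed.

Let mXT J i : J (i, kT) -> J (i, kX) -> measurable_fun setT
  ((fun w => X i (T i w) w) : g_sigma_algebraType (SJ J) -> R).
Proof.
move=> JT JX.
apply: (measurable_random_time (T := g_sigma_algebraType (SJ J)) (f := X i)) => //.
  by move=> t t0; apply: atom_sub JX _; exact: mX.
by apply: atom_sub JT _; exact: mT.
Qed.

Let mYS J i : J (i, kS) -> J (i, kY) -> measurable_fun setT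
  ((fun w => Y i (S i w) w) : g_sigma_algebraType (SJ J) -> R).
Proof.
move=> JT JX.
apply: (measurable_random_time (T := g_sigma_algebraType (SJ J)) (f := Y i)) => //.
  by move=> t t0; apply: atom_sub JX _; exact: mY.
by apply: atom_sub JT _; exact: mS.
Qed.

Let mfT J i (f : R -> R) : measurable_fun setT f -> J (i, kT) -> measurable_fun setT
  ((fun w => f (T i w)) : g_sigma_algebraType (SJ J) -> R).
Proof.
move=> mf JT; apply: (measurableT_comp (f := f) (g := T i : g_sigma_algebraType (SJ J) -> R)) => //.
by apply: atom_sub JT _; exact: mT.
Qed.

Let mfS J i (f : R -> R) : measurable_fun setT f -> J (i, kS) -> measurable_fun setT
  ((fun w => f (S i w)) : g_sigma_algebraType (SJ J) -> R).
Proof.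
move=> mf JT; apply: (measurableT_comp (f := f) (g := S i : g_sigma_algebraType (SJ J) -> R)) => //.
by apply: atom_sub JT _; exact: mS.
Qed.

Let m_stage_factor J i : (forall k, J (i, k)) ->
  measurable_fun setT (stage_factor i : g_sigma_algebraType (SJ J) -> R).
Proof.
move=> Ji; apply: (measurable_funM (T := g_sigma_algebraType (SJ J))).
  by apply: (measurable_funM (T := g_sigma_algebraType (SJ J))); [exact: mfT|exact: mXT].
by apply: (measurable_funM (T := g_sigma_algebraType (SJ J))); [exact: mfS|exact: mYS].
Qed.

Local Open Scope ereal_scope.

(* The processes are integrated out first, at the price of [gx] and [gy]; then
   the two durations split off. *)
Lemma stage_le (s : seq nat) (i : nat) (past : Omega -> R) : i \notin s ->
  measurable_fun setT (past : g_sigma_algebraType (SJ (J0 s)) -> R) ->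
  (forall w, 0 <= past w)%R ->
  \int[P]_w (past w * stage_factor i w)%:E <=
  (\int[P]_w (past w)%:E) *
  ((\int[P]_w (phi (T i w) * gx (T i w))%:E) *
   (\int[P]_w (psi (S i w) * gy (S i w))%:E)).
Proof.
move=> iS mpast past0.
move: k_uniq; rewrite /= !inE !negb_or -!andbA => /and5P[TS TX TY SX /andP[SY /andP[XY _]]].
have Ns k : ~ J0 s (i, k) by rewrite /J0 /=; apply/negP.
have NE (a b : 'I_4) : a != b -> (i, a) <> (i, b) by move=> /eqP ab [].
(* [J1], [J2] and [J4] hold the past and what remains of block [i] once [X], then [Y], then [S] is
   removed; each removed ingredient is independent of what remains. *)
pose J4 : set (nat * 'I_4) := J0 s `|` [set (i, kT)].
pose J2 : set (nat * 'I_4) := J4 `|` [set (i, kS)].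
pose J1 : set (nat * 'I_4) := J2 `|` [set (i, kY)].
have JT4 : J4 (i, kT) by right.
have JT2 : J2 (i, kT) by left.
have JS2 : J2 (i, kS) by right.
have JT1 : J1 (i, kT) by left.
have JS1 : J1 (i, kS) by left.
have JY1 : J1 (i, kY) by right.
have s4 : J0 s `<=` J4 by move=> k ?; left.
have s2 : J0 s `<=` J2 by move=> k ?; do 2 left.
have s1 : J0 s `<=` J1 by move=> k ?; do 3 left.
have N1 : ~ J1 (i, kX).
  case; last exact: NE.
  case; last by apply: NE; rewrite eq_sym.
  by case; [exact: Ns|apply: NE; rewrite eq_sym].
have N2 : ~ J2 (i, kY).
  case; last by apply: NE; rewrite eq_sym.
  by case; [exact: Ns|apply: NE; rewrite eq_sym].
have N4 : ~ J4 (i, kS).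
  by case; [exact: Ns|apply: NE; rewrite eq_sym].
have mGk k : G k `<=` measurable by exact: mG.
have mM J (f g : Omega -> R) : measurable_fun setT (f : g_sigma_algebraType (SJ J) -> R) ->
   measurable_fun setT (g : g_sigma_algebraType (SJ J) -> R) ->
   measurable_fun setT ((fun w => f w * g w)%R : g_sigma_algebraType (SJ J) -> R).
  exact: (measurable_funM (T := g_sigma_algebraType (SJ J))).
pose f1 w := (past w * phi (T i w) * (psi (S i w) * Y i (S i w) w))%R.
apply: (@le_trans _ _ (\int[P]_w (f1 w * X i (T i w) w)%:E)).
  rewrite le_eqVlt; apply/orP; left; apply/eqP; apply: eq_integral => w _.
  by rewrite /f1 /stage_factor; congr (_%:E); ring.
apply: (@le_trans _ _ (\int[P]_w (f1 w * gx (T i w))%:E)).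
  apply: (random_time_le (mSJ (J := J1)) (mGk _) (indepJ N1)) => //.
  - apply: (mM _); first by apply: (mM _); [exact: sub_SJ s1 mpast|exact: mfT].
    by apply: (mM _); [exact: mfS|exact: mYS].
  - by apply: atom_sub JT1 _; exact: mT.
  - by move=> w; rewrite /f1 !mulr_ge0 ?Y0.
  - by move=> t t0; exact: mX.
  - by move=> t w t0; exact: X0.
  - by move=> t t0; exact: Xgx.
pose f2 w := (past w * (phi (T i w) * gx (T i w)) * psi (S i w))%R.
apply: (@le_trans _ _ (\int[P]_w (f2 w * Y i (S i w) w)%:E)).
  rewrite le_eqVlt; apply/orP; left; apply/eqP; apply: eq_integral => w _.
  by rewrite /f1 /f2; congr (_%:E); ring.
apply: (@le_trans _ _ (\int[P]_w (f2 w * gy (S i w))%:E)).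
  apply: (random_time_le (mSJ (J := J2)) (mGk _) (indepJ N2)) => //.
  - apply: (mM _); last exact: mfS.
    by apply: (mM _); [exact: sub_SJ s2 mpast|apply: (mM _); exact: mfT].
  - by apply: atom_sub JS2 _; exact: mS.
  - by move=> w; rewrite /f2 !mulr_ge0.
  - by move=> t t0; exact: mY.
  - by move=> t w t0; exact: Y0.
  - by move=> t t0; exact: Ygy.
have mTk (f : R -> R) : measurable_fun setT f -> measurable_fun setT
    ((fun w => f (T i w)) : g_sigma_algebraType (G (i, kT)) -> R).
  move=> mf; exact: (measurableT_comp (f := f) (g := T i : g_sigma_algebraType _ -> R)).
have mSk (f : R -> R) : measurable_fun setT f -> measurable_fun setT
    ((fun w => f (S i w)) : g_sigma_algebraType (G (i, kS)) -> R).
  move=> mf; exact: (measurableT_comp (f := f) (g := S i : g_sigma_algebraType _ -> R)).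
rewrite le_eqVlt; apply/orP; left; apply/eqP.
transitivity (\int[P]_w ((past w * (phi (T i w) * gx (T i w))) *
                        (psi (S i w) * gy (S i w)))%:E).
  by apply: eq_integral => w _; rewrite /f2 -!mulrA.
rewrite (ge0_expectationM_indep (mSJ (J := J4)) (mGk _) (indepJ N4))//; last 4 first.
- by apply: (mM _); [exact: sub_SJ s4 mpast|apply: (mM _); exact: mfT].
- apply: (mSk (fun x => psi x * gy x)%R); exact: measurable_funM.
- by move=> w; rewrite !mulr_ge0.
- by move=> w; rewrite !mulr_ge0.
rewrite (ge0_expectationM_indep (mSJ (J := J0 s)) (mGk _) (indepJ (Ns kT)))//; last 2 first.
- apply: (mTk (fun x => phi x * gx x)%R); exact: measurable_funM.
- by move=> w; rewrite !mulr_ge0.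
by rewrite muleA.
Qed.

Lemma stage_product_le (s : seq nat) : uniq s ->
  \int[P]_w (\prod_(i <- s) stage_factor i w)%:E <=
  \prod_(i <- s) ((\int[P]_w (phi (T i w) * gx (T i w))%:E) *
   (\int[P]_w (psi (S i w) * gy (S i w))%:E)).
Proof.
have pge0 t w : (0 <= \prod_(i <- t) stage_factor i w)%R.
  by apply: prodr_ge0 => i _; exact: stage_factor_ge0.
have mp t : measurable_fun setT ((fun w => \prod_(i <- t) stage_factor i w)%R :
     g_sigma_algebraType (SJ (J0 t)) -> R).
  apply: (measurable_prod (T := g_sigma_algebraType (SJ (J0 t)))) => i it.
  by apply: m_stage_factor.
elim: s => [|i s IH].
  rewrite big_nil; under eq_integral do rewrite big_nil.
  by move=> _; rewrite integral_cst// mul1e; exact: probability_le1.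
rewrite /= => /andP[iS us]; rewrite big_cons.
under eq_integral do rewrite big_cons mulrC.
apply: le_trans (stage_le iS (mp s) (pge0 s)) _.
rewrite muleC; apply: lee_wpmul2l; last exact: IH.
by apply: mule_ge0; apply: integral_ge0 => w _; rewrite lee_fin mulr_ge0.
Qed.

End stage_product.

Section mutual_independence.
Context (d : measure_display) (Omega : measurableType d) (R : realType)
  (P : probability Omega R).

Lemma mutually_independent_sub (I : choiceType) (F F' : I -> set_system Omega) :
  (forall i, F' i `<=` F i) -> mutually_independent P F ->
  mutually_independent P F'.
Proof. by move=> FF' + J A AF => ->// i /AF /FF'. Qed.

(** The events are regrouped by their second coordinate: those of column [k] intersect to an event
    [C k] of [G k]. Independence of the [G k] splits the columns, and independence inside each
    column splits the rest. *)
Lemma mutually_independent_prod (I K : choiceType)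
    (F : I * K -> set_system Omega) (G : K -> set_system Omega) :
  (forall k, sigma_algebra setT (G k)) ->
  (forall i k, F (i, k) `<=` G k) ->
  (forall k, mutually_independent P (fun i => F (i, k))) ->
  mutually_independent P G -> mutually_independent P F.
Proof.
move=> sG FG Findep Gindep J A AF.
pose Jk k := [fset a in J | a.2 == k]%fset.
pose C k := \bigcap_(i in [set` (fst @` Jk k)%fset]) A (i, k).
have GC k : G k (C k).
  have E := sigma_algebra_id (sG k); rewrite -E.
  apply: (@fin_bigcap_measurable _ (g_sigma_algebraType (G k))) => //.
  move=> i /= /imfsetP [[i' k'] /=]; rewrite !inE /= => /andP[aJ /eqP k'k] ->.
  rewrite /measurable /= E; apply: (FG i').
  by rewrite -k'k; apply: AF.
transitivity (pr P (\bigcap_(k in [set` (snd @` J)%fset]) C k)).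
  congr (pr P _); apply/seteqP; split => [w H k _ i /=|w H [i k] /= aJ].
    move/imfsetP => [[i' k'] /=]; rewrite !inE /= => /andP[aJ /eqP k'k] ->.
    by rewrite -k'k; exact: H.
  apply: (H k); first by apply/imfsetP; exists (i, k).
  by apply/imfsetP; exists (i, k) => //; rewrite !inE /= aJ /=.
rewrite Gindep; last by move=> k _; exact: GC.
rewrite (partition_big_imfset _ (snd : I * K -> K)) /=.
apply: eq_bigr => k _.
rewrite /C (Findep k (fst @` Jk k)%fset (fun i => A (i, k))); last first.
  move=> i /imfsetP [[i' k'] /=]; rewrite !inE /= => /andP[aJ /eqP k'k] ->.
  by rewrite -k'k; exact: AF.
rewrite big_imfset/=; last first.
  move=> [i k1] [i' k2]; rewrite !inE /= => /andP[_ /eqP ->] /andP[_ /eqP ->].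
  by move=> ->.
rewrite -big_fset_condE /=.
by apply: eq_bigr => -[i k'] /= /eqP ->.
Qed.

End mutual_independence.

Section model_atoms.
Context (d : measure_display) (Omega : measurableType d) (R : realType)
  (P : probability Omega R).
Variables (Tn Sn : nat -> {RV P >-> R}) (Xn Yn : nat -> 'I_2 -> R -> {RV P >-> R}).

Definition sigma_rv (X : Omega -> R) : set_system Omega :=
  sigma_of setT (fun _ : unit => X).

(** The codes 0 to 3 stand for [T], [S], [X], [Y]. Both coordinates of a process form one atom,
    since each estimate of sums concerns one coordinate at a time. *)
Definition atoms (k : nat * 'I_4) : set_system Omega :=
  match val k.2 with
  | 0 => sigma_rv (Tn k.1)
  | 1 => sigma_rv (Sn k.1)
  | 2 => sigma_of (@nonneg_time R) (uncurried (Xn k.1))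
  | _ => sigma_of (@nonneg_time R) (uncurried (Yn k.1))
  end.

Lemma sigma_of_measurable (I : Type) (D : set I) (F : I -> Omega -> R) :
  (forall i, D i -> measurable_fun setT (F i)) -> sigma_of D F `<=` measurable.
Proof.
move=> mF; apply: smallest_sub; first exact: sigma_algebra_measurable.
by move=> _ [i Di [B mB <-]]; exact: mF.
Qed.

Lemma sigma_of_sub (I I' : Type) (D : set I) (F : I -> Omega -> R)
    (D' : set I') (F' : I' -> Omega -> R) :
  (forall i, D i -> exists2 j, D' j & F i = F' j) ->
  sigma_of D F `<=` sigma_of D' F'.
Proof.
move=> DD'; apply: sub_sigma_algebra2 => A [i Di FA].
by have [j Dj E] := DD' i Di; exists j => //; rewrite -E.
Qed.

Lemma atoms_sigma_algebra k : sigma_algebra setT (atoms k).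
Proof.
by case: k => i [[|[|[|[|k]]]] //= hk]; rewrite /atoms /=;
  exact: smallest_sigma_algebra.
Qed.

Lemma atoms_measurable k : atoms k `<=` measurable.
Proof.
by case: k => i [[|[|[|[|k]]]] //= hk]; rewrite /atoms /=;
  apply: sigma_of_measurable.
Qed.

Lemma measurable_sigma_of (I : Type) (D : set I) (F : I -> Omega -> R) i : D i ->
  measurable_fun setT (F i : g_sigma_algebraType (sigma_of D F) -> R).
Proof.
move=> Di _ B mB; rewrite setTI; apply: sub_sigma_algebra.
by apply: sub_sigma_algebra; exists i => //; exists B => //; rewrite setTI.
Qed.

Lemma measurable_atomT i (o : 'I_4) : val o = 0%N ->
  measurable_fun setT (Tn i : g_sigma_algebraType (atoms (i, o)) -> R).
Proof.
case: o => -[|//] ? _; exact: (@measurable_sigma_of unit setT (fun=> Tn i) tt).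
Qed.

Lemma measurable_atomS i (o : 'I_4) : val o = 1%N ->
  measurable_fun setT (Sn i : g_sigma_algebraType (atoms (i, o)) -> R).
Proof.
case: o => -[//|[|//]] ? _; exact: (@measurable_sigma_of unit setT (fun=> Sn i) tt).
Qed.

Lemma measurable_atomX i j t (o : 'I_4) : val o = 2%N -> 0 <= t ->
  measurable_fun setT (Xn i j t : g_sigma_algebraType (atoms (i, o)) -> R).
Proof.
case: o => -[|[|[|//]]]// ? _ t0.
exact: (@measurable_sigma_of _ (@nonneg_time R) (uncurried (Xn i)) (j, t)).
Qed.

Lemma measurable_atomY i j t (o : 'I_4) : val o = 3%N -> 0 <= t ->
  measurable_fun setT (Yn i j t : g_sigma_algebraType (atoms (i, o)) -> R).
Proof.
case: o => -[|[|[|[|//]]]]// ? _ t0.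
exact: (@measurable_sigma_of _ (@nonneg_time R) (uncurried (Yn i)) (j, t)).
Qed.

(** Independence between columns is the independence of the four families; inside the columns of [T]
    and [S] it is inherited from that of the pairs. *)
Lemma atoms_indep :
  mutually_independent P (fun i : nat =>
    sigma_of setT (fun b : bool => if b then Tn i else Sn i)) ->
  mutually_independent P (fun i => sigma_of (@nonneg_time R) (uncurried (Xn i))) ->
  mutually_independent P (fun i => sigma_of (@nonneg_time R) (uncurried (Yn i))) ->
  mutually_independent P (fun k : 'I_4 => nth set0
    [:: sigma_of setT Tn; sigma_of setT Sn;
        sigma_of_processes Xn; sigma_of_processes Yn] k) ->
  mutually_independent P atoms.
Proof.
move=> TSi Xi Yi Gi; apply: mutually_independent_prod Gi.
- by case=> -[|[|[|[|k]]]] //= hk; exact: smallest_sigma_algebra.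
- move=> i [[|[|[|[|k]]]] //= hk]; rewrite /atoms /=; apply: sigma_of_sub.
  + by move=> _ _; exists i.
  + by move=> _ _; exists i.
  + by move=> k kt; exists (i, k).
  + by move=> k kt; exists (i, k).
- case=> -[|[|[|[|k]]]] //= hk; rewrite /atoms /=.
  + apply: mutually_independent_sub TSi => i; apply: sigma_of_sub.
    by move=> _ _; exists true.
  + apply: mutually_independent_sub TSi => i; apply: sigma_of_sub.
    by move=> _ _; exists false.
Qed.

End model_atoms.

(** * Gaussian estimates *)

Section expR_bounds.
Context (R : realType).
Implicit Types (z m s : R).

Lemma expR_le1D3 z : 0 <= z <= 1 -> expR z <= 1 + 3 * z.
Proof.
move=> /andP[z0 z1].
have H : 1 - z / 2 <= expR (- (z / 2)) by have := expR_ge1Dx (- (z / 2)).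
have -> : expR z = (expR (- (z / 2)))^-1 ^+ 2.
  by rewrite -expRN opprK -expRM_natr; congr expR; field.
have hp : 0 < 1 - z / 2 by lra.
apply: (@le_trans _ _ ((1 - z / 2)^-1 ^+ 2)).
  by rewrite lerXn2r ?nnegrE ?invr_ge0 ?expR_ge0 ?(ltW hp)// lef_pV2 ?posrE ?expR_gt0.
rewrite exprVn -[leLHS]mul1r ler_pdivrMr ?exprn_gt0//.
(* This product equals [(1 + 3 * z) * (1 - z / 2) ^+ 2 - 1]. *)
have : 0 <= z * (1 - z) * (2 - 3 / 4 * z) by rewrite !mulr_ge0//; lra.
by rewrite expr2; lra.
Qed.

Lemma exprn_le_expR (k : nat) z : (0 < k)%N -> 0 <= z ->
  k%:R^-1 ^+ k * z ^+ k <= expR z.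
Proof.
move=> k0 z0; rewrite -exprMn.
have kR : 0 < k%:R :> R by rewrite ltr0n.
have -> : expR z = expR (k%:R^-1 * z) ^+ k.
  by rewrite -expRM_natr; congr expR; field; rewrite gt_eqF.
rewrite lerXn2r ?nnegrE ?expR_ge0 ?mulr_ge0 ?invr_ge0//.
by have := expR_ge1Dx (k%:R^-1 * z); lra.
Qed.

(** For [h = - e * m] with small [e], the left side gains [e * m ^+ 2], of first order in [e],
    whereas the right side exceeds 1 only by a second-order term. *)
Lemma mean0_of_mgf m s :
  (forall h, 1 - h * m <= expR (h ^+ 2 * s ^+ 2 / 2)) -> m = 0.
Proof.
move=> H; apply/eqP/negPn/negP => m0.
have m2 : 0 < m ^+ 2 by rewrite lt_neqAle eq_sym sqrf_eq0 m0 sqr_ge0.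
have s2 := sqr_ge0 s.
have D : 0 < (1 + m ^+ 2) * (1 + 2 * s ^+ 2) by nra.
(* This makes [p = e * m ^+ 2] at most 1 and [q = e * s ^+ 2] at most 1/2, whence
   [expR (p * q / 2) <= 1 + 3 / 4 * p], which is less than [1 + p]. *)
pose e := ((1 + m ^+ 2) * (1 + 2 * s ^+ 2))^-1.
have e0 : 0 < e by rewrite invr_gt0.
have eD : e * ((1 + m ^+ 2) * (1 + 2 * s ^+ 2)) = 1 by rewrite mulVf ?gt_eqF.
have em : e * m ^+ 2 <= 1.
  have := mulr_ge0 (ltW e0) s2; have := mulr_ge0 (mulr_ge0 (ltW e0) s2) (ltW m2); lra.
have es : e * s ^+ 2 <= 2^-1.
  have := mulr_gt0 e0 m2; have := mulr_ge0 (mulr_ge0 (ltW e0) s2) (ltW m2); lra.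
have := H (- (e * m)).
have es0 : 0 <= e * s ^+ 2 by rewrite mulr_ge0// ltW.
have em0 : 0 < e * m ^+ 2 by rewrite mulr_gt0.
have -> : (- (e * m)) ^+ 2 * s ^+ 2 / 2 = (e * m ^+ 2) * (e * s ^+ 2) / 2 by ring.
have -> : 1 - - (e * m) * m = 1 + e * m ^+ 2 by ring.
set p := e * m ^+ 2 in em em0 *; set q := e * s ^+ 2 in es es0 *.
have : expR (p * q / 2) <= 1 + 3 * (p * q / 2).
  apply: expR_le1D3; apply/andP; split; first by rewrite divr_ge0// mulr_ge0// ltW.
  by nra.
nra.
Qed.

End expR_bounds.

Section normal_mgf.
Context (R : realType).
Local Notation mu := (@lebesgue_measure R).
Local Open Scope ereal_scope.

Lemma ge0_integral_normal_prob (m s : R) (f : R -> \bar R) :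
  measurable_fun setT f -> (forall x, 0 <= f x) ->
  \int[normal_prob m s]_x f x = \int[mu]_x (f x * (normal_pdf m s x)%:E).
Proof.
move=> mf f0.
have dom : normal_prob m s `<< mu by exact: normal_prob_dominates.
rewrite -(Radon_Nikodym_SigmaFinite.change_of_variables dom f0 measurableT mf).
have mpdf : measurable_fun setT (fun x => (normal_pdf m s x)%:E).
  by apply/measurable_EFinP; exact: measurable_normal_pdf.
have intRN := Radon_Nikodym_SigmaFinite.f_integrable dom.
apply: ae_eq_integral => //.
- by apply: emeasurable_funM => //; exact: measurable_int intRN.
- exact: emeasurable_funM.
apply: ae_eqe_mul2l; apply: integral_ae_eq => //.
by move=> E _ mE; rewrite -Radon_Nikodym_SigmaFinite.f_integral.
Qed.

(** Completing the square: the exponential weight shifts the mean of the density by [h * s ^+ 2],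
    and the shifted density again has integral 1. *)
Lemma normal_mgf (m s h : R) : s != 0%R ->
  \int[normal_prob m s]_x (expR (h * (x - m)))%:E =
  (expR (h ^+ 2 * s ^+ 2 / 2))%:E.
Proof.
move=> s0; rewrite ge0_integral_normal_prob; last 2 first.
- apply/measurable_EFinP; apply: measurableT_comp => //.
  by apply: measurable_funM => //; exact: measurable_funB.
- by move=> x; rewrite lee_fin expR_ge0.
transitivity (\int[mu]_x ((expR (h ^+ 2 * s ^+ 2 / 2))%:E *
    (normal_pdf (m + h * s ^+ 2) s x)%:E)).
  apply: eq_integral => x _; rewrite -!EFinM; congr (_%:E).
  rewrite !normal_pdfE//= mulrCA [RHS]mulrCA; congr (_ * _)%R.
  rewrite /normal_fun -!expRD; congr expR.
  by field.
have mpdf : measurable_fun setT (fun x => (normal_pdf (m + h * s ^+ 2) s x)%:E).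
  by apply/measurable_EFinP; exact: measurable_normal_pdf.
rewrite ge0_integralZl//.
- by rewrite integral_normal_pdf mule1.
- by move=> x _; rewrite lee_fin normal_pdf_ge0.
Qed.

Lemma normal_prob_interval_le (m s r : R) : s != 0%R -> (0 <= r)%R ->
  normal_prob m s `[(- r)%R, r]%classic <= (normal_peak s * (2 * r))%:E.
Proof.
move=> s0 r0; rewrite /normal_prob.
apply: (@le_trans _ _ (\int[mu]_(x in `[(- r)%R, r]) (normal_peak s)%:E)).
  apply: ge0_le_integral => //.
  - by move=> x _; rewrite lee_fin normal_pdf_ge0.
  - by apply/measurable_EFinP; apply: measurable_funTS; exact: measurable_normal_pdf.
  - by move=> x _; rewrite lee_fin normal_pdf_ub.
rewrite integral_cst//= lebesgue_measure_itv/=.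
case: ifPn => _; last by rewrite mule0 lee_fin !mulr_ge0// normal_peak_ge0.
by rewrite -EFinD -EFinM lee_fin; rewrite le_eqVlt; apply/orP; left; apply/eqP; ring.
Qed.

End normal_mgf.

Lemma prob_integral (d : measure_display) (Omega : measurableType d)
    (R : realType) (P : probability Omega R) (A : set Omega) : measurable A ->
  P A = (\int[P]_w (\1_A w)%:E)%E.
Proof. by move=> mA; rewrite integral_indic// setIT. Qed.

Section gaussian.
Context (d : measure_display) (Omega : measurableType d) (R : realType)
  (P : probability Omega R).
Variable X : Omega -> R.
Hypothesis mX : measurable_fun setT X.
Local Open Scope ereal_scope.

Let gaussian_mgf_param (m s : R) :
  (forall A : set R, measurable A ->
    P (X @^-1` A) = if s == 0%R then \d_m A else normal_prob m s A) ->
  forall h : R, \int[P]_w (expR (h * (X w - m)))%:E = (expR (h ^+ 2 * s ^+ 2 / 2))%:E.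
Proof.
move=> XP h.
have mf : measurable_fun setT (fun x : R => (expR (h * (x - m)))%:E).
  apply/measurable_EFinP; apply: measurableT_comp => //.
  by apply: measurable_funM => //; exact: measurable_funB.
have f0 x : 0 <= (expR (h * (x - m)))%:E by rewrite lee_fin expR_ge0.
have mX' : measurable_fun setT (X : Omega -> measurableTypeR R) by exact: mX.
pose X' : {mfun Omega >-> measurableTypeR R} :=
  HB.pack (X : Omega -> measurableTypeR R)
    (isMeasurableFun.Build _ _ Omega (measurableTypeR R) X mX').
transitivity (\int[distribution P X']_x (expR (h * (x - m)))%:E).
  by rewrite ge0_integral_distribution.
have [s0|s0] := eqVneq s 0%R.
  transitivity (\int[\d_(m : measurableTypeR R)]_x (expR (h * (x - m)))%:E).
    by apply: eq_measure_integral => A mA _; move: (XP A mA); rewrite s0 eqxx.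
  by rewrite integral_dirac// diracT mul1e subrr mulr0 s0 expr0n/= mulr0 mul0r.
transitivity (\int[normal_prob m s]_x (expR (h * (x - m)))%:E).
  apply: (@eq_measure_integral _ (measurableTypeR R) R setT (normal_prob m s) (distribution P X')).
  by move=> A mA _; move: (XP A mA); rewrite (negbTE s0).
exact: normal_mgf.
Qed.

Let gaussian_integrable (m s : R) :
  (forall h : R, \int[P]_w (expR (h * (X w - m)))%:E = (expR (h ^+ 2 * s ^+ 2 / 2))%:E) ->
  P.-integrable setT (EFin \o X).
Proof.
move=> mgf; have mgf1 := mgf 1%R; have mgfN := mgf (-1)%R.
have mE (h : R) : measurable_fun setT (fun w => (expR (h * (X w - m)))%:E).
  apply/measurable_EFinP; apply: measurableT_comp => //.
  by apply: measurable_funM => //; exact: measurable_funB.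
apply/integrableP; split; first exact/measurable_EFinP.
apply: (@le_lt_trans _ _ (\int[P]_w ((expR (1 * (X w - m)))%:E +
   (expR (-1 * (X w - m)))%:E + `|m|%:E))).
  apply: ge0_le_integral => //.
  - by apply/measurableT_comp => //; exact/measurable_EFinP.
  - by apply: emeasurable_funD => //; exact: emeasurable_funD.
  move=> w _; rewrite -!EFinD lee_fin mul1r mulN1r.
  have h1 := expR_ge1Dx (X w - m); have h2 := expR_ge1Dx (- (X w - m)).
  have h3 := expR_ge0 (X w - m); have h4 := expR_ge0 (- (X w - m)).
  have : (X w = (X w - m) + m)%R by rewrite subrK.
  move=> {1}->; apply: le_trans (ler_normD _ _) _; rewrite lerD2r.
  by rewrite ler_norml; apply/andP; split; lra.
rewrite ge0_integralD//; last 2 first.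
- by move=> w _; rewrite adde_ge0// lee_fin expR_ge0.
- exact: emeasurable_funD.
rewrite ge0_integralD//.
rewrite mgf1 mgfN integral_cst// -EFinD -ge0_fin_numE.
  by rewrite fin_numD/= fin_numM// fin_num_measure.
by rewrite adde_ge0 ?lee_fin ?addr_ge0 ?expR_ge0// mule_ge0// lee_fin.
Qed.

(** The parameters [m] and [s] in [gaussian] are not tied to moments by definition. The bound
    [1 + x <= expR x] under the integral gives [m = 0]; boundedness of the density gives
    [s ^+ 2 <= 8 * v], which is where the factor 4 comes from. *)
Lemma gaussian_mgf_le (v : R) : gaussian P X -> 'E_P[X] = 0 ->
  \int[P]_w (X w ^+ 2)%:E = v%:E ->
  forall h : R, \int[P]_w (expR (h * X w))%:E <= (expR (4 * h ^+ 2 * v))%:E.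
Proof.
move=> [m [s XP]] EX0 EX2.
have mgf := gaussian_mgf_param XP.
have iX := gaussian_integrable mgf.
have EX h : (1 - h * m <= expR (h ^+ 2 * s ^+ 2 / 2))%R.
  rewrite -lee_fin -mgf.
  apply: (@le_trans _ _ (\int[P]_w ((1 - h * m)%:E + h%:E * (X w)%:E))).
    rewrite integralD//; last 2 first.
    - exact: finite_measure_integrable_cst.
    - exact: integrableZl.
    rewrite integral_cst// integralZl//.
    move: EX0; rewrite unlock => ->.
    by rewrite mule0 adde0 [X in _ * X](_ : _ = 1) ?mule1//; exact: probability_setT.
  apply: le_integral => //.
  - apply: integrableD => //; first exact: finite_measure_integrable_cst.
    exact: integrableZl.
  - apply/integrableP; split.
      apply/measurable_EFinP; apply: measurableT_comp => //.
      by apply: measurable_funM => //; exact: measurable_funB.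
    under eq_integral do rewrite gee0_abs ?lee_fin ?expR_ge0//.
    by rewrite mgf ltry.
  move=> w _; rewrite -EFinM -EFinD lee_fin.
  by have := expR_ge1Dx (h * (X w - m)); lra.
have m0 : m = 0%R := mean0_of_mgf EX.
have sv : (s ^+ 2 <= 8 * v)%R.
  have [->|s0] := eqVneq s 0%R.
    rewrite expr0n/= mulr_ge0// -lee_fin -EX2.
    by apply: integral_ge0 => w _; rewrite lee_fin sqr_ge0.
  (* The density is at most [normal_peak s], so the interval of half-length [r] has mass at most
     1/2. Hence [v] is at least [r ^+ 2 / 2], that is [s ^+ 2 * pi / 16]. *)
  pose r := ((normal_peak s)^-1 / 4)%R.
  have pk := normal_peak_gt0 s0.
  have r0 : (0 < r)%R by rewrite divr_gt0// invr_gt0.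
  pose A := X @^-1` `[(- r)%R, r]%classic.
  have mA : measurable A by rewrite -[A]setTI; exact: mX.
  have PA : P A <= (2^-1)%:E.
    rewrite XP// (negbTE s0); apply: le_trans (normal_prob_interval_le m s0 (ltW r0)) _.
    rewrite lee_fin /r le_eqVlt; apply/orP; left; apply/eqP; field.
    by rewrite gt_eqF.
  have H : (r ^+ 2)%:E <= v%:E + (r ^+ 2)%:E * P A.
    apply: (@le_trans _ _ (\int[P]_w (r ^+ 2)%:E)).
      rewrite integral_cst// [X in _ * X](_ : _ = 1) ?mule1//.
      exact: probability_setT.
    rewrite -EX2 (prob_integral P mA) -ge0_integralZl//; last 2 first.
    - by apply/measurable_EFinP; exact: measurable_indic.
    - by rewrite lee_fin sqr_ge0.
    rewrite -ge0_integralD//; last 4 first.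
    - by move=> w _; rewrite lee_fin sqr_ge0.
    - by apply/measurable_EFinP; exact: measurable_funX.
    - by move=> w _; rewrite mule_ge0// lee_fin// sqr_ge0.
    - by apply: measurable_funeM; apply/measurable_EFinP; exact: measurable_indic.
    apply: ge0_le_integral => //.
    - by move=> w _; rewrite lee_fin sqr_ge0.
    - apply: emeasurable_funD; first by apply/measurable_EFinP; exact: measurable_funX.
      by apply: measurable_funeM; apply/measurable_EFinP; exact: measurable_indic.
    move=> w _; rewrite -EFinM -EFinD lee_fin indicE.
    have [wA|wA] := boolP (w \in A); first by rewrite mulr1 lerDr sqr_ge0.
    rewrite mulr0 addr0 -[leRHS]real_normK ?num_real//.
    rewrite lerXn2r ?nnegrE ?normr_ge0// ?ltW//.
    rewrite ltNge; apply/negP => Xr; move/negP: wA; apply.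
    by apply/mem_set; rewrite /A /= in_itv/= -ler_norml.
  have : (r ^+ 2 <= v + r ^+ 2 * 2^-1)%R.
    rewrite -lee_fin [leRHS]EFinD; apply: le_trans H _.
    by apply: leeD2l; rewrite [leRHS]EFinM; apply: lee_wpmul2l => //; rewrite lee_fin sqr_ge0.
  have -> : (r ^+ 2 = s ^+ 2 * pi / 8)%R.
    rewrite /r /normal_peak invrK exprMn sqr_sqrtr ?mulr_ge0 ?mulrn_wge0 ?sqr_ge0 ?pi_ge0//.
      by rewrite -mulr_natr; field.
    by rewrite mulr_ge0 ?sqr_ge0 ?pi_ge0.
  have := pi_ge2 R; have := sqr_ge0 s; nra.
move=> h; under eq_integral do rewrite -[X in (h * X)%R]subr0.
move: mgf; rewrite m0 => ->; rewrite lee_fin ler_expR.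
have := sqr_ge0 h; nra.
Qed.

(** At the rates [1 / v] and [- 1 / v] the exponential moment is at most [expR 4], whatever [v]; the
    bound [(z / k) ^+ k <= expR z] turns this into a power tail of any order [k], with the scaling
    [v / y] needed for chaining. *)
Lemma gaussian_tail_le (v : R) : gaussian P X -> 'E_P[X] = 0 ->
  \int[P]_w (X w ^+ 2)%:E = (v ^+ 2)%:E -> (0 <= v)%R ->
  forall (k : nat) (y : R), (0 < y)%R -> (0 < k)%N ->
  P [set w | (y < `|X w|)%R] <= (2 * expR 4 * k%:R ^+ k * (v / y) ^+ k)%:E.
Proof.
move=> GX EX0 EX2 v0 k y y0 k0.
have mE (h : R) : measurable_fun setT (fun w => expR (h * X w)).
  by apply: measurableT_comp => //; exact: measurable_funM.
have my : measurable [set w | (y < `|X w|)%R].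
  rewrite -[X in measurable X]setTI; apply: measurable_fun_ltr => //.
  exact: measurableT_comp.
have mgf := gaussian_mgf_le GX EX0 EX2.
(* The rate [1 / v] is meaningless for [v = 0]; there Chebyshev's inequality gives probability
   zero. *)
have [v_eq0|v_neq0] := eqVneq v 0%R.
  have X0 : \int[P]_w (X w ^+ 2)%:E = 0 by rewrite EX2 v_eq0 expr0n.
  have : P [set w | (y < `|X w|)%R] <= 0.
    apply: (@le_trans _ _ ((y ^- 2)%:E * \int[P]_w (X w ^+ 2)%:E)); last first.
      by rewrite X0 mule0.
    rewrite -ge0_integralZl//; last 3 first.
    - by apply/measurable_EFinP; exact: measurable_funX.
    - by move=> w _; rewrite lee_fin sqr_ge0.
    - by rewrite lee_fin invr_ge0 exprn_ge0// ltW.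
    rewrite (prob_integral P my); apply: ge0_le_integral => //.
    - by apply/measurable_EFinP; exact: measurable_indic.
    - by apply: measurable_funeM; apply/measurable_EFinP; exact: measurable_funX.
    move=> w _; rewrite -EFinM lee_fin indicE.
    have [/set_mem /= wy|_] := boolP (w \in _).
      rewrite mulrC ler_pdivlMr ?exprn_gt0// mul1r -[leRHS]real_normK ?num_real//.
      by rewrite lerXn2r ?nnegrE ?normr_ge0// ltW.
    by rewrite mulr_ge0 ?sqr_ge0// invr_ge0 exprn_ge0// ltW.
  move=> /le_trans; apply; rewrite lee_fin !mulr_ge0 ?expR_ge0 ?exprn_ge0//.
  by rewrite divr_ge0// ltW.
have {v_neq0}v_gt0 : (0 < v)%R by rewrite lt_neqAle eq_sym v_neq0.
have kv : (0 < y / v)%R by rewrite divr_gt0.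
pose c := (k%:R ^+ k * (v / y) ^+ k)%R.
have c0 : (0 <= c)%R by rewrite mulr_ge0 ?exprn_ge0// divr_ge0// ltW.
apply: (@le_trans _ _ (\int[P]_w (c%:E *
    ((expR (v^-1 * X w))%:E + (expR (- v^-1 * X w))%:E)))).
  rewrite (prob_integral P my); apply: ge0_le_integral => //.
  - by apply/measurable_EFinP; exact: measurable_indic.
  - apply: measurable_funeM; apply: emeasurable_funD; exact/measurable_EFinP.
  move=> w _; rewrite -EFinD -EFinM lee_fin indicE.
  have e0 := expR_ge0 (v^-1 * X w); have e1 := expR_ge0 (- v^-1 * X w).
  have [/set_mem /= wy|_] := boolP (w \in _); last by rewrite mulr_ge0// addr_ge0.
  apply: (@le_trans _ _ (c * expR (v^-1 * `|X w|)))%R; last first.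
    apply: ler_wpM2l => //; case: (ger0P (X w)) => _; first by rewrite lerDl.
    by rewrite mulrN -mulNr lerDr.
  have H := exprn_le_expR k0 (_ : (0 <= v^-1 * `|X w|)%R).
  apply: (@le_trans _ _ (c * ((k%:R)^-1 ^+ k * (y / v) ^+ k))%R).
    rewrite /c mulrACA -!exprMn (_ : _ * _ = 1)%R ?expr1n//.
    by field; rewrite !gt_eqF// ltr0n.
  apply: ler_wpM2l => //; apply: le_trans (H _); last first.
    by rewrite mulr_ge0 ?invr_ge0// ltW.
  apply: ler_wpM2l; first by rewrite exprn_ge0// invr_ge0.
  rewrite lerXn2r ?nnegrE ?mulr_ge0 ?invr_ge0// ?ltW//.
  by rewrite mulrC ltr_pM2l// invr_gt0.
rewrite ge0_integralZl//; last 2 first.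
- by apply: emeasurable_funD; exact/measurable_EFinP.
- by move=> w _; rewrite -EFinD lee_fin addr_ge0// expR_ge0.
rewrite ge0_integralD//; [|exact/measurable_EFinP|exact/measurable_EFinP].
apply: (@le_trans _ _ (c%:E * ((expR 4)%:E + (expR 4)%:E))).
  apply: lee_wpmul2l => //; apply: leeD.
    apply: le_trans (mgf (v^-1)%R) _; rewrite lee_fin exprVn -mulrA mulVf ?mulr1//.
    by rewrite expf_neq0// gt_eqF.
  apply: le_trans (mgf (- v^-1)%R) _; rewrite lee_fin sqrrN exprVn -mulrA mulVf ?mulr1//.
  by rewrite expf_neq0// gt_eqF.
rewrite -EFinD -EFinM lee_fin le_eqVlt; apply/orP; left; apply/eqP.
by rewrite /c; ring.
Qed.

End gaussian.

(** * Chaining *)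

Section pr_theory.
Context (d : measure_display) (Omega : measurableType d) (R : realType)
  (P : probability Omega R).
Implicit Types A B : set Omega.

Lemma pr_ge0 A : 0 <= pr P A.
Proof. by rewrite /pr fine_ge0. Qed.

Lemma pr_le1 A : measurable A -> pr P A <= 1.
Proof. by move=> mA; rewrite -lee_fin -pr_fin// probability_le1. Qed.

Lemma le_pr A B : measurable A -> measurable B -> A `<=` B -> pr P A <= pr P B.
Proof.
move=> mA mB AB; rewrite -lee_fin -!pr_fin//.
by apply: le_measure => //; exact/mem_set.
Qed.

Lemma pr_setU_le A B : measurable A -> measurable B ->
  pr P (A `|` B) <= pr P A + pr P B.
Proof.
move=> mA mB; rewrite -lee_fin EFinD -!pr_fin//; last exact: measurableU.
by apply: measureU2.
Qed.

Lemma pr_bigcup_ord_le (n : nat) (A : nat -> set Omega) :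
  (forall i : nat, measurable (A i)) ->
  pr P (\bigcup_(i in `I_n) A i) <= \sum_(i < n) pr P (A i).
Proof.
move=> mA; rewrite -lee_fin -sumEFin -pr_fin; last exact: bigcup_measurable.
rewrite bigcup_mkord; apply: le_trans (Boole_inequality P _) _ => //.
by apply: lee_sum => i _; rewrite -pr_fin.
Qed.

Lemma pr_bigcup_ord_cst (n : nat) (A : nat -> set Omega) (c : R) :
  (forall i : nat, measurable (A i)) -> (forall i : nat, (i < n)%N -> pr P (A i) <= c) ->
  pr P (\bigcup_(i in `I_n) A i) <= n%:R * c.
Proof.
move=> mA Ac; apply: le_trans (pr_bigcup_ord_le n mA) _.
apply: le_trans (ler_sum _ (fun (i : 'I_n) _ => Ac i (ltn_ord i))) _.
by rewrite sumr_const card_ord mulr_natl.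
Qed.

Lemma pr_bigcup_geometric (A : nat -> set Omega) (c z : R) :
  (forall i : nat, measurable (A i)) -> 0 <= c -> 0 < z < 1 ->
  (forall i : nat, pr P (A i) <= c * z ^+ i) ->
  pr P (\bigcup_i A i) <= c / (1 - z).
Proof.
move=> mA c0 /andP[z0 z1] Ac.
have mU : measurable (\bigcup_i A i) by exact: bigcup_measurable.
rewrite -lee_fin -pr_fin//.
apply: le_trans (generalized_Boole_inequality P mA mU) _.
apply: lime_le; first exact: is_cvg_nneseries.
near=> n; apply: (@le_trans _ _ (\sum_(0 <= i < n) (c * z ^+ i)%:E)%E).
  by apply: lee_sum => i _; have := Ac i; rewrite -lee_fin -pr_fin.
rewrite sumEFin lee_fin; apply: (geometric_le_lim n c0 z0).
by rewrite ger0_norm ?ltW.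
Unshelve. all: by end_near. Qed.

End pr_theory.

Section dyadic.
Context (R : realType).

Lemma dyadic_small (L e : R) : 0 < L -> 0 < e -> exists l : nat, L / 2 ^+ l < e.
Proof.
move=> L0 e0; pose l := (truncn (L / e)).+1; exists l.
rewrite ltr_pdivrMr ?exprn_gt0// -ltr_pdivrMl// mulrC.
apply: lt_le_trans (_ : l%:R <= _).
  by have /andP[] := truncn_itv (divr_ge0 (ltW L0) (ltW e0)).
by rewrite -natrX ler_nat ltnW// ltn_expl.
Qed.

(** The dyadic point is taken to the left of [t], so that it remains in every interval from 0 that
    contains [t]. This makes events on continuous paths countable unions. *)
Lemma dyadic_witness (f : R -> R) (L t : R) :
  {within `[0, +oo[, continuous f} -> 0 < L -> 0 <= t -> 0 < f t ->
  exists l i : nat, i%:R * (L / 2 ^+ l) <= t /\ 0 < f (i%:R * (L / 2 ^+ l)).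
Proof.
move=> cf L0 t0 ft.
have : f @ within `[0, +oo[%classic (nbhs t) --> f t.
  by move/subspace_continuousP : cf; apply; rewrite /= in_itv/= t0.
move=> /cvgrPdist_lt /(_ _ ft) [e /= e0 He].
have [l Hl] := dyadic_small L0 e0.
have h0 : 0 < L / 2 ^+ l by rewrite divr_gt0// exprn_gt0.
exists l, (truncn (t / (L / 2 ^+ l))).
have /andP[] := truncn_itv (divr_ge0 t0 (ltW h0)).
rewrite ler_pdivlMr// ltr_pdivrMr//; set i := truncn _ => it ti.
split => //; set s := _ * _ in it *.
have s0 : 0 <= s by rewrite mulr_ge0// ltW.
have := He s; rewrite /= in_itv/= s0 ltr_norml => H.
have : `|f t - f s| < f t.
  apply: He; rewrite /= ?in_itv/= ?s0// ger0_norm ?subr_ge0//.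
  apply: lt_trans Hl; rewrite ltrBlDr addrC.
  by move: ti; rewrite -natr1 mulrDl mul1r.
by rewrite ltr_norml => /andP[_]; rewrite ltrBlDr ltrDl.
Qed.

End dyadic.

Section chaining.
Context (d : measure_display) (Omega : measurableType d) (R : realType)
  (P : probability Omega R).
Variables (b : R -> Omega -> R) (C H : R) (k : nat).
Hypothesis mb : forall t : R, 0 <= t -> measurable_fun setT (b t).
Hypothesis cb : forall w, {within `[0, +oo[, continuous (fun t => b t w)}.
Hypothesis C0 : 0 <= C.
Hypothesis H01 : 0 < H < 1.
Hypothesis Hk : 4 <= H * k%:R.
Hypothesis b_tail : forall t y : R, 0 <= t -> 0 < y ->
  pr P [set w | y < `|b t w|] <= C * (t `^ H / y) ^+ k.
Hypothesis b_increment : forall s t y : R, 0 <= s -> 0 <= t -> 0 < y ->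
  pr P [set w | y < `|b t w - b s w|] <= C * (`|t - s| `^ H / y) ^+ k.

(** The increments shrink by [2 ^ - H = theta ^ 2] per level. One factor [theta] pays for the
    decreasing share of the height; the other has [k]-th power at most 1/4, which beats the doubling
    of the number of increments. *)
Let theta : R := 2 `^ (- (H / 2)).

Let theta0 : 0 < theta. Proof. by rewrite powR_gt0. Qed.

Let theta1 : theta < 1.
Proof.
rewrite /theta powRN invf_lt1 ?powR_gt0//.
rewrite [ltLHS](_ : 1 = 1 `^ (H / 2)); last by rewrite powR1.
 apply: gt0_ltr_powR; rewrite ?nnegrE ?ltr1n//.
by case/andP: H01 => *; rewrite divr_gt0.
Qed.

Let thetak : theta ^+ k <= 4^-1.
Proof.
rewrite -powR_mulrn ?(ltW theta0)// -powRrM mulNr mulrAC.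
have -> : 4^-1 = 2 `^ (- 2) :> R.
  by rewrite powRN powR_mulrn// -natrX.
apply: ler_powR; first by rewrite ler1n.
by rewrite lerN2; move: Hk; set z := H * k%:R => ?; lra.
Qed.

Let thetaH l : (2 ^+ l) `^ (- H) = theta ^+ l * theta ^+ l.
Proof.
have E : theta ^+ l = 2 `^ (- (H / 2) * l%:R).
  by rewrite -powR_mulrn ?(ltW theta0)// /theta -powRrM.
rewrite E -powRD; last by rewrite pnatr_eq0 implybT.
by rewrite -powR_mulrn// -powRrM; congr (_ `^ _); field.
Qed.

(** By continuity a strict exceedance is visible at a dyadic time; capping the times at [L] keeps
    every member of the countable union inside the event. *)
Lemma exceeds_measurable (r x L : R) : measurable
  [set w | exists t, 0 <= t <= L /\ r * t + x < `|b t w|].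
Proof.
have [L0|L0] := ltP L 0.
  rewrite (_ : [set w | _] = set0)//; apply/seteqP; split => // w [t [/andP[t0 tL] _]].
  by have := le_lt_trans (le_trans t0 tL) L0; rewrite ltxx.
rewrite (_ : [set w | _] = \bigcup_l \bigcup_(i : nat)
    [set w | r * minr (i%:R * (1 / 2 ^+ l)) L + x <
       `|b (minr (i%:R * (1 / 2 ^+ l)) L) w|]).
  apply: bigcup_measurable => l _; apply: bigcup_measurable => i _.
  rewrite -[X in measurable X]setTI; apply: measurable_fun_ltr => //.
  apply: measurableT_comp => //; apply: mb.
  by rewrite le_min L0 andbT mulr_ge0// divr_ge0// exprn_ge0.
apply/seteqP; split => [w [t [/andP[t0 tL] H']]|w [l _ [i _ H']]]; last first.
  exists (minr (i%:R * (1 / 2 ^+ l)) L); split => //.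
  rewrite ge_min lexx orbT le_min L0 !andbT mulr_ge0// divr_ge0// exprn_ge0//.
pose f s := `|b (minr s L) w| - (r * minr s L + x).
have [l [i [_ fi]]] : exists l i : nat, i%:R * (1 / 2 ^+ l) <= t /\
    0 < f (i%:R * (1 / 2 ^+ l)).
  apply: dyadic_witness => //; last by rewrite /f min_l// subr_gt0.
  have cm : {within `[0, +oo[, continuous (fun s : R => minr s L)}.
    by apply: continuous_subspaceT => s; apply: continuous_min => //; exact: cvg_cst.
  apply/subspace_continuousP => s; rewrite /= in_itv/= andbT => s0.
  have cms : minr s' L @[s' --> within `[0, +oo[%classic (nbhs s)] --> minr s L.
    by move/subspace_continuousP : cm; apply; rewrite /= in_itv/= s0.
  have bms : b (minr s' L) w @[s' --> within `[0, +oo[%classic (nbhs s)] -->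
      b (minr s L) w.
    apply: (@cvg_comp _ _ _ (fun s' => minr s' L) (fun u => b u w) _
       (within `[0, +oo[%classic (nbhs (minr s L)))).
      move=> A /= [e e0 He].
      move/cvgrPdist_lt : cms => /(_ e e0) [e1 /= e10 He1].
      exists e1 => // u /= su u0; apply: He; first exact: He1.
      move: u0; rewrite /= !in_itv/= !andbT => u0.
      by rewrite le_min u0.
    have /subspace_continuousP := @cb w; apply; rewrite /= in_itv/= andbT.
    by rewrite le_min s0.
  apply: cvgB; first exact: cvg_norm.
  by apply: cvgD; [apply: cvgMr|exact: cvg_cst].
by exists l => //; exists i => //=; rewrite -subr_gt0.
Qed.

(** The leading 2 sums the levels, a geometric series of ratio 1/2; [2 / (1 - theta)] is the inverse
    of the fraction of the height granted to level 0. *)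
Definition chain_cst : R := 2 * C * (2 / (1 - theta)) ^+ k.

Lemma chain_cst_ge0 : 0 <= chain_cst.
Proof.
by rewrite /chain_cst !mulr_ge0// exprn_ge0// divr_ge0// subr_ge0 ltW.
Qed.

(* Dyadic chaining: the level-[l] increments are allowed the share
   [(1 - theta) theta ^ l] of the height. *)
Lemma sup_itv_tail (L y : R) : 0 < L -> 0 < y ->
  pr P [set w | exists t, 0 <= t <= L /\ y < `|b t w|] <=
  chain_cst * (L `^ H / y) ^+ k.
Proof.
move=> L0 y0.
have k0 : (0 < k)%N.
  by rewrite lt0n; apply/eqP => k0; move: Hk; rewrite k0 mulr0; lra.
pose dl l : R := L / 2 ^+ l.
have dl0 l : 0 < dl l by rewrite divr_gt0// exprn_gt0.
pose yl l := y / 2 * ((1 - theta) * theta ^+ l).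
have yl0 l : 0 < yl l by rewrite !mulr_gt0 ?exprn_gt0 ?subr_gt0.
(* Half of the height is reserved for the starting value, which vanishes only almost surely; the
   tail bound at time 0 makes this event null. *)
pose I0 := [set w | y / 2 < `|b 0 w|].
pose E1 l i := [set w | yl l < `|b (i.+1%:R * dl l) w - b (i%:R * dl l) w|].
pose E l := \bigcup_(i in `I_(2 ^ l)) E1 l i.
have t0 l (i : nat) : 0 <= i%:R * dl l by rewrite mulr_ge0// ltW.
have mI0 : measurable I0.
  rewrite -[X in measurable X]setTI; apply: measurable_fun_ltr => //.
  by apply: measurableT_comp => //; exact: mb.
have mE1 l i : measurable (E1 l i).
  rewrite -[X in measurable X]setTI; apply: measurable_fun_ltr => //.
  by apply: measurableT_comp => //; apply: measurable_funB; exact: mb.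
have mE l : measurable (E l) by apply: bigcup_measurable => i _.
have prI0 : pr P I0 <= 0.
  apply: le_trans (b_tail (lexx 0) _) _; first by rewrite divr_gt0.
  by rewrite powR0 ?mul0r ?expr0n ?gtn_eqF ?mulr0//; case/andP: H01 => /gt_eqF ->.
have prE l : pr P (E l) <= (C * (L `^ H / y * (2 / (1 - theta))) ^+ k) * 2^-1 ^+ l.
  apply: (@le_trans _ _ ((2 ^ l)%:R * (C * (dl l `^ H / yl l) ^+ k))).
    apply: pr_bigcup_ord_cst => // i _.
    apply: le_trans (b_increment (t0 l i) (t0 l i.+1) (yl0 l)) _.
    by rewrite -mulrBl -natrB// subSnn mul1r ger0_norm// ltW.
  have -> : dl l `^ H / yl l = (L `^ H / y * (2 / (1 - theta))) * theta ^+ l.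
    rewrite /dl /yl powRM ?ltW// ?invr_gt0 ?exprn_gt0//.
    rewrite -powR_inv1 ?exprn_ge0// -powRrM mulN1r thetaH.
    by field; rewrite !gt_eqF ?exprn_gt0 ?subr_gt0.
  rewrite exprMn mulrA [_ * C]mulrC -!mulrA; apply: ler_wpM2l => //.
  rewrite mulrCA; apply: ler_wpM2l.
    by rewrite exprn_ge0// !mulr_ge0 ?invr_ge0 ?powR_ge0// ?subr_ge0 ltW.
  (* The [2 ^ l] increments of level [l], against the [l]-th power of [theta ^+ k <= 1/4], leave
     [2 ^ - l]. *)
  rewrite natrX -exprM mulnC exprM -exprMn lerXn2r ?nnegrE ?invr_ge0//.
    by rewrite mulr_ge0// exprn_ge0// ltW.
  by have := thetak; lra.
have prU : pr P (\bigcup_l E l) <= (C * (L `^ H / y * (2 / (1 - theta))) ^+ k) * 2.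
  set c := C * _.
  have c0 : 0 <= c.
    by rewrite mulr_ge0// exprn_ge0// !mulr_ge0 ?invr_ge0 ?powR_ge0// ?subr_ge0 ltW.
  have -> : c * 2 = c / (1 - 2^-1) by field.
  by apply: pr_bigcup_geometric => //; apply/andP; split; lra.
apply: (@le_trans _ _ (pr P (I0 `|` \bigcup_l E l))); last first.
  apply: le_trans (pr_setU_le P mI0 _) _; first exact: bigcup_measurable.
  rewrite -[leRHS]add0r; apply: lerD => //; apply: le_trans prU _.
  by rewrite /chain_cst exprMn le_eqVlt; apply/orP; left; apply/eqP; ring.
apply: le_pr.
- have := exceeds_measurable 0 y L.
  by rewrite (_ : [set w | _] = [set w | exists t, 0 <= t <= L /\ y < `|b t w|])//;
    apply/seteqP; split => w [t [tL H1]]; exists t; move: H1; rewrite mul0r add0r.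
- by apply: measurableU => //; exact: bigcup_measurable.
move=> w [t [/andP[tge0 tL] yt]]; apply: contrapT => /not_orP[/negP].
rewrite -leNgt => b0 nE.
(* The right side is the sum of the shares of the levels up to [l]. An even point of the next level
   already belongs to the previous one; an odd point is one increment away from such a point. *)
have chain l i : (i <= 2 ^ l)%N ->
    `|b (i%:R * dl l) w - b 0 w| <= y / 2 * (1 - theta ^+ l.+1).
  elim: l i => [|l IH] i.
    rewrite expn0 expr1; case: i => [|[|//]] _.
      by rewrite mul0r subrr normr0 mulr_ge0 ?divr_ge0 ?ltW// subr_gt0.
    rewrite leNgt; apply/negP => Hlt; apply: nE; exists 0%N => //.
    exists 0%N => //=; rewrite /E1 /= mul0r /yl expr0 mulr1; exact: Hlt.
  move=> il; have dS : dl l = 2 * dl l.+1.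
    by rewrite /dl exprS; field; rewrite expf_neq0.
  have IH' j : (j <= 2 ^ l)%N ->
      `|b (j.*2%:R * dl l.+1) w - b 0 w| <= y / 2 * (1 - theta ^+ l.+1).
    move=> jl; have -> : j.*2%:R * dl l.+1 = j%:R * dl l.
      by rewrite dS -muln2 natrM; ring.
    exact: IH.
  have mono : y / 2 * (1 - theta ^+ l.+1) <= y / 2 * (1 - theta ^+ l.+2).
    apply: ler_wpM2l; first by rewrite divr_ge0// ltW.
    by rewrite lerB// [leLHS]exprS ler_piMl ?exprn_ge0 ?ltW.
  have := odd_double_half i; move: (i./2) (odd i) => j [] Ei; last first.
    rewrite -Ei add0n; apply: le_trans (IH' _ _) mono.
    by rewrite -leq_double; move: il; rewrite -Ei add0n expnS mul2n.
  have ij : (j < 2 ^ l)%N.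
    by rewrite -ltn_double; move: il; rewrite -Ei expnS mul2n add1n.
  rewrite -Ei add1n.
  have -> : b (j.*2.+1%:R * dl l.+1) w - b 0 w =
    (b (j.*2.+1%:R * dl l.+1) w - b (j.*2%:R * dl l.+1) w) +
    (b (j.*2%:R * dl l.+1) w - b 0 w) by ring.
  apply: le_trans (ler_normD _ _) _.
  apply: (@le_trans _ _ (yl l.+1 + y / 2 * (1 - theta ^+ l.+1))).
    apply: lerD; last by apply: IH'; exact: ltnW.
    rewrite leNgt; apply/negP => Hlt; apply: nE; exists l.+1 => //.
    exists j.*2 => //=; by move: il; rewrite -Ei add1n.
  rewrite /yl (exprS _ l.+1) le_eqVlt; apply/orP; left; apply/eqP; ring.
pose f s := `|b s w| - y.
have [l [i [it fi]]] : exists l i : nat, i%:R * (L / 2 ^+ l) <= t /\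
    0 < f (i%:R * (L / 2 ^+ l)).
  apply: dyadic_witness => //; last by rewrite /f subr_gt0.
  apply/subspace_continuousP => s; rewrite /= in_itv/= andbT => s0.
  apply: cvgB; last exact: cvg_cst.
  apply: cvg_norm; have /subspace_continuousP := @cb w; apply.
  by rewrite /= in_itv/= s0.
have il : (i <= 2 ^ l)%N.
  rewrite -(ler_nat R) natrX -(ler_pM2r (dl0 l)); apply: le_trans it _.
  by apply: le_trans tL _; rewrite /dl mulrCA divff ?mulr1// expf_neq0.
have := chain l i il; move: fi; rewrite /f subr_gt0 -/(dl l) => fi Hc.
have := ler_normD (b (i%:R * dl l) w - b 0 w) (b 0 w); rewrite subrK => Hn.
have : y / 2 * (1 - theta ^+ l.+1) <= y / 2.
  by rewrite ler_piMr ?(divr_ge0 (ltW y0))// gerBl exprn_ge0// ltW.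
lra.
Qed.

Lemma drift_exceeds_measurable (r x : R) :
  measurable [set w | exists t, 0 <= t /\ r * t + x < `|b t w|].
Proof.
rewrite (_ : [set w | _] = \bigcup_n
    [set w | exists t, 0 <= t <= n%:R /\ r * t + x < `|b t w|]).
  by apply: bigcup_measurable => n _; exact: exceeds_measurable.
apply/seteqP; split => [w [t [t0 H1]]|w [n _ [t [/andP[t0 _] H1]]]]; last by exists t.
exists (truncn t).+1 => //; exists t; split => //; rewrite t0/=.
by have /andP[_ /ltW] := truncn_itv t0.
Qed.

Let powR_div_le (z : R) (m : nat) : 1 <= z -> m%:R <= (1 - H) * k%:R ->
  (z `^ H / z) ^+ k <= (z ^+ m)^-1.
Proof.
move=> z1 mk; have z0 : 0 < z by apply: lt_le_trans z1.
have -> : z `^ H / z = z `^ (H - 1).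
  rewrite powRD; last by rewrite (gt_eqF z0) implybT.
  by rewrite powRN powRr1 ?ltW.
rewrite -powR_mulrn ?powR_ge0// -powRrM -[X in _ <= X^-1]powR_mulrn ?(ltW z0)//.
rewrite -powRN; apply: ler_powR => //.
by rewrite -[leLHS]opprK lerN2 -mulNr opprB.
Qed.

(** The first term accounts for the times up to [x], the second for the later dyadic time blocks,
    summed as a geometric series of ratio 1/2. *)
Definition drift_cst (r : R) : R := chain_cst + 2 * (chain_cst * (2 `^ H / r) ^+ k).

Lemma drift_cst_ge0 (r : R) : 0 <= r -> 0 <= drift_cst r.
Proof.
have K0 := chain_cst_ge0 => r0.
by rewrite addr_ge0// mulr_ge0// mulr_ge0// exprn_ge0// divr_ge0// powR_ge0.
Qed.

(** Times between [2 ^ n * x] and [2 ^ n.+1 * x] require the height [r * 2 ^ n * x], while the path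
    has size of order [(2 ^ n * x) ^ H]. The [k]-th power of this ratio decays like
    [(2 ^ n * x) ^ - m], and [m >= 1] makes the sum over [n] converge. *)
Lemma drift_exceeds_tail (r : R) (m : nat) : 0 < r -> (0 < m)%N ->
  m%:R <= (1 - H) * k%:R ->
  forall x : R, 1 <= x ->
    pr P [set w | exists t, 0 <= t /\ r * t + x < `|b t w|] <= drift_cst r / x ^+ m.
Proof.
move=> r0 m0 mk; have K0 := chain_cst_ge0; have Ktail := sup_itv_tail.
rewrite /drift_cst; move: chain_cst K0 Ktail => K K0 Ktail.
pose D := K * (2 `^ H / r) ^+ k; rewrite -/D.
have D0 : 0 <= D by rewrite mulr_ge0// exprn_ge0// divr_ge0 ?powR_ge0// ltW.
move=> x x1; have x0 : 0 < x by apply: lt_le_trans x1.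
have p20 n : 0 < 2 ^+ n :> R by rewrite exprn_gt0.
have xn0 n : 0 < 2 ^+ n * x by rewrite mulr_gt0.
pose A0 := [set w | exists t, 0 <= t <= x /\ x < `|b t w|].
pose A n := [set w | exists t, 0 <= t <= 2 ^+ n.+1 * x /\
                      r * (2 ^+ n * x) < `|b t w|].
have mA y L : measurable [set w | exists t, 0 <= t <= L /\ y < `|b t w|].
  have := exceeds_measurable 0 y L.
  by rewrite (_ : [set w | _] = [set w | exists t, 0 <= t <= L /\ y < `|b t w|])//;
    apply/seteqP; split => w [t [tL H1]]; exists t; move: H1; rewrite mul0r add0r.
have prA0 : pr P A0 <= K / x ^+ m.
  apply: le_trans (Ktail _ _ x0 x0) _; apply: ler_wpM2l => //.
  exact: powR_div_le.
have prA n : pr P (A n) <= D / x ^+ m * 2^-1 ^+ n.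
  apply: le_trans (Ktail _ _ (xn0 n.+1) (mulr_gt0 r0 (xn0 n))) _.
  rewrite /D -!mulrA; apply: ler_wpM2l => //.
  rewrite exprS -mulrA powRM ?(ltW (xn0 n))//.
  have -> : 2 `^ H * (2 ^+ n * x) `^ H / (r * (2 ^+ n * x)) =
    (2 `^ H / r) * ((2 ^+ n * x) `^ H / (2 ^+ n * x)).
    by field; rewrite !gt_eqF.
  rewrite exprMn; apply: ler_wpM2l.
    by rewrite exprn_ge0// divr_ge0 ?powR_ge0// ltW.
  apply: le_trans (powR_div_le _ mk) _.
    by rewrite -[leLHS]mul1r ler_pM// exprn_ege1// ler1n.
  rewrite exprMn invfM mulrC; apply: ler_wpM2l; first by rewrite invr_ge0 exprn_ge0// ltW.
  rewrite exprVn lef_pV2 ?posrE ?exprn_gt0//.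
  by rewrite ler_eXnr ?exprn_ege1 ?ler1n.
have prU : pr P (\bigcup_n A n) <= D / x ^+ m * 2.
  set c := D / _ in prA *.
  have -> : c * 2 = c / (1 - 2^-1) by field.
  apply: pr_bigcup_geometric => //; last by apply/andP; split; lra.
    by move=> i; exact: mA.
  by rewrite divr_ge0// exprn_ge0// ltW.
apply: (@le_trans _ _ (pr P (A0 `|` \bigcup_n A n))); last first.
  apply: le_trans (pr_setU_le P _ _) _; [exact: mA|by apply: bigcup_measurable => i _; exact: mA|].
  rewrite mulrDl; apply: lerD => //.
  by rewrite [2 * D]mulrC mulrAC.
apply: le_pr; first exact: drift_exceeds_measurable.
  by apply: measurableU; [exact: mA|apply: bigcup_measurable => i _; exact: mA].
move=> w [t [t0 H1]]; have [tx|xt] := leP t x.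
  left; exists t; rewrite t0 tx; split => //; apply: le_lt_trans H1.
  by rewrite lerDr mulr_ge0// ltW.
right; have tx1 : 1 <= t / x by rewrite ler_pdivlMr// mul1r ltW.
pose n := trunc_log 2 (truncn (t / x)).
have tr0 : (0 < truncn (t / x))%N by rewrite truncn_gt0.
have /andP[n1 n2] := trunc_log_bounds (isT : (1 < 2)%N) tr0.
have /andP[q1 q2] := truncn_itv (le_trans ler01 tx1).
exists n => //; exists t; split; last first.
  apply: le_lt_trans H1; apply: ler_wpDr; first exact: ltW.
  apply: ler_wpM2l; first exact: ltW.
  by rewrite -ler_pdivlMr//; apply: le_trans q1; rewrite -natrX ler_nat.
rewrite t0/= -ler_pdivrMr//; apply: (le_trans (ltW q2)).
by rewrite -natrX ler_nat.
Qed.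

End chaining.

(** * Copies of a fractional Brownian motion *)

Section law.
Context (d : measure_display) (Omega : measurableType d) (R : realType)
  (P : probability Omega R).

Lemma eq_law_integral (X Y : Omega -> R) (f : R -> R) :
  measurable_fun setT X -> measurable_fun setT Y -> measurable_fun setT f ->
  (forall x : R, 0 <= f x) ->
  (forall A : set R, measurable A -> P (X @^-1` A) = P (Y @^-1` A)) ->
  (\int[P]_w (f (X w))%:E = \int[P]_w (f (Y w))%:E)%E.
Proof.
move=> mX mY mf f0 XY.
pose X' : {RV P >-> R} := mfun_Sub (mem_set mX).
pose Y' : {RV P >-> R} := mfun_Sub (mem_set mY).
have mf' : measurable_fun setT (EFin \o f) by exact/measurable_EFinP.
rewrite -[LHS](@ge0_integral_distribution _ _ _ _ _ P X' (EFin \o f))//.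
rewrite -[RHS](@ge0_integral_distribution _ _ _ _ _ P Y' (EFin \o f))//.
by apply: eq_measure_integral => A mA _; exact: XY.
Qed.

End law.

Section fbm.
Context (d : measure_display) (Omega : measurableType d) (R : realType)
  (P : probability Omega R) (H : R) (B : R -> {RV P >-> R}).
Hypothesis H01 : 0 < H < 1.
Hypothesis fB : standard_fbm H B.

Lemma fbm_moment2 (s t : R) : 0 <= s -> 0 <= t ->
  (\int[P]_w (B t w * B s w)%:E =
   (2^-1 * (`|t| `^ (2 * H) + `|s| `^ (2 * H) - `|t - s| `^ (2 * H)))%:E)%E.
Proof.
move=> s0 t0; rewrite -(fbm_covariance fB t0 s0).
rewrite covariance.unlock !(fbm_centered fB)//= unlock.
apply: eq_integral => w _.
by transitivity ((B t w - 0) * (B s w - 0))%:E; first by rewrite !subr0.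
Qed.

Lemma fbm_increment_sq (s t : R) : 0 <= s -> 0 <= t ->
  (\int[P]_w ((B t w - B s w) ^+ 2)%:E = ((`|t - s| `^ H) ^+ 2)%:E)%E.
Proof.
move=> s0 t0.
have H0 : 2 * H != 0 by case/andP: H01 => ? _; rewrite mulf_neq0// gt_eqF.
have cov0 u : `|u - u| `^ (2 * H) = 0 by rewrite subrr normr0 powR0.
have i2 u : 0 <= u -> P.-integrable setT (fun w => (B u w * B u w)%:E).
  move=> u0; apply/integrableP; split.
    by apply/measurable_EFinP; exact: measurable_funM.
  under eq_integral do rewrite gee0_abs ?lee_fin -?expr2 ?sqr_ge0//.
  by under eq_integral do rewrite expr2; rewrite fbm_moment2// ltry.
have its : P.-integrable setT (fun w => (B t w * B s w)%:E).
  apply: (le_integrable _ _ _ (integrableD measurableT (i2 t t0) (i2 s s0))) => //.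
    by apply/measurable_EFinP; exact: measurable_funM.
  move=> w _; rewrite -EFinD !abse_EFin lee_fin [leRHS]ger0_norm; last first.
    by rewrite addr_ge0// -expr2 sqr_ge0.
  rewrite ler_norml; apply/andP; split.
    by have := sqr_ge0 (B t w + B s w); have := sqr_ge0 (B t w); have := sqr_ge0 (B s w); nra.
  by have := sqr_ge0 (B t w - B s w); have := sqr_ge0 (B t w); have := sqr_ge0 (B s w); nra.
transitivity (\int[P]_w ((B t w * B t w)%:E + (B s w * B s w)%:E -
    2%:E * (B t w * B s w)%:E))%E.
  by apply: eq_integral => w _; rewrite -!(EFinM, EFinN, EFinD); congr (_%:E); ring.
rewrite integralB//; last 2 first.
- exact: integrableD (i2 t t0) (i2 s s0).
- exact: integrableZl.
rewrite integralD//; last 2 first.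
- exact: i2.
- exact: i2.
rewrite integralZl// !fbm_moment2// !cov0 -!(EFinM, EFinN, EFinD); congr (_%:E).
rewrite -powR_mulrn ?powR_ge0// -powRrM [H * _]mulrC.
by field.
Qed.

Lemma fbm_increment_centered (s t : R) : 0 <= s -> 0 <= t ->
  ('E_P[(fun w => (B t w - B s w)%R)] = 0)%E.
Proof.
move=> s0 t0.
have i1 u : 0 <= u -> P.-integrable setT (EFin \o B u).
  move=> u0; apply: (@le_integrable _ _ _ _ _ measurableT _ (fun w => (1 + B u w * B u w)%:E)).
  - exact/measurable_EFinP.
  - move=> w _; rewrite /= lee_fin [leRHS]ger0_norm; last first.
      by rewrite addr_ge0// -expr2 sqr_ge0.
    rewrite ler_norml; apply/andP; split.
      by have := sqr_ge0 (B u w + 1); nra.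
    by have := sqr_ge0 (B u w - 1); nra.
  apply: (@eq_integrable _ _ _ P setT measurableT
    (fun w => 1%:E + (B u w * B u w)%:E)%E) => //.
  apply: integrableD => //; first exact: finite_measure_integrable_cst.
  apply/integrableP; split; first by apply/measurable_EFinP; exact: measurable_funM.
  under eq_integral do rewrite gee0_abs ?lee_fin -?expr2 ?sqr_ge0//.
  by under eq_integral do rewrite expr2; rewrite fbm_moment2// ltry.
rewrite unlock; under eq_integral do rewrite EFinB.
rewrite integralB//; last 2 first.
- exact: i1.
- exact: i1.
have := fbm_centered fB t0; have := fbm_centered fB s0; rewrite unlock.
by move=> -> ->; rewrite sube0.
Qed.

Lemma fbm_increment_gaussian (s t : R) : 0 <= s -> 0 <= t ->
  gaussian P (fun w => B t w - B s w).
Proof.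
move=> s0 t0.
have := @fbm_gaussian _ _ _ _ _ _ fB 2
  (fun i => if i == ord0 then t else s) (fun i => if i == ord0 then 1 else -1).
rewrite (_ : (fun w => \sum_(k < 2) _) = (fun w => B t w - B s w)).
  by apply => k; case: ifP.
by apply/funext => w; rewrite !big_ord_recl big_ord0 /= mul1r addr0 mulN1r.
Qed.

Lemma fbm_gaussian1 (t : R) : 0 <= t -> gaussian P (B t).
Proof.
move=> t0; have := @fbm_gaussian _ _ _ _ _ _ fB 1 (fun=> t) (fun=> 1).
rewrite (_ : (fun w => \sum_(k < 1) _) = B t :> (Omega -> R)); first exact.
by apply/funext => w; rewrite big_ord_recl big_ord0 mul1r addr0.
Qed.

Lemma fbm_sq (t : R) : 0 <= t ->
  (\int[P]_w (B t w ^+ 2)%:E = ((t `^ H) ^+ 2)%:E)%E.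
Proof.
move=> t0; under eq_integral do rewrite expr2.
rewrite fbm_moment2// subrr normr0 powR0; last first.
  by case/andP: H01 => ? _; rewrite mulf_neq0// gt_eqF.
rewrite ger0_norm// -powR_mulrn ?powR_ge0// -powRrM [H * _]mulrC; congr (_%:E).
by field.
Qed.

Definition fbm_cst (k : nat) : R := 2 * expR 4 * k%:R ^+ k.

Lemma fbm_cst_ge0 k : 0 <= fbm_cst k.
Proof. by rewrite /fbm_cst !mulr_ge0 ?expR_ge0// exprn_ge0. Qed.

(** A copy is only required to share the laws at two times: tails and exponential moments involve
    nothing more, and chaining recovers the whole path. *)
Variable b : R -> Omega -> R.
Hypothesis mb : forall t : R, 0 <= t -> measurable_fun setT (b t).
Hypothesis b_law : forall (s t : R) (A : set (R * R)), 0 <= s -> 0 <= t ->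
  measurable A -> P [set w | A (b s w, b t w)] = P [set w | A (B s w, B t w)].

Lemma fbm_copy_increment_tail (k : nat) (s t y : R) : (0 < k)%N ->
  0 <= s -> 0 <= t -> 0 < y ->
  pr P [set w | y < `|b t w - b s w|] <= fbm_cst k * (`|t - s| `^ H / y) ^+ k.
Proof.
move=> k0 s0 t0 y0.
have := @b_law s t [set z | y < `|z.2 - z.1|] s0 t0.
rewrite /pr /= => ->; last first.
  rewrite -[X in measurable X]setTI; apply: measurable_fun_ltr => //.
  apply: measurableT_comp => //; apply: measurable_funB.
    exact: measurable_snd.
  exact: measurable_fst.
rewrite -lee_fin fineK; last first.
  apply: fin_num_measure.
  rewrite -[X in measurable X]setTI; apply: measurable_fun_ltr => //.
  by apply: measurableT_comp => //; exact: measurable_funB.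
apply: gaussian_tail_le => //.
- exact: measurable_funB.
- exact: fbm_increment_gaussian.
- exact: fbm_increment_centered.
- exact: fbm_increment_sq.
Qed.

Lemma fbm_copy_tail (k : nat) (t y : R) : (0 < k)%N -> 0 <= t -> 0 < y ->
  pr P [set w | y < `|b t w|] <= fbm_cst k * (t `^ H / y) ^+ k.
Proof.
move=> k0 t0 y0.
have := @b_law t t [set z | y < `|z.2|] t0 t0.
rewrite /pr /= => ->; last first.
  rewrite -[X in measurable X]setTI; apply: measurable_fun_ltr => //.
  by apply: measurableT_comp => //; exact: measurable_snd.
rewrite -lee_fin fineK; last first.
  apply: fin_num_measure.
  rewrite -[X in measurable X]setTI; apply: measurable_fun_ltr => //.
  by apply: measurableT_comp.
apply: gaussian_tail_le => //.
- exact: fbm_gaussian1.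
- exact: (fbm_centered fB).
- exact: fbm_sq.
- exact: powR_ge0.
Qed.

Lemma fbm_copy_mgf (h t : R) : 0 <= t ->
  (\int[P]_w (expR (h * b t w))%:E <= (expR (4 * h ^+ 2 * t `^ (2 * H)))%:E)%E.
Proof.
move=> t0.
rewrite (@eq_law_integral _ _ _ P (b t) (B t) (fun x => expR (h * x)))//.
- have -> : t `^ (2 * H) = (t `^ H) ^+ 2.
    by rewrite -powR_mulrn ?powR_ge0// -powRrM [H * _]mulrC.
  apply: gaussian_mgf_le => //.
  + exact: fbm_gaussian1.
  + exact: (fbm_centered fB).
  + exact: fbm_sq.
- exact: mb.
- by apply: measurableT_comp => //; exact: measurable_funM.
- move=> A mA; apply: (@b_law t t (fst @^-1` A)) => //.
  by rewrite -[X in measurable X]setTI; exact: measurable_fst.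
Qed.

End fbm.

(** The order [k] is taken large enough both for chaining ([4 <= H * k]) and for the decay
    ([m <= (1 - H) * k]). The constant is chosen before the copy, so it serves all blocks at
    once. *)
Lemma fbm_copy_drift_tail (d : measure_display) (Omega : measurableType d)
    (R : realType) (P : probability Omega R) (H : R) (B : R -> {RV P >-> R})
    (r : R) (m : nat) :
  0 < H < 1 -> standard_fbm H B -> 0 < r -> (0 < m)%N ->
  exists2 C : R, 0 <= C & forall b : R -> Omega -> R,
    (forall t : R, 0 <= t -> measurable_fun setT (b t)) ->
    (forall (s t : R) (A : set (R * R)), 0 <= s -> 0 <= t -> measurable A ->
      P [set w | A (b s w, b t w)] = P [set w | A (B s w, B t w)]) ->
    (forall w, {within `[0, +oo[, continuous (fun t => b t w)}) ->
    forall x : R, 1 <= x ->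
    pr P [set w | exists t : R, 0 <= t /\ r * t + x < `|b t w|] <= C / x ^+ m.
Proof.
move=> H01 fB r0 m0; case/andP: (H01) => H0 H1.
pose k := maxn (truncn (4 / H)).+1 (truncn (m%:R / (1 - H))).+1.
have h1 : 4 <= H * k%:R.
  rewrite mulrC -ler_pdivrMr//; apply: (@le_trans _ _ (truncn (4 / H)).+1%:R).
    by have /andP[_ /ltW] := truncn_itv (divr_ge0 (ler0n R 4) (ltW H0)).
  by rewrite ler_nat leq_maxl.
have H1' : 0 < 1 - H by rewrite subr_gt0.
have h2 : m%:R <= (1 - H) * k%:R.
  rewrite mulrC -ler_pdivrMr//; apply: (@le_trans _ _ (truncn (m%:R / (1 - H))).+1%:R).
    by have /andP[_ /ltW] := truncn_itv (divr_ge0 (ler0n R m) (ltW H1')).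
  by rewrite ler_nat leq_maxr.
have k0 : (0 < k)%N by rewrite leq_max.
exists (drift_cst (fbm_cst R k) H k r).
  by apply: drift_cst_ge0; rewrite ?fbm_cst_ge0 ?(ltW r0).
move=> b mb b_law cb; apply: drift_exceeds_tail => //.
- exact: fbm_cst_ge0.
- by move=> t y t0 y0; apply: (@fbm_copy_tail _ _ _ P H B).
- by move=> s t y s0 t0 y0; apply: (@fbm_copy_increment_tail _ _ _ P H B).
Qed.

(** * Regularly varying tails *)

Section near_pinfty.
Context (R : realType).

Lemma near_pinfty_ex (Q : R -> Prop) : (\forall x \near +oo, Q x) ->
  exists2 x0 : R, 1 <= x0 & forall x, x0 <= x -> Q x.
Proof.
move=> [M [_ HM]]; exists (maxr 1 (M + 1)); first by rewrite le_max lexx.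
move=> x; rewrite ge_max => /andP[_ Mx]; apply: HM.
by apply: lt_le_trans Mx; rewrite ltrDl.
Qed.

Lemma near_pinfty_of (Q : R -> Prop) (x0 : R) : (forall x, x0 <= x -> Q x) ->
  \forall x \near +oo, Q x.
Proof. by move=> H; near=> x; apply: H; near: x; apply: nbhs_pinfty_ge; exact: num_real. Unshelve. all: by end_near. Qed.

Lemma near_pinfty_scale (Q : R -> Prop) (t : R) : 0 < t ->
  (\forall x \near +oo, Q x) -> \forall x \near +oo, Q (t * x).
Proof.
move=> t0 /near_pinfty_ex[x0 _ H]; apply: (@near_pinfty_of _ (x0 / t)) => x.
by rewrite ler_pdivrMr// mulrC => /H.
Qed.

Lemma powRN_small (a e : R) : 0 < a -> 0 < e ->
  \forall x \near +oo, x `^ (- a) <= e.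
Proof.
move=> a0 e0; apply: (@near_pinfty_of _ ((e^-1) `^ (a^-1))) => x H.
have x0 : 0 < x by apply: lt_le_trans H; rewrite powR_gt0// invr_gt0.
rewrite powRN -[leRHS]invrK lef_pV2 ?posrE ?powR_gt0 ?invr_gt0//.
have -> : e^-1 = (e^-1 `^ a^-1) `^ a.
  by rewrite -powRrM mulVf ?gt_eqF// powRr1// invr_ge0 ltW.
by apply: ge0_ler_powR => //; rewrite ?nnegrE ?powR_ge0// ltW.
Qed.

Lemma ln_le_powR (b x : R) : 0 < b -> 0 < x -> ln x <= x `^ b / b.
Proof.
move=> b0 x0; rewrite ler_pdivlMr// mulrC -ln_powR.
by apply: le_trans (_ : x `^ b - 1 <= _); rewrite ?lerBlDr ?lerDl//
  -[X in ln X](subrK 1) addrC le_ln1Dx// ltrBrDl subrr powR_gt0.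
Qed.

Lemma ln_powRN_small (a e : R) : 0 < a -> 0 < e ->
  \forall x \near +oo, ln x * x `^ (- a) <= e.
Proof.
move=> a0 e0; have a20 : 0 < a / 2 by rewrite divr_gt0.
near=> x; have x0 : 0 < x by near: x; apply: nbhs_pinfty_gt; exact: num_real.
apply: (@le_trans _ _ (x `^ (a / 2) / (a / 2) * x `^ (- a))).
  by rewrite ler_wpM2r ?powR_ge0// ln_le_powR.
rewrite mulrAC -powRD; last by rewrite (gt_eqF x0) implybT.
have -> : a / 2 + - a = - (a / 2) by field.
rewrite ler_pdivrMr//; near: x; apply: powRN_small => //.
by rewrite mulr_gt0.
Unshelve. all: by end_near. Qed.

Lemma invrX_powR (x : R) (m : nat) : 0 <= x -> x ^- m = x `^ (- m%:R).
Proof. by move=> x0; rewrite powRN powR_mulrn. Qed.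

End near_pinfty.

Section regular_tail.
Context (R : realType).

(** What the analysis uses of regular variation; the slowly varying factor does not appear any
    more. *)
Record regular_tail (F : R -> R) (lambda : R) : Prop := RegularTail {
  rt_nonincreasing : forall x y : R, x <= y -> F y <= F x ;
  rt_gt0 : forall x : R, 0 < F x ;
  rt_ratio : forall t : R, 0 < t -> F (t * x) / F x @[x --> +oo] --> t `^ (- lambda)
}.

Variables (F : R -> R) (lambda : R).
Hypothesis rF : regular_tail F lambda.

Lemma rt_ratio_le (t c : R) : 0 < t -> t `^ (- lambda) < c ->
  \forall x \near +oo, F (t * x) <= c * F x.
Proof.
move=> t0 tc; have := rt_ratio rF t0 => /cvgr_le /(_ _ tc).
by apply: filterS => x; rewrite ler_pdivrMr ?(rt_gt0 rF).
Qed.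

Lemma rt_ratio_ge (t c : R) : 0 < t -> c < t `^ (- lambda) ->
  \forall x \near +oo, c * F x <= F (t * x).
Proof.
move=> t0 tc; have := rt_ratio rF t0 => /cvgr_ge /(_ _ tc).
by apply: filterS => x; rewrite ler_pdivlMr ?(rt_gt0 rF).
Qed.

Lemma rt_ratio_bounded (t : R) : 0 < t ->
  exists2 C : R, 0 < C & \forall x \near +oo, F (t * x) <= C * F x.
Proof.
move=> t0; exists (t `^ (- lambda) + 1); first by rewrite ltr_wpDl ?powR_ge0.
by apply: rt_ratio_le => //; rewrite ltrDl.
Qed.

(** A Potter-type bound, obtained by iterating the ratio estimate at 2 beyond a threshold; its point
    is the uniformity in [n]. *)
Lemma rt_halving (mu : R) : mu < lambda ->
  \forall x \near +oo, forall n, F (2 ^+ n * x) <= (2 `^ (- mu)) ^+ n * F x.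
Proof.
move=> ml.
have [x0 x01 H] : exists2 x0 : R, 1 <= x0 &
    forall x, x0 <= x -> F (2 * x) <= 2 `^ (- mu) * F x.
  apply: near_pinfty_ex; apply: rt_ratio_le => //.
  rewrite !powRN ltf_pV2 ?posrE ?powR_gt0//.
  rewrite /powR !(gt_eqF (ltr0Sn R 1)) ltr_expR ltr_pM2r//.
  by rewrite ln_gt0// ltr1n.
apply: (@near_pinfty_of _ _ x0) => x x0x; elim => [|n IH].
  by rewrite !expr0 !mul1r.
rewrite exprS -mulrA; apply: le_trans (H _ _) _.
  rewrite -[leLHS]mul1r ler_pM//; first exact: le_trans x01.
  by rewrite exprn_ege1// ler1n.
by rewrite exprS -mulrA; apply: ler_wpM2l => //; rewrite powR_ge0.
Qed.

Lemma dyadic_bracket (x x0 : R) : 0 < x0 -> x0 <= x ->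
  exists n : nat, 2 ^+ n * x0 <= x < 2 ^+ n.+1 * x0.
Proof.
move=> x00 x0x; have x1 : 1 <= x / x0 by rewrite ler_pdivlMr// mul1r.
have tr0 : (0 < truncn (x / x0))%N by rewrite truncn_gt0.
have /andP[n1 n2] := trunc_log_bounds (isT : (1 < 2)%N) tr0.
have /andP[q1 q2] := truncn_itv (le_trans ler01 x1).
exists (trunc_log 2 (truncn (x / x0))); rewrite -ler_pdivlMr// -ltr_pdivrMr//.
rewrite -!natrX; apply/andP; split.
  by apply: le_trans q1; rewrite ler_nat.
by apply: lt_le_trans q2 _; rewrite ler_nat.
Qed.

(** [C1] covers the arguments below the threshold [x0], [C2] the others; the factor [2 * x0] inside
    [C2] pays for rounding down to a dyadic multiple of [x0]. *)
Lemma rt_upper (mu : R) : 0 < mu -> mu < lambda ->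
  exists2 C : R, 0 <= C & forall x, 1 <= x -> F x <= C * x `^ (- mu).
Proof.
move=> mu0 ml; have [x0 x01 H] := near_pinfty_ex (rt_halving ml).
have x00 : 0 < x0 by apply: lt_le_trans x01.
have F1 := ltW (rt_gt0 rF 1); have Fx0 := ltW (rt_gt0 rF x0).
pose C1 := F 1 * x0 `^ mu; pose C2 := F x0 * (2 * x0) `^ mu.
have C10 : 0 <= C1 by rewrite mulr_ge0 ?powR_ge0.
have C20 : 0 <= C2 by rewrite mulr_ge0 ?powR_ge0.
exists (C1 + C2); first by rewrite addr_ge0.
move=> x x1; have xp : 0 < x by apply: lt_le_trans x1.
rewrite mulrDl; have [x0x|xx0] := leP x0 x.
  rewrite -[leLHS]add0r; apply: lerD; first by rewrite mulr_ge0 ?powR_ge0.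
  have [n /andP[n1 n2]] := dyadic_bracket x00 x0x.
  apply: le_trans (rt_nonincreasing rF n1) _; apply: le_trans (H _ (lexx _) n) _.
  rewrite mulrC /C2 -mulrA; apply: ler_wpM2l => //.
  have -> : (2 `^ (- mu)) ^+ n = ((2 ^+ n) `^ mu)^-1.
    rewrite powRN exprVn -[(2 `^ mu) ^+ n]powR_mulrn ?powR_ge0//.
    by rewrite -powRrM mulrC powRrM powR_mulrn.
  rewrite powRN ler_pdivlMr ?powR_gt0// ler_pdivrMl ?powR_gt0 ?exprn_gt0//.
  rewrite -powRM ?exprn_ge0 ?mulr_ge0 ?(ltW x00)//.
  apply: ge0_ler_powR; rewrite ?nnegrE ?(ltW mu0) ?(ltW xp)//.
    by rewrite !mulr_ge0 ?exprn_ge0 ?(ltW x00).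
  by rewrite mulrA -exprSr ltW.
rewrite -[leLHS]addr0; apply: lerD; last by rewrite mulr_ge0 ?powR_ge0.
apply: le_trans (rt_nonincreasing rF x1) _.
rewrite /C1 -mulrA ler_peMr// powRN ler_pdivlMr ?powR_gt0// mul1r.
by apply: ge0_ler_powR; rewrite ?nnegrE ltW.
Qed.

Lemma rt_lower (m : nat) : lambda < m%:R ->
  exists2 c : R, 0 < c & \forall x \near +oo, c / x ^+ m <= F x.
Proof.
move=> lm.
have [x0 x01 H] : exists2 x0 : R, 1 <= x0 &
    forall x, x0 <= x -> 2 ^- m * F x <= F (2 * x).
  apply: near_pinfty_ex; apply: rt_ratio_ge => //.
  rewrite invrX_powR//.
  rewrite !powRN ltf_pV2 ?posrE ?powR_gt0//.
  rewrite /powR !(gt_eqF (ltr0Sn R 1)) ltr_expR ltr_pM2r//.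
  by rewrite ln_gt0// ltr1n.
have x00 : 0 < x0 by apply: lt_le_trans x01.
have iter n : (2 ^- m) ^+ n * F x0 <= F (2 ^+ n * x0).
  elim: n => [|n IH]; first by rewrite !expr0 !mul1r.
  rewrite [2 ^+ n.+1]exprS -mulrA; apply: le_trans (H _ _); last first.
    by rewrite -[leLHS]mul1r ler_wpM2r ?(ltW x00)// exprn_ege1// ler1n.
  by rewrite exprS -mulrA; apply: ler_wpM2l => //; rewrite invr_ge0 exprn_ge0.
exists (2 ^- m * F x0 * x0 ^+ m).
  by rewrite !mulr_gt0 ?invr_gt0 ?exprn_gt0 ?(rt_gt0 rF).
apply: (@near_pinfty_of _ _ x0) => x x0x.
have xp : 0 < x by apply: lt_le_trans x0x.
have [n /andP[n1 n2]] := dyadic_bracket x00 x0x.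
apply: le_trans (rt_nonincreasing rF (ltW n2)); apply: le_trans (iter n.+1).
rewrite exprS -!mulrA; apply: ler_wpM2l; first by rewrite invr_ge0 exprn_ge0.
rewrite [leRHS]mulrC; apply: ler_wpM2l; first exact: ltW (rt_gt0 rF _).
rewrite ler_pdivrMr ?exprn_gt0//.
rewrite -exprVn -exprM mulnC exprM -exprMn lerXn2r ?nnegrE ?(ltW x00)//.
  by rewrite mulr_ge0 ?exprn_ge0 ?invr_ge0// ltW.
by rewrite exprVn mulrC ler_pdivlMr ?exprn_gt0// mulrC.
Qed.

End regular_tail.

Section negligible.
Context (R : realType).
Variables (F : R -> R) (lambda : R).
Hypothesis rF : regular_tail F lambda.
Hypothesis lambda1 : 1 < lambda.

(** A one-sided little-o with respect to [x * F x], the scale of the ruin probability; it is applied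
    to error bounds that are nonnegative for large [x]. *)
Definition negligible (f : R -> R) : Prop :=
  forall e : R, 0 < e -> \forall x \near +oo, f x <= e * (x * F x).

Lemma negligibleD f g : negligible f -> negligible g ->
  negligible (fun x => f x + g x).
Proof.
move=> nf ng e e0; have e20 : 0 < e / 2 by rewrite divr_gt0.
near=> x; rewrite [leRHS](_ : _ = e / 2 * (x * F x) + e / 2 * (x * F x)).
  by apply: lerD; near: x; [exact: nf|exact: ng].
by field.
Unshelve. all: by end_near. Qed.

Lemma negligibleZ (k : R) f : 0 <= k -> negligible f ->
  negligible (fun x => k * f x).
Proof.
move=> k0 nf e e0; have k1 : 0 < k + 1 by rewrite ltr_wpDl.
have := nf (e / (k + 1)) (divr_gt0 e0 k1); apply: filterS2 (nbhs_pinfty_ge (num_real 0)).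
move=> x x0 H; apply: le_trans (ler_wpM2l k0 H) _.
have xF : 0 <= x * F x by rewrite mulr_ge0// ltW// (rt_gt0 rF).
rewrite [leLHS]mulrA; apply: ler_wpM2r => //; rewrite mulrCA ler_piMr ?(ltW e0)//.
by rewrite ler_pdivrMr// mul1r lerDl.
Qed.

Lemma negligible_inv_pow (k m : nat) (C : R) : 0 <= C -> lambda < k%:R ->
  (k < m)%N -> negligible (fun x => C / x ^+ m).
Proof.
move=> C0 lk km e e0; have [c c0 Hc] := rt_lower rF lk.
near=> x.
have x1 : 1 <= x by near: x; apply: nbhs_pinfty_ge; exact: num_real.
have xC : C / (e * c) <= x by near: x; apply: nbhs_pinfty_ge; exact: num_real.
have xp : 0 < x by apply: lt_le_trans x1.
apply: (@le_trans _ _ (e * (x * (c / x ^+ k)))); last first.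
  apply: ler_wpM2l; first exact: ltW.
  by apply: ler_wpM2l; [exact: ltW|near: x].
rewrite ler_pdivrMr ?exprn_gt0//.
have -> : x ^+ m = x ^+ k * x ^+ (m - k) by rewrite -exprD subnKC// ltnW.
have -> : e * (x * (c / x ^+ k)) * (x ^+ k * x ^+ (m - k)) =
   (e * c) * (x * x ^+ (m - k)).
  by field; rewrite expf_neq0// gt_eqF.
rewrite -ler_pdivrMl ?mulr_gt0// mulrC; apply: le_trans xC _.
by rewrite ler_peMr ?(ltW xp)// exprn_ege1.
Unshelve. all: by end_near. Qed.

(** The assumption [1 < lambda] enters here: [F] is dominated by a power of exponent [- mu] with
    [mu] midway between 1 and [lambda]. *)
Lemma rt_xF_small (e : R) : 0 < e -> \forall x \near +oo, x * F x <= e.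
Proof.
move=> e0; pose mu := (1 + lambda) / 2.
have l1 := lambda1; have mu1 : 1 < mu by rewrite /mu; lra.
have mul : mu < lambda by rewrite /mu; lra.
have mu0 : 0 < mu by apply: lt_trans mu1.
have [C C0 HC] := rt_upper rF mu0 mul.
have C1 : 0 < C + 1 by rewrite ltr_wpDl.
near=> x; have x1 : 1 <= x by near: x; apply: nbhs_pinfty_ge; exact: num_real.
have xp : 0 < x by apply: lt_le_trans x1.
apply: (@le_trans _ _ (x * (C * x `^ (- mu)))).
  by apply: ler_wpM2l; [exact: ltW|exact: HC].
apply: (@le_trans _ _ ((C + 1) * x `^ (- (mu - 1)))).
  have -> : - (mu - 1) = 1 + - mu by ring.
  rewrite powRD; last by rewrite (gt_eqF xp) implybT.
  rewrite powRr1 ?(ltW xp)// mulrCA; apply: ler_wpM2r; last by rewrite lerDl.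
  by rewrite mulr_ge0 ?powR_ge0 ?ltW.
rewrite -ler_pdivlMl// mulrC; near: x; apply: powRN_small.
  by rewrite subr_gt0.
by rewrite divr_gt0.
Unshelve. all: by end_near. Qed.

(** This is the order of the probability of two long stages among about [K * x] blocks. One factor
    tends to 0, the other is comparable to [x * F x]. *)
Lemma negligible_sq (t K : R) : 0 < t -> 0 <= K ->
  negligible (fun x => K * (x * F (t * x)) ^+ 2).
Proof.
move=> t0 K0; apply: negligibleZ => // e e0.
have [C C0 HC] := rt_ratio_bounded rF t0.
near=> x; have xp : 0 <= x by near: x; apply: nbhs_pinfty_ge; exact: num_real.
have F0 := ltW (rt_gt0 rF (t * x)).
have FC : F (t * x) <= C * F x by near: x.
have xF : t * x * F (t * x) <= e * t / C.
  near: x; apply: (near_pinfty_scale (Q := fun y => y * F y <= e * t / C) t0).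
  by apply: rt_xF_small; rewrite divr_gt0// mulr_gt0.
have H : x * F (t * x) <= e / C.
  rewrite -(ler_pM2l t0) mulrA; apply: le_trans xF _.
  by rewrite mulrCA mulrA.
rewrite expr2; apply: (@le_trans _ _ (e / C * (x * F (t * x)))).
  by apply: ler_wpM2r => //; rewrite mulr_ge0.
rewrite -!mulrA; apply: ler_wpM2l; first exact: ltW.
rewrite mulrCA; apply: ler_wpM2l => //.
by rewrite ler_pdivrMl.
Unshelve. all: by end_near. Qed.

End negligible.

Section regularly_varying_tail.
Context (d : measure_display) (Omega : measurableType d) (R : realType)
  (P : probability Omega R).

Lemma measurable_gt (X : Omega -> R) (x : R) : measurable_fun setT X ->
  measurable [set w | x < X w].
Proof.
by move=> mX; rewrite -[X in measurable X]setTI; exact: measurable_fun_ltr.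
Qed.

Lemma regularly_varying_regular_tail (T : {RV P >-> R}) (lambda : R) :
  regularly_varying T lambda -> regular_tail (tail P T) lambda.
Proof.
move=> [L [mL Lpos Lratio] TL].
have nd (x y : R) : x <= y -> tail P T y <= tail P T x.
  move=> xy; apply: le_pr; try exact: measurable_gt.
  by move=> w /=; exact: le_lt_trans.
have [x0 x01 H0] := near_pinfty_ex Lpos.
(* The representation gives positivity for large arguments only; monotonicity extends it to all of
   them. *)
have pos (x : R) : 0 < tail P T x.
  apply: lt_le_trans (nd x (maxr x x0) _); last by rewrite le_max lexx.
  have xp : 0 < maxr x x0 by rewrite lt_max (lt_le_trans ltr01 x01) orbT.
  by rewrite TL// mulr_gt0 ?powR_gt0// H0// le_max lexx orbT.
split => // t t0.
have := Lratio t t0 => HL.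
have : t `^ (- lambda) * (L (t * x) / L x) @[x --> +oo] --> t `^ (- lambda) * 1.
  by apply: cvgMr.
rewrite mulr1; apply: cvg_trans; apply: near_eq_cvg; near=> x.
have xp : 0 < x by near: x; apply: nbhs_pinfty_gt; exact: num_real.
rewrite !TL ?mulr_gt0// powRM ?(ltW xp) ?(ltW t0)//.
have Lx : L x != 0 by rewrite gt_eqF//; near: x.
by field; rewrite Lx gt_eqF// powR_gt0.
Unshelve. all: by end_near. Qed.

(* On [2 ^ n < V <= 2 ^ n.+1] the integrand is at most [4 ^ a * 2 ^ (n * a)]. *)
Lemma moment_finite (V : Omega -> R) (a mu C : R) :
  measurable_fun setT V -> (forall w, 0 <= V w) -> 0 < a -> a < mu -> 0 <= C ->
  (forall x : R, 1 <= x -> pr P [set w | x < V w] <= C * x `^ (- mu)) ->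
  exists2 M : R, 0 <= M & (\int[P]_w ((1 + V w) `^ a)%:E <= M%:E)%E.
Proof.
move=> mV V0 a0 amu C0 HC.
pose g n w : \bar R := ((2 ^+ n) `^ a * \1_[set w | 2 ^+ n < V w] w)%:E.
have g0 n w : (0 <= g n w)%E by rewrite lee_fin mulr_ge0 ?powR_ge0.
have mg n : measurable_fun setT (g n).
  apply/measurable_EFinP; apply: measurable_funM => //.
  by apply: measurable_indic; exact: measurable_gt.
pose z : R := 2 `^ (a - mu).
have z01 : 0 < z < 1.
  rewrite powR_gt0//= /z -opprB powRN invf_lt1 ?powR_gt0//.
  rewrite [ltLHS](_ : 1 = 1 `^ (mu - a)); last by rewrite powR1.
  by apply: gt0_ltr_powR; rewrite ?nnegrE ?ltr1n// subr_gt0.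
have ig n : (\int[P]_w g n w <= (C * z ^+ n)%:E)%E.
  rewrite /g; under eq_integral do rewrite EFinM.
  have mn : measurable [set w | 2 ^+ n < V w] by exact: measurable_gt.
  rewrite ge0_integralZl//; last first.
    by apply/measurable_EFinP; exact: measurable_indic.
  rewrite -(prob_integral P mn) pr_fin// -EFinM lee_fin.
  apply: (@le_trans _ _ ((2 ^+ n) `^ a * (C * (2 ^+ n) `^ (- mu)))).
    by apply: ler_wpM2l; [exact: powR_ge0|apply: HC; rewrite exprn_ege1// ler1n].
  rewrite mulrCA -powRD; last by rewrite expf_neq0 ?implybT.
  rewrite ler_wpM2l// /z -!powR_mulrn ?powR_ge0// -!powRrM mulrC.
  by rewrite [(a - mu) * _]mulrC.
have isum : (\int[P]_w (\sum_(n <oo) g n w) <= (C / (1 - z))%:E)%E.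
  rewrite integral_nneseries//.
  apply: lime_le; first by apply: is_cvg_nneseries => n _ _; exact: integral_ge0.
  near=> n; apply: (@le_trans _ _ (\sum_(0 <= i < n) (C * z ^+ i)%:E)%E).
    by apply: lee_sum => i _; exact: ig.
  rewrite sumEFin lee_fin; case/andP: z01 => z0 z1.
  by apply: (geometric_le_lim n C0 z0); rewrite ger0_norm ?ltW.
exists (4 `^ a * (1 + C / (1 - z))).
  rewrite mulr_ge0 ?powR_ge0// addr_ge0// divr_ge0// subr_ge0.
  by case/andP: z01 => _ /ltW.
have s0 w : (0 <= \sum_(n <oo) g n w)%E by exact: nneseries_ge0.
have ms : measurable_fun setT (fun w => \sum_(n <oo) g n w)%E.
  by apply: ge0_emeasurable_sum => //.
apply: (@le_trans _ _ (\int[P]_w ((4 `^ a)%:E * (1 + \sum_(n <oo) g n w)))%E); last first.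
  rewrite ge0_integralZl//; last 2 first.
  - exact: emeasurable_funD.
  - by move=> w _; rewrite adde_ge0.
  rewrite EFinM lee_wpmul2l ?lee_fin ?powR_ge0// ge0_integralD//.
  rewrite EFinD; apply: leeD isum.
  by rewrite integral_cst// mul1e; exact: probability_le1.
apply: ge0_le_integral => //.
- by move=> w _; rewrite lee_fin powR_ge0.
- apply/measurable_EFinP; apply: (measurableT_comp (measurable_powR a)).
  exact: measurable_funD.
- by apply: measurable_funeM; exact: emeasurable_funD.
move=> w _; have [V1|V1] := leP (V w) 1.
  apply: (@le_trans _ _ ((4 `^ a)%:E * 1)%E); last first.
    by rewrite lee_wpmul2l ?lee_fin ?powR_ge0// leeDl.
  rewrite mule1 lee_fin; apply: ge0_ler_powR; rewrite ?nnegrE ?(ltW a0) ?addr_ge0//.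
  by lra.
have [n /andP[n1 n2]] : exists n : nat, 2 ^+ n < V w <= 2 ^+ n.+1.
  have [n /andP[n1 n2]] := dyadic_bracket (@ltr01 R) (ltW V1).
  rewrite !mulr1 in n1 n2; case: (ltP (2 ^+ n) (V w)) => h.
    by exists n; rewrite h ltW.
  have E : V w = 2 ^+ n by apply/eqP; rewrite eq_le h n1.
  case: n n1 n2 h E => [|n] n1 n2 h E; first by rewrite E expr0 ltxx in V1.
  by exists n; rewrite E lexx andbT [ltRHS]exprS ltr_pMl ?exprn_gt0 ?ltr1n.
apply: (@le_trans _ _ ((4 `^ a)%:E * g n w)%E); last first.
  rewrite lee_wpmul2l ?lee_fin ?powR_ge0//.
  apply: (@le_trans _ _ (\sum_(n <oo) g n w)%E); last by rewrite leeDr.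
  apply: le_trans (nneseries_lim_ge n.+1 _) => //.
  by rewrite big_nat_recr//= leeDr// sume_ge0.
rewrite /g -EFinM lee_fin indicE mem_set// mulr1 -powRM ?exprn_ge0//.
apply: ge0_ler_powR; rewrite ?nnegrE ?(ltW a0) ?addr_ge0 ?mulr_ge0 ?exprn_ge0//.
have : 1 <= 2 ^+ n :> R by rewrite exprn_ege1// ler1n.
by move: n2; rewrite exprS; lra.
Unshelve. all: by end_near. Qed.

End regularly_varying_tail.

(** * Exponential moments of truncated variables *)

Section exp_bounds.
Context (R : realType).
Implicit Types y eta : R.

Let powR_ge_self y eta : 1 <= y -> 0 <= eta -> y <= y `^ (1 + eta).
Proof. by move=> y1 e0; apply: le1r_powR => //; rewrite lerDl. Qed.

Let powR_ge_sq y eta : 0 <= y <= 1 -> 0 <= eta <= 1 -> y ^+ 2 <= y `^ (1 + eta).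
Proof.
move=> /andP[y0 y1] /andP[e0 e1]; move: y0; rewrite le_eqVlt => /orP[/eqP <-|y0].
  by rewrite expr0n powR_ge0.
rewrite -powR_mulrn ?(ltW y0)// /powR (gt_eqF y0) ler_expR.
by apply: ler_wnM2r; [exact: ln_le0|rewrite -[2%:R]/(1 + 1) lerD2l].
Qed.

Lemma one_plus_powR_ge0 y eta : 0 <= eta -> 0 <= 1 + y + `|y| `^ (1 + eta).
Proof.
move=> e0; have [y1|y1] := lerP (-1) y.
  by rewrite addr_ge0 ?powR_ge0//; lra.
have h : 1 <= - y by lra.
by have := powR_ge_self h e0; rewrite ltr0_norm; lra.
Qed.

(** A first-order expansion whose remainder needs only a moment of order [1 + eta]: for [|y| <= 1]
    the quadratic term is below [|y| ^ (1 + eta)], and for [|y| >= 1] already the linear one is. *)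
Lemma expR_le_powR y eta : 0 <= eta <= 1 ->
  expR y <= 1 + y + `|y| `^ (1 + eta) * expR (maxr y 0).
Proof.
move=> /andP[e0 e1]; have [y0|y0] := lerP 0 y.
  rewrite ger0_norm//.
  have [y1|y1] := lerP 1 y.
    have h : 1 <= y `^ (1 + eta) by apply: le_trans (powR_ge_self y1 e0).
    have : expR y <= y `^ (1 + eta) * expR y by rewrite ler_peMl ?expR_ge0.
    by lra.
  have h := powR_ge_sq (introT andP (conj y0 (ltW y1))) (introT andP (conj e0 e1)).
  have k : expR y <= 1 + y * expR y.
    have := expR_ge1Dx (- y); rewrite expRN => k.
    have ey := expR_gt0 y.
    have : (1 - y) * expR y <= 1 by rewrite -ler_pdivlMr// mul1r.
    by lra.
  have k2 : y * expR y <= y * (1 + y * expR y) by rewrite ler_wpM2l.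
  have k3 : y ^+ 2 * expR y <= y `^ (1 + eta) * expR y by rewrite ler_wpM2r ?expR_ge0.
  by move: k2 k3; rewrite expr2; lra.
rewrite expR0 mulr1 ltr0_norm//.
have [y1|y1] := lerP (-1) y.
  have h := @powR_ge_sq (- y) eta _ (introT andP (conj e0 e1)).
  have {}h : (- y) ^+ 2 <= (- y) `^ (1 + eta) by apply: h; apply/andP; split; lra.
  apply: (@le_trans _ _ (1 + y + y ^+ 2)); last by rewrite lerD2l -sqrrN.
  have := expR_ge1Dx (- y); rewrite expRN => k.
  have ey := expR_gt0 y.
  have h1 : 0 < 1 - y by lra.
  have k1 : expR y <= (1 - y)^-1 by rewrite -[leLHS]invrK lef_pV2 ?posrE ?invr_gt0.
  apply: le_trans k1 _; rewrite -[leLHS]mul1r ler_pdivrMr//.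
  have : 0 <= (- y) ^+ 3 by rewrite exprn_ge0// oppr_ge0 ltW.
  by rewrite !exprS !expr0; lra.
have : - y <= (- y) `^ (1 + eta) by apply: powR_ge_self => //; lra.
have : expR y <= 1 by rewrite -expR0 ler_expR ltW.
by lra.
Qed.

End exp_bounds.

Section truncated_exp_moment.
Context (d : measure_display) (Omega : measurableType d) (R : realType)
  (P : probability Omega R).
Variables (V : Omega -> R) (H eta M m1 : R).
Hypothesis mV : measurable_fun setT V.
Hypothesis V0 : forall w, 0 <= V w.
Hypothesis H01 : 0 < H < 1.
Hypothesis eta01 : 0 < eta <= 1.
Hypothesis VM : (\int[P]_w ((1 + V w) `^ (1 + eta))%:E <= M%:E)%E.
Hypothesis Vm1 : (\int[P]_w (V w)%:E = m1%:E)%E.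

(** At this rate, a deviation [eps * x] is weighted by [x ^ (- kappa * eps)], while a variable
    truncated at [dl * x] contributes at most the small power [x ^ (kappa * dl)]. *)
Definition chernoff_rate (kappa x : R) : R := kappa * ln x / x.

(** For [H > 1/2] the variance grows faster than linearly. Below the truncation level it is linear
    up to [x ^ H], which is harmless because [h * x ^ H] tends to 0 for [h] the Chernoff rate. *)
Let powR2H_le (v x : R) : 0 <= v -> v <= x -> 1 <= x ->
  v `^ (2 * H) <= x `^ H * (1 + v).
Proof.
case/andP: H01 => H0 H1 v0 vx x1.
have xH1 : 1 <= x `^ H.
  rewrite -[leLHS](_ : 1 `^ H = 1); last by rewrite powR1.
  by apply: ge0_ler_powR; rewrite ?nnegrE ?(ltW H0)// (le_trans _ x1).
have [v1|v1] := leP v 1.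
  have : v `^ (2 * H) <= 1.
    rewrite -[leRHS](_ : 1 `^ (2 * H) = 1); last by rewrite powR1.
    by apply: ge0_ler_powR; rewrite ?nnegrE ?mulr_ge0 ?(ltW H0).
  move=> h; apply: (le_trans h); rewrite -[leLHS]mulr1.
  by rewrite ler_pM// lerDl.
have vp : 0 < v by apply: lt_trans v1.
apply: (@le_trans _ _ (v `^ H * v)).
  have -> : v `^ H * v = v `^ (H + 1).
    by rewrite powRD ?powRr1 ?(ltW vp)// (gt_eqF vp) implybT.
  by apply: ler_powR; [exact: ltW|lra].
apply: ler_pM => //; rewrite ?powR_ge0//.
  by apply: ge0_ler_powR; rewrite ?nnegrE ?(ltW H0)// (le_trans _ x1).
by rewrite lerDr.
Qed.

(** With [h] the rate, the Gaussian factor is absorbed into [z = h * rho + h * (s + rho) * V], and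
    [expR_le_powR] is applied to [z]. On the truncation event the exponential in the remainder is at
    most [x ^ (eta / 2)], and [h ^ (1 + eta) * x ^ (eta / 2)] is small compared with [h]. *)
Lemma truncated_exp_moment (s eps kappa : R) : 0 < eps -> 0 < kappa ->
  exists2 d0 : R, 0 < d0 <= 1 & forall dl : R, 0 < dl <= d0 ->
    \forall x \near +oo,
    (\int[P]_w (expR (chernoff_rate kappa x * s * V w) * (V w <= dl * x)%R%:R *
       expR (4 * (chernoff_rate kappa x) ^+ 2 * V w `^ (2 * H)))%:E <=
    (1 + chernoff_rate kappa x * (s * m1 + eps))%:E)%E.
Proof.
move=> eps0 kappa0; case/andP: (eta01) => eta0 eta1.
have m10 : 0 <= m1 by rewrite -lee_fin -Vm1; apply: integral_ge0 => w _; rewrite lee_fin.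
have M0 : 0 <= M.
  rewrite -lee_fin; apply: le_trans VM; apply: integral_ge0 => w _.
  by rewrite lee_fin powR_ge0.
(* The expectation of [h * rho * (1 + V)] is then [h * eps / 2], half of the allowed error; the
   other half is left to the remainder. *)
pose rho := eps / (2 * (1 + m1)).
have m11 : 0 < 1 + m1 by rewrite ltr_wpDr.
have rho0 : 0 < rho by rewrite divr_gt0// mulr_gt0.
pose p3 := `|s| + rho.
have p30 : 0 < p3 by rewrite ltr_wpDl.
(* For [V <= dl * x] the exponent is at most [2 * kappa * dl * p3 * ln x], which this choice keeps
   below [eta / 2 * ln x]. *)
pose d0 := minr 1 (eta / (4 * kappa * p3)).
have kp : 0 < 4 * kappa * p3 by rewrite !mulr_gt0.
exists d0; first by rewrite lt_min ltr01 ge_min lexx/= andbT divr_gt0.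
move=> dl /andP[dl0 dld0].
have dl1 : dl <= 1 by apply: le_trans dld0 _; rewrite ge_min lexx.
have dlk : 2 * kappa * dl * p3 <= eta / 2.
  have : dl <= eta / (4 * kappa * p3) by apply: le_trans dld0 _; rewrite ge_min lexx orbT.
  rewrite ler_pdivlMr// => h; rewrite ler_pdivlMr//.
  by rewrite (_ : _ * 2 = dl * (4 * kappa * p3))//; ring.
(* [A] dominates the moment in the remainder; [e1] is the bound on [ln x / sqrt x] that makes the
   whole remainder at most [h * eps / 2]. *)
pose A := p3 `^ (1 + eta) * M + 1.
have A0 : 0 < A by rewrite ltr_wpDl// mulr_ge0 ?powR_ge0.
pose e1 := (eps / (2 * A)) `^ (eta^-1) / kappa.
have eA : 0 < eps / (2 * A) by rewrite divr_gt0// mulr_gt0.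
have e10 : 0 < e1 by apply: divr_gt0 => //; exact: powR_gt0.
have H0 : 0 < H < 1 by [].
have r40 : 0 < rho / (4 * kappa) by rewrite divr_gt0// mulr_gt0.
have H1 : 0 < 1 - H by rewrite subr_gt0; case/andP: H01.
near=> x.
have x1 : 1 < x by near: x; apply: nbhs_pinfty_gt; exact: num_real.
have xdl : 1 <= dl * x.
  rewrite mulrC -ler_pdivrMr//; near: x; apply: nbhs_pinfty_ge; exact: num_real.
have xp : 0 < x by apply: lt_trans x1.
have lx0 : 0 < ln x by rewrite ln_gt0.
set h := chernoff_rate kappa x.
have h0 : 0 < h by rewrite /h /chernoff_rate divr_gt0// mulr_gt0.
have hrho : 4 * h * x `^ H <= rho.
  have : ln x * x `^ (- (1 - H)) <= rho / (4 * kappa).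
    by near: x; apply: ln_powRN_small.
  have -> : - (1 - H) = H + - 1 by ring.
  rewrite powRD; last by rewrite (gt_eqF xp) implybT.
  rewrite powRN powRr1 ?(ltW xp)// ler_pdivlMr ?mulr_gt0// => hh.
  apply: le_trans hh; rewrite /h /chernoff_rate le_eqVlt; apply/orP; left; apply/eqP.
  by ring.
have heta : h `^ eta * x `^ (eta / 2) <= eps / (2 * A).
  have : ln x * x `^ (- 2^-1) <= e1 by near: x; apply: ln_powRN_small.
  rewrite /e1 ler_pdivlMr// => hh.
  have : (ln x * x `^ (- 2^-1) * kappa) `^ eta <= ((eps / (2 * A)) `^ (eta^-1)) `^ eta.
    apply: ge0_ler_powR => //; rewrite ?nnegrE ?powR_ge0 ?(ltW eta0)//.
    by rewrite !mulr_ge0 ?powR_ge0 ?ltW.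
  rewrite -powRrM mulVf ?(gt_eqF eta0)// powRr1; last first.
    by rewrite divr_ge0 ?(ltW eps0)// mulr_ge0// ltW.
  move=> hh2; apply: le_trans hh2.
  have -> : x `^ (eta / 2) = (x `^ 2^-1) `^ eta by rewrite -powRrM mulrC.
  rewrite -powRM ?powR_ge0 ?(ltW h0)// le_eqVlt; apply/orP; left; apply/eqP.
  congr (_ `^ _); rewrite /h /chernoff_rate.
  rewrite powRN; have q : x = x `^ 2^-1 * x `^ 2^-1.
    rewrite -powRD; last by rewrite (gt_eqF xp) implybT.
    by rewrite (_ : 2^-1 + 2^-1 = 1) ?powRr1 ?(ltW xp)//; field.
  have q0 : x `^ 2^-1 != 0 by rewrite gt_eqF// powR_gt0.
  by rewrite [X in _ / X]q; field.
have hE : h = kappa * ln x / x by [].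
clearbody h.
pose B := (h * p3) `^ (1 + eta) * x `^ (eta / 2).
have B0 : 0 <= B by rewrite mulr_ge0 ?powR_ge0.
pose g w := (1 + h * rho) + h * (s + rho) * V w + B * (1 + V w) `^ (1 + eta).
have hp3 : 0 < h * p3 by rewrite mulr_gt0.
have fg w : expR (h * s * V w) * (V w <= dl * x)%R%:R *
       expR (4 * h ^+ 2 * V w `^ (2 * H)) <= g w.
  have W1 : 0 < 1 + V w by rewrite ltr_wpDr.
  pose z := h * rho + h * (s + rho) * V w.
  have zabs : `|z| <= h * p3 * (1 + V w).
    rewrite /z -mulrA -mulrDr normrM (gtr0_norm h0) -mulrA ler_wpM2l ?(ltW h0)//.
    apply: le_trans (ler_normD _ _) _; rewrite (normrM _ (V w)) (ger0_norm (V0 w)) (gtr0_norm rho0).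
    rewrite mulrDr mulr1; apply: lerD; first by rewrite lerDr.
    apply: ler_wpM2r => //; apply: le_trans (ler_normD _ _) _.
    by rewrite (gtr0_norm rho0).
  have zpow : `|z| `^ (1 + eta) <= (h * p3) `^ (1 + eta) * (1 + V w) `^ (1 + eta).
    rewrite -powRM ?(ltW hp3) ?(ltW W1)//.
    have q0 : 0 <= h * p3 * (1 + V w) := mulr_ge0 (ltW hp3) (ltW W1).
    by apply: ge0_ler_powR; rewrite ?nnegrE ?normr_ge0// addr_ge0// ltW.
  have xe1 : 1 <= x `^ (eta / 2).
    rewrite -[leLHS](_ : 1 `^ (eta / 2) = 1); last by rewrite powR1.
    by apply: ge0_ler_powR; rewrite ?nnegrE ?divr_ge0 ?(ltW eta0) ?(ltW xp) ?(ltW x1).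
  have gz : 1 + z + `|z| `^ (1 + eta) * x `^ (eta / 2) <= g w.
    rewrite /g /B /z !addrA lerD2l [leRHS]mulrAC.
    by apply: ler_wpM2r => //; exact: powR_ge0.
  apply: le_trans gz; have [Vx|Vx] := leP (V w) (dl * x); last first.
    (* Off the truncation event the left side is 0, so only the nonnegativity of the bound
       matters. *)
    rewrite mulr0 mul0r; apply: le_trans (one_plus_powR_ge0 z (ltW eta0)) _.
    by rewrite lerD2l ler_peMr ?powR_ge0.
  rewrite mulr1 -expRD.
  have Vxx : V w <= x by apply: le_trans Vx _; rewrite ler_piMl// ltW.
  have zle : h * s * V w + 4 * h ^+ 2 * V w `^ (2 * H) <= z.
    have := powR2H_le (V0 w) Vxx (ltW x1) => q.
    have : 4 * h ^+ 2 * V w `^ (2 * H) <= 4 * h ^+ 2 * (x `^ H * (1 + V w)).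
      by rewrite ler_wpM2l// mulr_ge0// sqr_ge0.
    have : h * (1 + V w) * (4 * h * x `^ H) <= h * (1 + V w) * rho.
      by rewrite ler_wpM2l// mulr_ge0 ?(ltW h0) ?(ltW W1).
    rewrite /z => q1 q2; move: q1 q2; rewrite expr2; lra.
  apply: le_trans (_ : expR z <= _); first by rewrite ler_expR.
  have eta01' : 0 <= eta <= 1 by rewrite (ltW eta0).
  apply: le_trans (expR_le_powR z eta01') _.
  rewrite lerD2l; apply: ler_wpM2l; first exact: powR_ge0.
  rewrite /powR (gt_eqF xp) ler_expR ge_max; apply/andP; split; last first.
    by rewrite mulr_ge0 ?divr_ge0 ?(ltW eta0) ?(ltW lx0).
  apply: le_trans (ler_norm z) _; apply: le_trans zabs _.
  apply: (@le_trans _ _ (h * p3 * (2 * (dl * x)))).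
    by apply: ler_wpM2l; [exact: ltW|lra].
  have -> : h * p3 * (2 * (dl * x)) = (2 * kappa * dl * p3) * ln x.
    by rewrite hE; field; rewrite gt_eqF.
  by apply: ler_wpM2r => //; exact: ltW.
have iV : P.-integrable setT (EFin \o V).
  apply/integrableP; split; first exact/measurable_EFinP.
  by under eq_integral do rewrite /= ger0_norm//; rewrite Vm1 ltry.
have mW : measurable_fun setT (fun w => (1 + V w) `^ (1 + eta)).
  by apply: (measurableT_comp (measurable_powR _)); exact: measurable_funD.
have iW : P.-integrable setT (fun w => ((1 + V w) `^ (1 + eta))%:E).
  apply/integrableP; split; first exact/measurable_EFinP.
  under eq_integral do rewrite /= ger0_norm ?powR_ge0//.
  by apply: le_lt_trans VM _; rewrite ltry.
have i1 : P.-integrable setT (fun w => ((1 + h * rho)%:E + (h * (s + rho))%:E * (V w)%:E)%E).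
  by apply: integrableD => //; [exact: finite_measure_integrable_cst|exact: integrableZl].
have i2 : P.-integrable setT (fun w => (B%:E * ((1 + V w) `^ (1 + eta))%:E)%E).
  exact: integrableZl.
have ig : P.-integrable setT (fun w => (g w)%:E).
  apply: (@eq_integrable _ _ _ P setT measurableT (fun w =>
     ((1 + h * rho)%:E + (h * (s + rho))%:E * (V w)%:E) +
      B%:E * ((1 + V w) `^ (1 + eta))%:E)%E) => //.
  exact: integrableD.
have mf : measurable_fun setT (fun w => expR (h * s * V w) * (V w <= dl * x)%R%:R *
       expR (4 * h ^+ 2 * V w `^ (2 * H))).
  apply: measurable_funM; last first.
    apply: measurableT_comp => //; apply: measurable_funM => //.
    exact: (measurableT_comp (measurable_powR _)).
  apply: measurable_funM.
    by apply: measurableT_comp => //; exact: measurable_funM.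
  rewrite (_ : (fun w => _) = \1_[set w | V w <= dl * x]).
    apply: measurable_indic; rewrite -[X in measurable X]setTI.
    exact: measurable_fun_ler.
  apply/funext => w; rewrite indicE; congr (_%:R).
  by case: (boolP (V w <= dl * x)) => [q|/negP q]; [rewrite mem_set|rewrite memNset].
have f0 w : 0 <= expR (h * s * V w) * (V w <= dl * x)%R%:R *
       expR (4 * h ^+ 2 * V w `^ (2 * H)) by rewrite !mulr_ge0 ?expR_ge0.
apply: (@le_trans _ _ (\int[P]_w (g w)%:E)%E).
  apply: le_integral => //.
    apply: (le_integrable measurableT _ _ ig); first exact/measurable_EFinP.
    move=> w _; rewrite !abse_EFin lee_fin !ger0_norm ?fg//.
    exact: le_trans (f0 w) (fg w).
  by move=> w _; rewrite lee_fin; exact: fg.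
rewrite (_ : (\int[P]_w (g w)%:E)%E = (\int[P]_w (((1 + h * rho)%:E +
   (h * (s + rho))%:E * (V w)%:E) + B%:E * ((1 + V w) `^ (1 + eta))%:E))%E); last first.
  by apply: eq_integral => w _; rewrite -!EFinM -!EFinD.
rewrite integralD// integralD//; last 2 first.
- exact: finite_measure_integrable_cst.
- exact: integrableZl.
rewrite integral_cst// !integralZl// Vm1 [X in (_ * X + _ + _)%E](_ : _ = 1%E); last first.
  exact: probability_setT.
rewrite mule1 -EFinM -EFinD.
apply: (@le_trans _ _ ((1 + h * rho + h * (s + rho) * m1)%:E + (B * M)%:E)%E).
  by apply: leeD => //; rewrite [leRHS]EFinM; apply: lee_wpmul2l => //; rewrite lee_fin.
rewrite -EFinD lee_fin.
have BM : B * M <= h * (eps / 2).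
  have -> : B * M = h * (h `^ eta * x `^ (eta / 2)) * (p3 `^ (1 + eta) * M).
    rewrite /B powRM ?(ltW h0) ?(ltW p30)// powRD; last by rewrite (gt_eqF h0) implybT.
    by rewrite powRr1 ?(ltW h0)//; ring.
  rewrite -!mulrA; apply: ler_wpM2l; first exact: ltW.
  rewrite mulrA; apply: (@le_trans _ _ (eps / (2 * A) * A)).
    apply: ler_pM => //; first by rewrite mulr_ge0 ?powR_ge0.
      by rewrite mulr_ge0 ?powR_ge0.
    by rewrite /A lerDl.
  by rewrite le_eqVlt; apply/orP; left; apply/eqP; field; rewrite gt_eqF.
have rm : rho * (1 + m1) = eps / 2.
  by rewrite /rho; field; rewrite gt_eqF.
have : h * (rho * (1 + m1)) = h * (eps / 2) by rewrite rm.
lra.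
Unshelve. all: by end_near. Qed.

End truncated_exp_moment.

(** * Long-stage barriers and Riemann sums *)

(* The processes vanish at time [0] only almost surely, hence crossings have to be
   witnessed at positive times. *)
Lemma positive_witness (R : realType) (f : R -> R) (L t : R) :
  {within `[0, +oo[, continuous f} -> 0 < L -> 0 <= t <= L -> 0 < f t ->
  exists2 s, 0 < s <= L & 0 < f s.
Proof.
move=> cf L0 /andP[]; rewrite le_eqVlt => /predU1P[<- _ f0|t0 tL ft]; last first.
  by exists t => //; rewrite t0.
have /subspace_continuousP/(_ 0) := cf.
rewrite /= in_itv/= lexx => /(_ isT)/cvgr_gt/(_ _ f0).
rewrite near_withinE => /nbhs_ballP[e /= e0 He].
exists (minr (e / 2) L); first by rewrite lt_min divr_gt0//= L0 ge_min lexx orbT.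
apply: He; last by rewrite in_itv/= andbT le_min !ltW// divr_gt0.
rewrite /ball/= sub0r normrN ger0_norm; last by rewrite le_min !ltW// divr_gt0.
by rewrite gt_min ltr_pdivrMr// mulr_natr mulr2n ltrDl e0.
Qed.

Section bonferroni.
Context (d : measure_display) (Omega : measurableType d) (R : realType)
  (P : probability Omega R).

Lemma pr_setU A B : measurable A -> measurable B ->
  pr P (A `|` B) = pr P A + pr P B - pr P (A `&` B).
Proof.
move=> mA mB; apply: EFin_inj; rewrite EFinB EFinD -!pr_fin//.
- by rewrite measureUfinl// -ge0_fin_numE// fin_num_measure.
- exact: measurableI.
- exact: measurableU.
Qed.

(** By induction: the [n]-th set meets the union of the preceding ones with probability at most
    [n * s]. The crude factor [n ^ 2] is affordable, [s] being later the square of a tail. *)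
Lemma bonferroni (n : nat) (A : nat -> set Omega) (s : R) :
  (forall i : nat, measurable (A i)) -> 0 <= s ->
  (forall i k : nat, i != k -> pr P (A i `&` A k) <= s) ->
  \sum_(i < n) pr P (A i) - n%:R ^+ 2 * s <= pr P (\bigcup_(i in `I_n) A i).
Proof.
move=> mA s0 As; elim: n => [|n IH].
  by rewrite big_ord0 expr0n mul0r subr0 pr_ge0.
have -> : \bigcup_(i in `I_n.+1) A i = (\bigcup_(i in `I_n) A i) `|` A n.
  by rewrite !bigcup_mkord big_ord_recr.
have mU : measurable (\bigcup_(i in `I_n) A i) by exact: bigcup_measurable.
rewrite big_ord_recr /= pr_setU//.
have : pr P (\bigcup_(i in `I_n) A i `&` A n) <= n%:R * s.
  rewrite setI_bigcupl; apply: pr_bigcup_ord_cst => [i|i ni]; first exact: measurableI.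
  by apply: As; rewrite ltn_eqF.
have : n.+1%:R ^+ 2 * s = n%:R ^+ 2 * s + n%:R * s + (n%:R * s + s).
  by rewrite -natr1; ring.
have : 0 <= n%:R * s by rewrite mulr_ge0.
move: IH; set x := n%:R ^+ 2 * s; set y := n%:R * s; lra.
Qed.

End bonferroni.

Lemma ord2_cases (j : 'I_2) : j = ord0 \/ j = ord_max.
Proof.
by case: j => -[|[|//]] i; [left|right]; exact: val_inj.
Qed.

Lemma positive_lower_bound (R : realType) (f : 'I_2 -> R) : (forall j, 0 < f j) ->
  exists2 m : R, 0 < m & forall j, m <= f j.
Proof.
move=> f0; exists (minr (f ord0) (f ord_max)); first by rewrite lt_min !f0.
by move=> j; case: (ord2_cases j) => ->; rewrite ge_min lexx ?orbT.
Qed.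

Section barrier.
Context (R : realType).
Variables (a c p : 'I_2 -> R).
Hypothesis a0 : forall j, 0 < a j.
Hypothesis c0 : forall j, 0 < c j.
Hypothesis p0 : forall j, 0 < p j.

(* At scale [u], a [T]-stage with index about [v u] has to be longer than
   [u * barrier v] in order to cause ruin. *)
Definition barrier (v : R) : R :=
  maxr ((a ord0 + c ord0 * v) / p ord0) ((a ord_max + c ord_max * v) / p ord_max).

Lemma barrier_ge j v : (a j + c j * v) / p j <= barrier v.
Proof. by case: (ord2_cases j) => ->; rewrite le_max lexx ?orbT. Qed.

Lemma barrier_lt (s u t : R) (k : nat) : 0 < s -> 0 < u ->
  (forall j, s * (a j * u + k%:R * c j) < p j * t) ->
  s * u * barrier (k%:R / u) < t.
Proof.
move=> s0 u0 H; rewrite mulrC -ltr_pdivlMr ?mulr_gt0// gt_max.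
have E j : (a j + c j * (k%:R / u)) / p j < t / (s * u).
  rewrite ltr_pdivlMr ?mulr_gt0// mulrAC ltr_pdivrMr// [t * _]mulrC.
  apply: le_lt_trans (H j); rewrite le_eqVlt; apply/orP; left; apply/eqP.
  by field; rewrite gt_eqF.
by rewrite !E.
Qed.

Lemma lt_barrier (s u t : R) (k : nat) j : 0 < s -> 0 < u ->
  s * u * barrier (k%:R / u) < t -> s * (a j * u + k%:R * c j) < p j * t.
Proof.
move=> s0 u0 H; rewrite mulrC -ltr_pdivrMl// in H *.
apply: le_lt_trans H; rewrite mulrC.
have -> : (p j)^-1 * (s * (a j * u + k%:R * c j)) = s * u * ((a j + c j * (k%:R / u)) / p j).
  by field; rewrite !gt_eqF.
by rewrite ler_pM2l ?mulr_gt0// barrier_ge.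
Qed.

End barrier.

(** One factor [1 +- theta] stands for the rounding of the number of blocks, the power [- lambda]
    for the perturbed threshold of the long stage; [rho] bounds their joint effect. *)
Lemma powR_perturbation (R : realType) (lambda rho : R) : 0 < lambda -> 1 < rho ->
  exists2 theta : R, 0 < theta < 1 &
    (1 + theta) * (1 - theta) `^ (- lambda) <= rho /\
    rho^-1 <= (1 - theta) * (1 + theta) `^ (- lambda).
Proof.
move=> l0 r1; have r0 : 0 < rho by apply: lt_trans r1.
have l10 : 0 < 1 + lambda by rewrite addr_gt0.
pose dl := ln rho / (1 + lambda).
have dl0 : 0 < dl by rewrite divr_gt0// ln_gt0.
have E : expR ((1 + lambda) * dl) = rho by rewrite /dl mulrCA divff ?gt_eqF// mulr1 lnK.
(* With [1 - theta = expR (- dl)] and [1 + theta <= expR dl], each product is compared with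
   [expR ((1 + lambda) * dl) = rho]. *)
exists (1 - expR (- dl)); first by rewrite subr_gt0 expR_lt1 oppr_lt0 dl0 gtrBl expR_gt0.
have h1 : 0 < expR (- dl) by exact: expR_gt0.
have h2 : 1 + (1 - expR (- dl)) <= expR dl.
  have := expR_ge1Dx dl; have := expR_ge1Dx (- dl); lra.
have h3 : 1 < 1 + (1 - expR (- dl)) by rewrite ltrDl subr_gt0 expR_lt1 oppr_lt0.
have h4 : 0 < 1 + (1 - expR (- dl)) by apply: lt_trans h3.
have powE (x : R) : expR x `^ (- lambda) = expR (- lambda * x).
  by rewrite /powR gt_eqF ?expR_gt0// expRK.
have E2 : rho = expR dl * expR (lambda * dl) by rewrite -expRD -E; congr expR; ring.
rewrite subKr powE mulNr mulrN opprK; split.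
  by rewrite [leRHS]E2; apply: ler_pM => //; exact: ltW.
rewrite E2 invfM -!expRN ler_pM2l// -mulNr -powE.
rewrite !powRN lef_pV2 ?posrE ?powR_gt0 ?expR_gt0//.
by apply: ge0_ler_powR; rewrite ?nnegrE ?(ltW l0) ?(ltW h4) ?expR_ge0.
Qed.

Section blocks.
Context (R : realType).
Variables (f b : nat -> R) (L m : nat).

Lemma sum_blocks_le :
  (forall r k, (r < L)%N -> (r * m <= k < r.+1 * m)%N -> f k <= b r) ->
  \sum_(k < L * m) f k <= m%:R * \sum_(r < L) b r.
Proof.
move=> fb; rewrite -(big_mkord xpredT f) big_nat_mul big_mkord mulr_sumr.
apply: ler_sum => r _; rewrite big_nat_cond.
apply: (@le_trans _ _ (\sum_(r * m <= k < r.+1 * m | (r * m <= k < r.+1 * m)%N && true) b r)).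
  by apply: ler_sum => k /andP[rk _]; apply: fb.
by rewrite -big_nat_cond sumr_const_nat mulSn addnK mulr_natl.
Qed.

Lemma sum_blocks_ge :
  (forall r k, (r < L)%N -> (r * m <= k < r.+1 * m)%N -> b r <= f k) ->
  m%:R * \sum_(r < L) b r <= \sum_(k < L * m) f k.
Proof.
move=> fb; rewrite -(big_mkord xpredT f) big_nat_mul big_mkord mulr_sumr.
apply: ler_sum => r _; rewrite big_nat_cond.
apply: (@le_trans _ _ (\sum_(r * m <= k < r.+1 * m | (r * m <= k < r.+1 * m)%N && true) b r)).
  by rewrite -big_nat_cond sumr_const_nat mulSn addnK mulr_natl.
by apply: ler_sum => k /andP[rk _]; apply: fb.
Qed.

End blocks.

(** * Riemann sums of a nonincreasing function *)

Section riemann_sums.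
Context (R : realType).
Variable G : R -> R.
Hypothesis mG : measurable_fun setT G.
Hypothesis G0 : forall v, 0 <= v -> 0 <= G v.
Hypothesis ndG : forall v v', 0 <= v -> v <= v' -> G v' <= G v.

Local Notation I := (\int[lebesgue_measure]_(v in `[0%R, +oo[) (G v)%:E)%E.

Definition lower_sum (h : R) (L : nat) : R := \sum_(r < L) h * G (r.+1%:R * h).

Definition upper_sum (h : R) (L : nat) : R := \sum_(r < L) h * G (r%:R * h).

(** Left endpoints become right endpoints after a shift by one block, so the gap between the sums is
    controlled by [h * G 0]. *)
Lemma upper_sumS h L : upper_sum h L.+1 = h * G 0 + lower_sum h L.
Proof. by rewrite /upper_sum big_ord_recl mul0r. Qed.

Variable h : R.
Hypothesis h0 : 0 < h.

Let block (r : nat) : set R := `[r%:R * h, r.+1%:R * h[.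

Let block_ge0 r v : block r v -> 0 <= v.
Proof. by rewrite /block /= in_itv/= => /andP[+ _]; apply: le_trans; rewrite mulr_ge0// ltW. Qed.

Let mGblock r : measurable_fun (block r) (fun v => (G v)%:E).
Proof. by apply/measurable_EFinP; exact: measurable_funTS. Qed.

Let block_measure r : lebesgue_measure (block r) = h%:E.
Proof.
rewrite /block lebesgue_measure_itv /= lte_fin ltr_pM2r// ltr_nat ltnSn -EFinB.
by rewrite -mulrBl -natrB// subSnn mul1r.
Qed.

Let cst_integral r (y : R) : (\int[lebesgue_measure]_(v in block r) y%:E = (h * y)%:E)%E.
Proof.
transitivity (y%:E * lebesgue_measure (block r))%E; first by apply: integral_cst; exact: measurable_itv.
by rewrite block_measure -EFinM mulrC.
Qed.

Let block_le r : (\int[lebesgue_measure]_(v in block r) (G v)%:E <= (h * G (r%:R * h))%:E)%E.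
Proof.
apply: (@le_trans _ _ (\int[lebesgue_measure]_(v in block r) (G (r%:R * h))%:E)%E).
  apply: ge0_le_integral => //.
  - exact: measurable_itv.
  - by move=> v bv; rewrite lee_fin G0// (block_ge0 bv).
  - exact: mGblock.
  - move=> v; rewrite /block /= in_itv/= => /andP[rv _].
    by rewrite lee_fin ndG// mulr_ge0// ltW.
by rewrite cst_integral.
Qed.

Let block_ge r : ((h * G (r.+1%:R * h))%:E <= \int[lebesgue_measure]_(v in block r) (G v)%:E)%E.
Proof.
apply: (@le_trans _ _ (\int[lebesgue_measure]_(v in block r) (G (r.+1%:R * h))%:E)%E).
  by rewrite cst_integral.
apply: ge0_le_integral => //.
- exact: measurable_itv.
- by move=> v bv; rewrite lee_fin G0// mulr_ge0// ltW.
- exact: mGblock.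
- move=> v bv; rewrite lee_fin ndG ?(block_ge0 bv)//.
  by move: bv; rewrite /block /= in_itv/= => /andP[_ /ltW].
Qed.

Let integral_blocks :
  I = (\sum_(0 <= r <oo) \int[lebesgue_measure]_(v in block r) (G v)%:E)%E.
Proof.
have U : `[0%R, +oo[%classic = \bigcup_r block r.
  apply/seteqP; split => v.
    rewrite /= in_itv/= andbT => v0; have := truncn_itv (divr_ge0 v0 (ltW h0)).
    rewrite ler_pdivlMr// ltr_pdivrMr// => vh.
    by exists (truncn (v / h)) => //; rewrite /block /= in_itv.
  by move=> [r _ /block_ge0 v0]; rewrite /= in_itv/= andbT.
rewrite U ge0_integral_bigcup//.
- by move=> r; exact: measurable_itv.
- by apply/measurable_EFinP; exact: measurable_funTS.
- by move=> v [r _ /block_ge0 v0]; rewrite lee_fin G0.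
- apply/trivIsetP => r s _ _ rs; apply/seteqP; split => // v [].
  rewrite /block /= !in_itv/= => /andP[r1 r2] /andP[s1 s2].
  have := le_lt_trans r1 s2; have := le_lt_trans s1 r2.
  rewrite !ltr_pM2r// !ltr_nat !ltnS => sr rs'.
  by move: rs; rewrite eqn_leq sr rs'.
Qed.

Let block_int_ge0 r : (0 <= \int[lebesgue_measure]_(v in block r) (G v)%:E)%E.
Proof. by apply: integral_ge0 => v bv; rewrite lee_fin G0// (block_ge0 bv). Qed.

Lemma lower_sum_le L : ((lower_sum h L)%:E <= I)%E.
Proof.
rewrite integral_blocks; apply: le_trans (nneseries_lim_ge L _) => //.
by rewrite big_mkord /lower_sum -sumEFin; apply: lee_sum => r _; exact: block_ge.
Qed.

Let partial_le L :
  (\sum_(0 <= r < L) \int[lebesgue_measure]_(v in block r) (G v)%:E <= (upper_sum h L)%:E)%E.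
Proof. by rewrite big_mkord /upper_sum -sumEFin; apply: lee_sum => r _; exact: block_le. Qed.

(** This yields the finiteness of the integral from a uniform bound, with no prior integrability. *)
Lemma integral_le_of_lower_sums (C : R) : (forall L, lower_sum h L <= C) ->
  (I <= (h * G 0 + C)%:E)%E.
Proof.
move=> HC; rewrite integral_blocks; apply: lime_le; first exact: is_cvg_nneseries.
apply: nearW => L; apply: le_trans (partial_le L) _; rewrite lee_fin.
apply: (@le_trans _ _ (upper_sum h L.+1)); last by rewrite upper_sumS lerD2l.
by rewrite [leRHS]/upper_sum big_ord_recr lerDl mulr_ge0 ?(ltW h0)// G0// mulr_ge0// ltW.
Qed.

(** Otherwise the preceding bound would give [i <= i - rho]. *)
Lemma lower_sum_near (i rho : R) : I = i%:E -> 0 < rho ->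
  exists L, i - h * G 0 - rho <= lower_sum h L.
Proof.
move=> Ii rho0; apply: contrapT => H.
have := @integral_le_of_lower_sums (i - h * G 0 - rho).
rewrite Ii lee_fin => /(_ _)/wrap[].
  by move=> L; rewrite leNgt; apply/negP => HL; apply: H; exists L; exact: ltW.
lra.
Qed.

End riemann_sums.

Section scaled_sums.
Context (R : realType).
Variables (F : R -> R) (lambda : R).
Hypothesis rF : regular_tail F lambda.

(** The number [L] of terms stays fixed as [u] grows, so regular variation applies term by term
    without uniformity; this is why the indices are grouped into blocks. *)
Lemma scaled_sum_cvg (L : nat) (b : nat -> R) (s : R) : 0 < s -> (forall r, 0 < b r) ->
  (\sum_(r < L) F (s * u * b r)) / F u @[u --> +oo] -->
    s `^ (- lambda) * \sum_(r < L) b r `^ (- lambda).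
Proof.
move=> s0 b0; elim: L => [|L IH].
  rewrite big_ord0 mulr0 (_ : (fun u => _) = cst 0); first exact: cvg_cst.
  by apply/funext => u; rewrite big_ord0 mul0r.
rewrite big_ord_recr /= mulrDr -(powRM _ (ltW s0) (ltW (b0 L))).
rewrite (_ : (fun u => _) = (fun u => (\sum_(r < L) F (s * u * b r)) / F u) \+
    (fun u => F (s * b L * u) / F u)).
  by apply: cvgD => //; apply: (rt_ratio rF); exact: mulr_gt0.
by apply/funext => u /=; rewrite big_ord_recr /= mulrDl [s * u * _]mulrAC.
Qed.

End scaled_sums.

(** * The regenerative process *)

Section fdd_copies.
Context (d : measure_display) (Omega : measurableType d) (R : realType)
  (P : probability Omega R).

Lemma copy_law (Xn : nat -> 'I_2 -> R -> {RV P >-> R})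
    (B : 'I_2 -> R -> {RV P >-> R}) (r : 'I_2 -> R) :
  independent_copies Xn (drifted B r) ->
  forall (i : nat) (j : 'I_2) (s t : R) (A : set (R * R)), 0 <= s -> 0 <= t ->
  measurable A ->
  P [set w | A (Xn i j s w - r j * s, Xn i j t w - r j * t)] =
  P [set w | A (B j s w, B j t w)].
Proof.
move=> [_ fdd _] i j s t A s0 t0 mA.
pose u (k : 'I_2) : 'I_2 * R := (j, if k == ord0 then s else t).
pose f (x : 2.-tuple R) := (tnth x ord0 - r j * s, tnth x ord_max - r j * t).
have mf : measurable_fun setT f.
  apply/measurable_fun_pair; apply: measurable_funB => //; exact: measurable_tnth.
have mA' : measurable (f @^-1` A) by rewrite -[X in measurable X]setTI; exact: mf.
have := fdd i 2 u (f @^-1` A) _ mA'.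
have u0 k : nonneg_time (u k) by rewrite /nonneg_time /=; case: ifP.
move=> /(_ u0); set U1 := (X in P X = _); set U2 := (X in _ = P X) => E.
have -> : [set w | A (Xn i j s w - r j * s, Xn i j t w - r j * t)] = U1.
  by apply/seteqP; split => w; rewrite /U1 /f /= !tnth_mktuple.
rewrite E; congr (P _).
by apply/seteqP; split => w; rewrite /U2 /f /= !tnth_mktuple /drifted /u /= !addrK.
Qed.

(** The generic variable [T] is nonnegative only in law, so its positive and negative parts are
    transferred separately to [V]. *)
Lemma ge0_law_expectation (T V : Omega -> R) :
  measurable_fun setT T -> measurable_fun setT V -> (forall w, 0 <= V w) ->
  (forall A : set R, measurable A -> P (V @^-1` A) = P (T @^-1` A)) ->
  ('E_P[T] = \int[P]_w (V w)%:E)%E.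
Proof.
move=> mT mV V0 VT; rewrite unlock integralE.
have mp : measurable_fun setT (fun x : R => maxr x 0) by exact: measurable_maxr.
have mn : measurable_fun setT (fun x : R => maxr (- x) 0).
  by apply: measurable_maxr => //; exact: measurable_oppr.
have pos (x : R) : 0 <= maxr x 0 by rewrite le_max lexx orbT.
have -> : (\int[P]_w (EFin \o T)^\+ w = \int[P]_w (V w)%:E)%E.
  transitivity (\int[P]_w (maxr (T w) 0)%:E)%E.
    by apply: eq_integral => w _; rewrite funeposE /= EFin_max.
  rewrite -(eq_law_integral mV mT mp)//.
  by apply: eq_integral => w _; rewrite max_l.
have -> : (\int[P]_w (EFin \o T)^\- w = 0)%E.
  transitivity (\int[P]_w (maxr (- T w) 0)%:E)%E.
    by apply: eq_integral => w _; rewrite funenegE /= EFin_max.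
  rewrite -(eq_law_integral mV mT mn)//.
  by apply: integral0_eq => w _; rewrite max_r// oppr_le0.
by rewrite sube0.
Qed.

End fdd_copies.

Lemma within_continuous_comp_expR (R : realType) (r : R) (f : R -> R) (A : set R) :
  {within A, continuous f} -> {within A, continuous (fun t => expR (r * f t))}.
Proof.
move=> cf; apply/subspace_continuousP => t At.
apply: (@cvg_comp _ _ _ (fun t => r * f t) expR); last exact: continuous_expR.
by apply: cvgMr; move/subspace_continuousP : cf; apply.
Qed.

Section model.
Context (d : measure_display) (Omega : measurableType d) (R : realType)
  (P : probability Omega R)
  (H Ht p q : 'I_2 -> R) (B Bt : 'I_2 -> R -> {RV P >-> R})
  (T S : {RV P >-> R}) (Tn Sn : nat -> {RV P >-> R})
  (Xn Yn : nat -> 'I_2 -> R -> {RV P >-> R}) (Z : 'I_2 -> R -> Omega -> R).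
Hypothesis model : regenerative_model H Ht p q B Bt T S Tn Sn Xn Yn Z.

Let Tn_ge0 i w : 0 <= Tn i w. Proof. exact: ltW (model_T_gt0 model i w). Qed.
Let Sn_ge0 i w : 0 <= Sn i w. Proof. exact: ltW (model_S_gt0 model i w). Qed.

Lemma law_T i (A : set R) : measurable A -> P (Tn i @^-1` A) = P (T @^-1` A).
Proof.
move=> mA; apply: (model_TS_law model i (A := fst @^-1` A)).
by rewrite -[X in measurable X]setTI; exact: measurable_fst.
Qed.

Lemma law_S i (A : set R) : measurable A -> P (Sn i @^-1` A) = P (S @^-1` A).
Proof.
move=> mA; apply: (model_TS_law model i (A := snd @^-1` A)).
by rewrite -[X in measurable X]setTI; exact: measurable_snd.
Qed.

Let law_T0 i (A : set R) : measurable A -> P (Tn i @^-1` A) = P (Tn 0 @^-1` A).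
Proof. by move=> mA; rewrite !law_T. Qed.

Let law_S0 i (A : set R) : measurable A -> P (Sn i @^-1` A) = P (Sn 0 @^-1` A).
Proof. by move=> mA; rewrite !law_S. Qed.

Lemma tail_T i (x : R) : pr P [set w | x < Tn i w] = tail P T x.
Proof.
have -> : [set w | x < Tn i w] = Tn i @^-1` `]x, +oo[.
  by apply/seteqP; split => w /=; rewrite in_itv/= andbT.
rewrite /pr law_T// /tail /pr; congr (fine (P _)).
by apply/seteqP; split => w /=; rewrite in_itv/= andbT.
Qed.

Lemma tail_S i (x : R) : pr P [set w | x < Sn i w] = tail P S x.
Proof.
have -> : [set w | x < Sn i w] = Sn i @^-1` `]x, +oo[.
  by apply/seteqP; split => w /=; rewrite in_itv/= andbT.
rewrite /pr law_S// /tail /pr; congr (fine (P _)).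
by apply/seteqP; split => w /=; rewrite in_itv/= andbT.
Qed.

Definition noiseX (j : 'I_2) (i : nat) (t : R) (w : Omega) : R :=
  Xn i j t w - p j * t.
Definition noiseY (j : 'I_2) (i : nat) (t : R) (w : Omega) : R :=
  Yn i j t w + q j * t.

Lemma noiseX_law (j : 'I_2) (i : nat) (s t : R) (A : set (R * R)) :
  0 <= s -> 0 <= t -> measurable A ->
  P [set w | A (noiseX j i s w, noiseX j i t w)] = P [set w | A (B j s w, B j t w)].
Proof. exact: (copy_law (model_X model)). Qed.

Lemma noiseY_law (j : 'I_2) (i : nat) (s t : R) (A : set (R * R)) :
  0 <= s -> 0 <= t -> measurable A ->
  P [set w | A (noiseY j i s w, noiseY j i t w)] = P [set w | A (Bt j s w, Bt j t w)].
Proof.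
move=> s0 t0 mA; rewrite -(copy_law (model_Y model) i j s0 t0 mA).
by congr (P _); apply/seteqP; split => w /=; rewrite /noiseY !mulNr !opprK.
Qed.

Lemma measurable_noiseX j i t : measurable_fun setT (noiseX j i t).
Proof. exact: measurable_funB. Qed.

Lemma measurable_noiseY j i t : measurable_fun setT (noiseY j i t).
Proof. exact: measurable_funD. Qed.

Let within_linear (r : R) (A : set R) (f : R -> R) :
  {within A, continuous f} -> {within A, continuous (fun t => f t + r * t)}.
Proof.
move=> cf; apply/subspace_continuousP => t At; apply: cvgD.
  by move/subspace_continuousP : cf; apply.
apply: cvg_within_filter; apply: cvgMr; exact: cvg_id.
Qed.

Lemma continuous_noiseX j i w :
  {within `[0, +oo[, continuous (fun t => noiseX j i t w)}.
Proof.
have [_ _ cX] := model_X model.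
have -> : noiseX j i ^~ w = (fun t => Xn i j t w + - p j * t).
  by apply/funext => t; rewrite /noiseX mulNr.
by apply: within_linear; exact: cX.
Qed.

Lemma continuous_noiseY j i w :
  {within `[0, +oo[, continuous (fun t => noiseY j i t w)}.
Proof.
have [_ _ cY] := model_Y model.
by apply: within_linear; exact: cY.
Qed.

Definition increment (j : 'I_2) (i : nat) (w : Omega) : R :=
  Xn i j (Tn i w) w + Yn i j (Sn i w) w.

Lemma measurable_increment j i : measurable_fun setT (increment j i).
Proof.
have [_ _ cX] := model_X model; have [_ _ cY] := model_Y model.
apply: measurable_funD.
  by apply: (measurable_random_time (f := fun t => Xn i j t) (U := Tn i)).
by apply: (measurable_random_time (f := fun t => Yn i j t) (U := Sn i)).
Qed.

Variables (lambda : R).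
Hypothesis lambda_gt1 : 1 < lambda.
Hypothesis T_rv : regularly_varying T lambda.
Hypothesis S_tail : tail P S x / tail P T x @[x --> +oo] --> (0 : R).
Hypothesis drift : forall j : 'I_2,
  ((p j)%:E * 'E_P[T] < (q j)%:E * 'E_P[S])%E /\ ((q j)%:E * 'E_P[S] < +oo)%E.

Local Notation F := (tail P T).

Lemma regular_tail_T : regular_tail F lambda.
Proof. exact: regularly_varying_regular_tail. Qed.

Lemma expectation_T : (\int[P]_w (Tn 0 w)%:E = (fine 'E_P[T])%:E)%E.
Proof.
have E : ('E_P[T] = \int[P]_w (Tn 0 w)%:E)%E.
  by apply: ge0_law_expectation => //; exact: law_T.
rewrite -E fineK// E ge0_fin_numE; last by apply: integral_ge0 => w _; rewrite lee_fin.
rewrite -E ltey; apply/eqP => Eoo.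
have [] := drift ord0; rewrite Eoo gt0_muley ?lte_fin ?(model_p_gt0 model)//.
by rewrite ltNge leey.
Qed.

Lemma expectation_S : (\int[P]_w (Sn 0 w)%:E = (fine 'E_P[S])%:E)%E.
Proof.
have E : ('E_P[S] = \int[P]_w (Sn 0 w)%:E)%E.
  by apply: ge0_law_expectation => //; exact: law_S.
rewrite -E fineK// E ge0_fin_numE; last by apply: integral_ge0 => w _; rewrite lee_fin.
rewrite -E ltey; apply/eqP => Eoo.
have [_] := drift ord0; rewrite Eoo gt0_muley ?lte_fin ?(model_q_gt0 model)//.
Qed.

Definition net_drift (j : 'I_2) : R := q j * fine 'E_P[S]%E - p j * fine 'E_P[T]%E.

Lemma net_drift_gt0 j : 0 < net_drift j.
Proof.
have ET : ('E_P[T] = (fine 'E_P[T])%:E)%E.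
  rewrite -expectation_T; apply: ge0_law_expectation => //; exact: law_T.
have ES : ('E_P[S] = (fine 'E_P[S])%:E)%E.
  rewrite -expectation_S; apply: ge0_law_expectation => //; exact: law_S.
by have [+ _] := drift j; rewrite ET ES -!EFinM lte_fin /net_drift /= subr_gt0.
Qed.

Lemma tail_S_small (e : R) : 0 < e -> \forall x \near +oo, tail P S x <= e * F x.
Proof.
move=> e0; have := S_tail => /cvgr_le /(_ _ e0).
by apply: filterS => x; rewrite ler_pdivrMr ?(rt_gt0 regular_tail_T).
Qed.

(** The order [1 + eta] stays below [mu], midway between 1 and [lambda]. The tail of [S] is below
    that of [T] only from [x0] on; the term [x0 ^ mu] covers the smaller arguments. *)
Lemma moments_finite : exists2 eta : R, 0 < eta <= 1 & exists2 M : R, 0 <= M &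
  (\int[P]_w ((1 + Tn 0 w) `^ (1 + eta))%:E <= M%:E)%E /\
  (\int[P]_w ((1 + Sn 0 w) `^ (1 + eta))%:E <= M%:E)%E.
Proof.
have l1 := lambda_gt1.
pose eta := minr 1 ((lambda - 1) / 4); pose mu := (1 + lambda) / 2.
have eta1 : eta <= 1 by rewrite ge_min lexx.
have eta2 : eta <= (lambda - 1) / 4 by rewrite ge_min lexx orbT.
have eta0 : 0 < eta by rewrite lt_min ltr01 divr_gt0// subr_gt0.
have mu0 : 0 < mu by rewrite /mu; lra.
have mul : mu < lambda by rewrite /mu; lra.
have emu : 1 + eta < mu by rewrite /mu; lra.
have e10 : 0 < 1 + eta by lra.
have [C C0 HC] := rt_upper regular_tail_T mu0 mul.
have [x0 x01 Hx0] := near_pinfty_ex (tail_S_small ltr01).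
have C20 : 0 <= C + x0 `^ mu by rewrite addr_ge0 ?powR_ge0.
have [M1 M10 HM1] : exists2 M : R, 0 <= M & (\int[P]_w ((1 + Tn 0 w) `^ (1 + eta))%:E <= M%:E)%E.
  by apply: (moment_finite _ _ e10 emu C0) => // x x1; rewrite tail_T; exact: HC.
have [M2 M20 HM2] : exists2 M : R, 0 <= M & (\int[P]_w ((1 + Sn 0 w) `^ (1 + eta))%:E <= M%:E)%E.
  apply: (moment_finite _ _ e10 emu C20) => // x x1; rewrite tail_S mulrDl.
  have xp : 0 < x by apply: lt_le_trans x1.
  have x0p : 0 < x0 by apply: lt_le_trans x01.
  have [xx0|x0x] := lerP x0 x.
    apply: le_trans (Hx0 _ xx0) _; rewrite mul1r.
    by apply: le_trans (HC _ x1) _; rewrite lerDl mulr_ge0 ?powR_ge0.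
  apply: (@le_trans _ _ 1); first by apply: pr_le1; exact: measurable_gt.
  rewrite -[leLHS]add0r; apply: lerD; first by rewrite mulr_ge0 ?powR_ge0.
  rewrite powRN ler_pdivlMr ?powR_gt0// mul1r.
  by apply: ge0_ler_powR; rewrite ?nnegrE ltW.
exists eta; first by rewrite eta0.
exists (maxr M1 M2); first by rewrite le_max M10.
by split; [apply: le_trans HM1 _|apply: le_trans HM2 _]; rewrite lee_fin le_max lexx ?orbT.
Qed.

Let measurable_le_nat (r : R) : measurable_fun setT (fun v : R => (v <= r)%R%:R : R).
Proof.
rewrite (_ : (fun v => _) = \1_[set v : R | v <= r]).
  apply: measurable_indic; rewrite -[X in measurable X]setTI.
  exact: measurable_fun_ler.
apply/funext => v; rewrite indicE; congr (_%:R).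
by case: (boolP (v <= r)) => [e|/negP e]; [rewrite mem_set|rewrite memNset].
Qed.

Let prod_le_exp (s : seq nat) (I1 I2 : nat -> \bar R) (a b : R) :
  (forall i, 0 <= I1 i)%E -> (forall i, 0 <= I2 i)%E ->
  (forall i, I1 i <= (expR a)%:E)%E -> (forall i, I2 i <= (expR b)%:E)%E ->
  (\prod_(i <- s) (I1 i * I2 i) <= (expR ((size s)%:R * (a + b)))%:E)%E.
Proof.
move=> p1 p2 h1 h2; elim: s => [|i s IH].
  by rewrite big_nil mul0r expR0.
rewrite big_cons /= -natr1 mulrDl mul1r addrC expRD EFinM.
apply: lee_pmul => //.
- exact: mule_ge0.
- by apply: prode_ge0 => k _; exact: mule_ge0.
- by rewrite expRD EFinM; apply: lee_pmul.
Qed.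

(** The sign [sg] treats both directions at once. The estimate is uniform over the index sets [s],
    as it will be applied with the random long block left out. *)
Lemma chernoff_increments (j : 'I_2) (sg eps K : R) (m : nat) :
  sg = 1 \/ sg = -1 -> 0 < eps -> 0 < K -> (0 < m)%N ->
  exists2 d0 : R, 0 < d0 <= 1 & forall dl : R, 0 < dl <= d0 ->
  \forall x \near +oo, forall s : seq nat, uniq s -> (size s)%:R <= K * x ->
  pr P [set w | eps * x < \sum_(i <- s) sg * (increment j i w + net_drift j) /\
     forall i, i \in s -> Tn i w <= dl * x /\ Sn i w <= dl * x] <= (x ^+ m)^-1.
Proof.
move=> sg1 eps0 K0 m0.
have sg2 : sg ^+ 2 = 1 by case: sg1 => ->; rewrite ?sqrrN expr1n.
(* The deviation [eps * x] yields [x ^ (- 2 * m)]; the errors [e'] of the two stages, over at most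
   [K * x] blocks, give back at most [x ^ m]. *)
pose kappa := 2 * m%:R / eps; pose e' := eps / (4 * K).
have kappa0 : 0 < kappa by rewrite divr_gt0// mulr_gt0// ltr0n.
have e'0 : 0 < e' by rewrite divr_gt0// mulr_gt0.
have [eta eta01 [M M0 [MT MS]]] := moments_finite.
have HT := @truncated_exp_moment _ _ _ P (Tn 0) (H j) eta M _ _ _ (model_hurst model j)
  eta01 MT expectation_T (sg * p j) e' kappa e'0 kappa0.
have HS := @truncated_exp_moment _ _ _ P (Sn 0) (Ht j) eta M _ _ _ (model_hurst' model j)
  eta01 MS expectation_S (- sg * q j) e' kappa e'0 kappa0.
have {HT} [||dT /andP[dT0 dT1] HT] := HT => //.
have {HS} [||dS /andP[dS0 dS1] HS] := HS => //.
exists (minr dT dS); first by rewrite lt_min dT0 dS0 ge_min dT1.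
move=> dl /andP[dl0]; rewrite le_min => /andP[dlT dlS].
have {}HT := HT dl (introT andP (conj dl0 dlT)).
have {}HS := HS dl (introT andP (conj dl0 dlS)).
near=> x => s us sK.
have x1 : 1 < x by near: x; apply: nbhs_pinfty_gt; exact: num_real.
have xp : 0 < x by apply: lt_trans x1.
have hT : (\int[P]_w (expR (chernoff_rate kappa x * (sg * p j) * Tn 0 w) *
       (Tn 0 w <= dl * x)%R%:R *
       expR (4 * (chernoff_rate kappa x) ^+ 2 * Tn 0 w `^ (2 * H j)))%:E <=
    (1 + chernoff_rate kappa x * (sg * p j * fine 'E_P[T]%E + e'))%:E)%E by near: x.
have hS : (\int[P]_w (expR (chernoff_rate kappa x * (- sg * q j) * Sn 0 w) *
       (Sn 0 w <= dl * x)%R%:R *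
       expR (4 * (chernoff_rate kappa x) ^+ 2 * Sn 0 w `^ (2 * Ht j)))%:E <=
    (1 + chernoff_rate kappa x * (- sg * q j * fine 'E_P[S]%E + e'))%:E)%E by near: x.
set h := chernoff_rate kappa x in hT hS.
have h0 : 0 < h by rewrite /h /chernoff_rate divr_gt0// mulr_gt0// ln_gt0.
pose phi (v : R) := expR (h * (sg * p j) * v) * (v <= dl * x)%R%:R.
pose psi (v : R) := expR (h * (- sg * q j) * v) * (v <= dl * x)%R%:R.
pose gx (v : R) := expR (4 * h ^+ 2 * v `^ (2 * H j)).
pose gy (v : R) := expR (4 * h ^+ 2 * v `^ (2 * Ht j)).
pose X i t w := expR (h * sg * noiseX j i t w).
pose Y i t w := expR (h * sg * noiseY j i t w).
have mlin (r : R) : measurable_fun setT (fun v : R => expR (r * v)).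
  by apply: measurableT_comp => //; exact: measurable_funM.
have mphi : measurable_fun setT phi by exact: measurable_funM.
have mpsi : measurable_fun setT psi by exact: measurable_funM.
have mg (r a : R) : measurable_fun setT (fun v : R => expR (r * v `^ a)).
  by apply: measurableT_comp => //; exact: measurable_funM.
have ndg (a : R) : 0 < a -> forall s t : R, 0 <= s -> s <= t ->
    expR (4 * h ^+ 2 * s `^ (2 * a)) <= expR (4 * h ^+ 2 * t `^ (2 * a)).
  move=> a0 u v u0 uv; rewrite ler_expR; apply: ler_wpM2l.
    by rewrite mulr_ge0// sqr_ge0.
  by apply: ge0_ler_powR; rewrite ?nnegrE ?mulr_ge0 ?(ltW a0)// (le_trans u0).
have sqh : (h * sg) ^+ 2 = h ^+ 2 by rewrite exprMn sg2 mulr1.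
have Gindep : mutually_independent P (atoms Tn Sn Xn Yn).
  have [Xi _ _] := model_X model; have [Yi _ _] := model_Y model.
  exact: atoms_indep (model_TS_indep model) Xi Yi (model_indep model).
pose o0 := @Ordinal 4 0 isT; pose o1 := @Ordinal 4 1 isT.
pose o2 := @Ordinal 4 2 isT; pose o3 := @Ordinal 4 3 isT.
have mT i : measurable_fun setT (Tn i : g_sigma_algebraType (atoms Tn Sn Xn Yn (i, o0)) -> R).
  exact: measurable_atomT.
have mS i : measurable_fun setT (Sn i : g_sigma_algebraType (atoms Tn Sn Xn Yn (i, o1)) -> R).
  exact: measurable_atomS.
have mX i t : 0 <= t ->
    measurable_fun setT (X i t : g_sigma_algebraType (atoms Tn Sn Xn Yn (i, o2)) -> R).
  move=> t0; apply: (measurableT_comp (mlin (h * sg))).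
  by apply: measurable_funB => //; exact: measurable_atomX.
have mY i t : 0 <= t ->
    measurable_fun setT (Y i t : g_sigma_algebraType (atoms Tn Sn Xn Yn (i, o3)) -> R).
  move=> t0; apply: (measurableT_comp (mlin (h * sg))).
  by apply: measurable_funD => //; exact: measurable_atomY.
have X0 i t w : 0 <= t -> 0 <= X i t w by move=> _; exact: expR_ge0.
have Y0 i t w : 0 <= t -> 0 <= Y i t w by move=> _; exact: expR_ge0.
have cX i w : {within `[0, +oo[, continuous (X i ^~ w)}.
  by apply: within_continuous_comp_expR; exact: continuous_noiseX.
have cY i w : {within `[0, +oo[, continuous (Y i ^~ w)}.
  by apply: within_continuous_comp_expR; exact: continuous_noiseY.
have phi0 v : 0 <= phi v by rewrite mulr_ge0 ?expR_ge0.
have psi0 v : 0 <= psi v by rewrite mulr_ge0 ?expR_ge0.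
have gx0 v : 0 <= gx v by exact: expR_ge0.
have gy0 v : 0 <= gy v by exact: expR_ge0.
have ndgx : forall s t : R, 0 <= s -> s <= t -> gx s <= gx t.
  by apply: ndg; case/andP: (model_hurst model j).
have ndgy : forall s t : R, 0 <= s -> s <= t -> gy s <= gy t.
  by apply: ndg; case/andP: (model_hurst' model j).
have Xgx i t : 0 <= t -> (\int[P]_w (X i t w)%:E <= (gx t)%:E)%E.
  move=> t0; rewrite /gx -sqh.
  apply: (fbm_copy_mgf (model_hurst model j) (model_fbm model j)) => //.
    by move=> ? _; exact: measurable_noiseX.
  by move=> *; exact: noiseX_law.
have Ygy i t : 0 <= t -> (\int[P]_w (Y i t w)%:E <= (gy t)%:E)%E.
  move=> t0; rewrite /gy -sqh.
  apply: (fbm_copy_mgf (model_hurst' model j) (model_fbm' model j)) => //.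
    by move=> ? _; exact: measurable_noiseY.
  by move=> *; exact: noiseY_law.
have key := @stage_product_le _ _ _ P (atoms Tn Sn Xn Yn)
  (@atoms_sigma_algebra _ _ _ P Tn Sn Xn Yn) (@atoms_measurable _ _ _ P Tn Sn Xn Yn)
  Gindep o0 o1 o2 o3 isT Tn Sn X Y mT mS mX mY Tn_ge0 Sn_ge0 X0 Y0 cX cY
  phi psi gx gy mphi mpsi (mg _ _) (mg _ _) phi0 psi0 gx0 gy0 ndgx ndgy Xgx Ygy s us.
pose E := [set w | eps * x < \sum_(i <- s) sg * (increment j i w + net_drift j) /\
     forall i, i \in s -> Tn i w <= dl * x /\ Sn i w <= dl * x].
have mE : measurable E.
  rewrite (_ : E = [set w | eps * x < \sum_(i <- s) sg * (increment j i w + net_drift j)]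
     `&` \bigcap_(i in [set` s]) ([set w | Tn i w <= dl * x] `&` [set w | Sn i w <= dl * x])).
    apply: measurableI.
      apply: measurable_gt; apply: measurable_sum => i.
      by apply: measurable_funM => //; apply: measurable_funD => //; exact: measurable_increment.
    apply: fin_bigcap_measurable => // i _.
    by apply: measurableI; rewrite -[X in measurable X]setTI; exact: measurable_fun_ler.
  by apply/seteqP; split => w [h1 h2]; split.
pose a1 := h * (sg * p j * fine 'E_P[T]%E + e').
pose b1 := h * (- sg * q j * fine 'E_P[S]%E + e').
have {}key : (\int[P]_w (\prod_(i <- s) stage_factor Tn Sn X Y phi psi i w)%:E <=
    (expR ((size s)%:R * (a1 + b1)))%:E)%E.
  apply: le_trans key _.
  apply: prod_le_exp => i.
  - by apply: integral_ge0 => w _; rewrite lee_fin !mulr_ge0 ?expR_ge0.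
  - by apply: integral_ge0 => w _; rewrite lee_fin !mulr_ge0 ?expR_ge0.
  - rewrite (eq_law_integral (f := fun v => phi v * gx v) (Y := Tn 0))//.
    + by apply: le_trans hT _; rewrite lee_fin expR_ge1Dx.
    + by apply: measurable_funM => //; exact: mg.
    + by move=> v; rewrite mulr_ge0.
    + by move=> A mA; exact: law_T0.
  - rewrite (eq_law_integral (f := fun v => psi v * gy v) (Y := Sn 0))//.
    + by apply: le_trans hS _; rewrite lee_fin expR_ge1Dx.
    + by apply: measurable_funM => //; exact: mg.
    + by move=> v; rewrite mulr_ge0.
    + by move=> A mA; exact: law_S0.
(* The deterministic part of the exponential Markov inequality. The drift term cancels against the
   first-order terms of [a1 + b1], which leaves only the errors [e']. *)
pose G := expR (- (h * (eps * x)) + h * sg * (size s)%:R * net_drift j).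
have mprod : measurable_fun setT (fun w => \prod_(i <- s) stage_factor Tn Sn X Y phi psi i w).
  apply: measurable_prod => i _.
  apply: measurable_funM; apply: measurable_funM; try exact: measurableT_comp.
    apply: (measurable_random_time (f := X i)) => // t _.
    by apply: (measurableT_comp (mlin (h * sg))); exact: measurable_noiseX.
  apply: (measurable_random_time (f := Y i)) => // t _.
  by apply: (measurableT_comp (mlin (h * sg))); exact: measurable_noiseY.
have prod0 w : 0 <= \prod_(i <- s) stage_factor Tn Sn X Y phi psi i w.
  by apply: prodr_ge0 => i _; rewrite !mulr_ge0 ?expR_ge0.
have EG w : \1_E w <= G * \prod_(i <- s) stage_factor Tn Sn X Y phi psi i w.
  rewrite indicE; have [/set_mem [Ew1 Ew2]|_] := boolP (w \in E); last first.
    by rewrite mulr_ge0 ?expR_ge0.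
  rewrite (_ : \prod_(i <- s) _ = expR (h * sg * \sum_(i <- s) increment j i w)); last first.
    rewrite mulr_sumr expR_sum; apply: eq_big_seq => i /Ew2[Ti Si].
    rewrite /stage_factor /phi /psi Ti Si !mulr1 -!expRD; congr expR.
    by rewrite /noiseX /noiseY /increment; ring.
  rewrite /G -expRD (_ : true%:R = expR (0 : R)); last by rewrite expR0.
  rewrite ler_expR.
  move: Ew1; under eq_bigr do rewrite mulrDr.
  rewrite big_split /= -mulr_sumr big_const_seq count_predT iter_addr_0.
  rewrite -(ltr_pM2l h0) => Ew1.
  by move: Ew1; rewrite -mulr_natl; lra.
rewrite -lee_fin -pr_fin// (prob_integral P mE).
apply: (@le_trans _ _ (\int[P]_w (G%:E * (\prod_(i <- s) stage_factor Tn Sn X Y phi psi i w)%:E))%E).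
  apply: ge0_le_integral => //.
  - by apply/measurable_EFinP; exact: measurable_indic.
  - by apply: measurable_funeM; exact/measurable_EFinP.
  - by move=> w _; rewrite -EFinM lee_fin.
rewrite ge0_integralZl//; last 3 first.
- exact/measurable_EFinP.
- by move=> w _; rewrite lee_fin.
- by rewrite lee_fin expR_ge0.
apply: (@le_trans _ _ (G%:E * (expR ((size s)%:R * (a1 + b1)))%:E)%E).
  by apply: lee_wpmul2l => //; rewrite lee_fin expR_ge0.
rewrite -EFinM lee_fin /G -expRD.
have -> : (x ^+ m)^-1 = expR (- (m%:R * ln x)).
  by rewrite expRN mulrC expRM_natr lnK.
rewrite ler_expR.
have hx : h * x = kappa * ln x by rewrite /h /chernoff_rate; field; rewrite gt_eqF.
have hx2 : h * (eps * x) = 2 * m%:R * ln x.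
  by rewrite mulrCA hx /kappa; field; rewrite gt_eqF.
have : h * e' * (size s)%:R <= h * e' * (K * x) by rewrite ler_wpM2l// mulr_ge0 ?ltW.
have -> : h * e' * (K * x) = (h * (eps * x)) / 4 by rewrite /e'; field; rewrite gt_eqF.
rewrite hx2 /a1 /b1 /net_drift; set z := m%:R * ln x.
have -> : 2 * m%:R * ln x = 2 * z by rewrite /z; ring.
lra.
Unshelve. all: by end_near. Qed.

(** * The good event *)

Local Notation inc := increment.
Local Notation c := net_drift.
Local Notation nX := noiseX.
Local Notation nY := noiseY.

(* The excluded index [k] is the one of the single long [T]-stage; [k = M]
   excludes nothing. *)
Record good (j : 'I_2) (eps dl x : R) (M : nat) (w : Omega) : Prop := Good {
  good_X : forall i t, (i < M)%N -> 0 <= t -> `|nX j i t w| <= eps * t + dl * x ;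
  good_Y : forall i t, (i < M)%N -> 0 <= t -> `|nY j i t w| <= eps * t + dl * x ;
  good_S : forall i, (i < M)%N -> Sn i w <= dl * x ;
  good_T : forall k l, (k < M)%N -> (l < M)%N -> k != l -> dl * x < Tn k w ->
    Tn l w <= dl * x ;
  good_sum : forall n k, (n <= M)%N -> (k <= M)%N ->
    (forall i, (i < n)%N -> i != k -> Tn i w <= dl * x) ->
    `|\sum_(i < n | i != k :> nat) (inc j i w + c j)| <= eps * x
}.

Lemma pr_two_long (k l : nat) (y : R) : k != l ->
  pr P ([set w | y < Tn k w] `&` [set w | y < Tn l w]) = F y ^+ 2.
Proof.
move=> kl; have := model_TS_indep model.
move=> /(_ [fset k; l]%fset (fun i => [set w | y < Tn i w])).
rewrite big_fsetU1 ?inE//= big_seq_fset1 !(tail_T) -expr2 => <-.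
  congr (pr P _); apply/seteqP; split => w.
    by move=> [h1 h2] i /=; rewrite !inE => /orP[] /eqP ->.
  by move=> h; split; apply: h => /=; rewrite !inE eqxx ?orbT.
move=> i _.
apply: sub_sigma_algebra; exists true => //; exists `]y, +oo[%classic => //.
by rewrite setTI; apply/seteqP; split => w /=; rewrite in_itv/= andbT.
Qed.

Lemma good_event_likely_proj (j : 'I_2) (eps K : R) : 0 < eps -> 0 < K ->
  exists2 d0 : R, 0 < d0 <= 1 & forall dl : R, 0 < dl <= d0 ->
  forall e : R, 0 < e ->
  \forall x \near +oo, forall M : nat, M%:R <= K * x ->
  exists D : set Omega, [/\ measurable D, pr P D <= e * (x * F x) &
    forall w, ~ D w -> good j eps dl x M w].
Proof.
move=> eps0 K0; have rF := regular_tail_T.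
have l0 : 0 <= lambda by apply: le_trans (ltW lambda_gt1).
(* From the order [m], the union over blocks costs one power of [x] and that over pairs [(n, k)]
   two; at least [m0 + 1] powers remain, enough since [lambda < m0]. *)
pose m0 := (truncn lambda).+1; pose m := m0.+3.
have lm0 : lambda < m0%:R by have /andP[_] := truncn_itv l0.
have [C1 C10 HC1] := fbm_copy_drift_tail (model_hurst model j) (model_fbm model j)
  eps0 (isT : (0 < m)%N).
have [C2 C20 HC2] := fbm_copy_drift_tail (model_hurst' model j) (model_fbm' model j)
  eps0 (isT : (0 < m)%N).
have [dp /andP[dp0 dp1] Hp] := chernoff_increments j
  (or_introl erefl : (1 : R) = 1 \/ (1 : R) = -1) eps0 K0 (isT : (0 < m)%N).
have [dm /andP[dm0 dm1] Hm] := chernoff_increments j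
  (or_intror erefl : (-1 : R) = 1 \/ (-1 : R) = -1) eps0 K0 (isT : (0 < m)%N).
exists (minr dp dm); first by rewrite lt_min dp0 dm0 ge_min dp1.
move=> dl /andP[dl0]; rewrite le_min => /andP[dlp dlm] e e0.
have {}Hp := Hp dl (introT andP (conj dl0 dlp)).
have {}Hm := Hm dl (introT andP (conj dl0 dlm)).
(* The summands bound, in order, large noises, long [S]-stages, two long [T]-stages, and deviating
   sums. *)
pose bound (x : R) := K * (C1 + C2) / dl ^+ m / x ^+ m0.+2 +
  (K * (x * tail P S (dl * x)) + (K ^+ 2 * (x * F (dl * x)) ^+ 2 +
  2 * (K + 1) ^+ 2 / x ^+ m0.+1)).
have nbound : negligible F bound.
  apply: negligibleD.
    apply: (negligible_inv_pow rF _ lm0) => //.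
    by rewrite divr_ge0 ?exprn_ge0 ?mulr_ge0 ?addr_ge0// ltW.
  apply: negligibleD.
    apply: (negligibleZ rF (ltW K0)) => e' e'0.
    have [C C0 HC] := rt_ratio_bounded rF dl0.
    have HS := near_pinfty_scale dl0 (tail_S_small (divr_gt0 e'0 C0)).
    near=> x.
    have x0 : 0 <= x by near: x; apply: nbhs_pinfty_ge; exact: num_real.
    rewrite mulrCA; apply: ler_wpM2l => //.
    apply: (@le_trans _ _ (e' / C * F (dl * x))); first by near: x.
    rewrite -mulrA; apply: ler_wpM2l; first exact: ltW.
    by rewrite ler_pdivrMl//; near: x.
  apply: negligibleD.
    exact: (negligible_sq rF lambda_gt1 dl0 (sqr_ge0 K)).
  apply: (negligible_inv_pow rF _ lm0) => //.
  by rewrite mulr_ge0// sqr_ge0.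
near=> x => M MK.
have x1 : 1 <= x by near: x; apply: nbhs_pinfty_ge; exact: num_real.
have dx1 : 1 <= dl * x.
  by rewrite -ler_pdivrMl// mulr1; near: x; apply: nbhs_pinfty_ge; exact: num_real.
have x0 : 0 < x by apply: lt_le_trans x1.
have hp : forall s : seq nat, uniq s -> (size s)%:R <= K * x ->
  pr P [set w | eps * x < \sum_(i <- s) 1 * (inc j i w + c j) /\
     forall i, i \in s -> Tn i w <= dl * x /\ Sn i w <= dl * x] <= (x ^+ m)^-1 by near: x.
have hm : forall s : seq nat, uniq s -> (size s)%:R <= K * x ->
  pr P [set w | eps * x < \sum_(i <- s) -1 * (inc j i w + c j) /\
     forall i, i \in s -> Tn i w <= dl * x /\ Sn i w <= dl * x] <= (x ^+ m)^-1 by near: x.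
pose NX i := [set w | exists t : R, 0 <= t /\ eps * t + dl * x < `|nX j i t w|].
pose NY i := [set w | exists t : R, 0 <= t /\ eps * t + dl * x < `|nY j i t w|].
have mNX i : measurable (NX i).
  apply: (@drift_exceeds_measurable _ _ _ (nX j i)) => [t _|w].
    exact: measurable_noiseX.
  exact: (continuous_noiseX).
have mNY i : measurable (NY i).
  apply: (@drift_exceeds_measurable _ _ _ (nY j i)) => [t _|w].
    exact: measurable_noiseY.
  exact: (continuous_noiseY).
have mS i : measurable [set w | dl * x < Sn i w] by exact: measurable_gt.
have mT i : measurable [set w | dl * x < Tn i w] by exact: measurable_gt.
pose A1 i := NX i `|` (NY i `|` [set w | dl * x < Sn i w]).
pose A2 k l := if k == l then set0 else
  [set w | dl * x < Tn k w] `&` [set w | dl * x < Tn l w].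
(* For [k = M] nothing is removed, since [n <= M]; this is why [n] and [k] range up to [M] included
   in the union of the [A3 n k]. *)
pose s n k := [seq i <- iota 0 n | i != k].
pose E sg n k := [set w | eps * x < \sum_(i <- s n k) sg * (inc j i w + c j) /\
     forall i, i \in s n k -> Tn i w <= dl * x /\ Sn i w <= dl * x].
pose A3 n k := if (n <= M)%N then E 1 n k `|` E (-1) n k else set0.
have mA1 i : measurable (A1 i) by do 2 apply: measurableU => //.
have mA2 k l : measurable (A2 k l) by rewrite /A2; case: ifP => // _; exact: measurableI.
have mE sg n k : measurable (E sg n k).
  rewrite (_ : E sg n k = [set w | eps * x < \sum_(i <- s n k) sg * (inc j i w + c j)]
     `&` \bigcap_(i in [set` s n k]) (~` [set w | dl * x < Tn i w] `&`
       ~` [set w | dl * x < Sn i w])).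
    apply: measurableI.
      apply: measurable_gt; apply: measurable_sum => i.
      by apply: measurable_funM => //; apply: measurable_funD => //;
        exact: (measurable_increment).
    by apply: fin_bigcap_measurable => // i _; apply: measurableI; exact: measurableC.
  apply/seteqP; split => w [h1 h2]; split => // i si.
    by have [h3 h4] := h2 i si; split; apply/negP; rewrite -leNgt.
  by have [h3 h4] := h2 i si; split; rewrite leNgt; apply/negP.
have mA3 n k : measurable (A3 n k) by rewrite /A3; case: ifP => // _; exact: measurableU.
exists (\bigcup_(i in `I_M) A1 i `|` (\bigcup_(k in `I_M) \bigcup_(l in `I_M) A2 k l `|`
  \bigcup_(n in `I_M.+1) \bigcup_(k in `I_M.+1) A3 n k)).
have m1 : measurable (\bigcup_(i in `I_M) A1 i) by exact: bigcup_measurable.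
have m2' k : measurable (\bigcup_(l in `I_M) A2 k l) by exact: bigcup_measurable.
have m2 : measurable (\bigcup_(k in `I_M) \bigcup_(l in `I_M) A2 k l) by exact: bigcup_measurable.
have m3' n : measurable (\bigcup_(k in `I_M.+1) A3 n k) by exact: bigcup_measurable.
have m3 : measurable (\bigcup_(n in `I_M.+1) \bigcup_(k in `I_M.+1) A3 n k).
  exact: bigcup_measurable.
split.
- by apply: measurableU => //; exact: measurableU.
- have Hb : bound x <= e * (x * F x) by near: x; exact: nbound.
  apply: le_trans Hb; rewrite /bound.
  have K1 : M.+1%:R <= (K + 1) * x by rewrite -natr1 mulrDl mul1r lerD.
  have h1 : pr P (\bigcup_(i in `I_M) A1 i) <= K * (C1 + C2) / dl ^+ m / x ^+ m0.+2 +
      K * (x * tail P S (dl * x)).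
    apply: (@le_trans _ _ (M%:R * ((C1 + C2) / (dl * x) ^+ m + tail P S (dl * x)))).
      apply: pr_bigcup_ord_cst => // i iM.
      apply: le_trans (pr_setU_le P _ _) _ => //; first exact: measurableU.
      rewrite mulrDl -addrA; apply: lerD.
        apply: HC1 => //; [by move=> t _; exact: measurable_noiseX| |].
          by move=> *; exact: (noiseX_law).
        by move=> w; exact: (continuous_noiseX).
      apply: le_trans (pr_setU_le P _ _) _ => //; rewrite (tail_S) lerD2r.
      apply: HC2 => //; [by move=> t _; exact: measurable_noiseY| |].
        by move=> *; exact: (noiseY_law).
      by move=> w; exact: (continuous_noiseY).
    apply: (@le_trans _ _ (K * x * ((C1 + C2) / (dl * x) ^+ m + tail P S (dl * x)))).
      apply: ler_wpM2r => //; rewrite addr_ge0 ?pr_ge0//.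
      by rewrite divr_ge0 ?addr_ge0// exprn_ge0// mulr_ge0 ?ltW.
    rewrite le_eqVlt; apply/orP; left; apply/eqP.
    have -> : x ^+ m0.+2 = x ^+ m / x by rewrite /m (exprSr x m0.+2) mulfK// gt_eqF.
    rewrite exprMn; set X := x ^+ m; set Dm := dl ^+ m.
    have X0 : X != 0 by rewrite gt_eqF// exprn_gt0.
    have D0 : Dm != 0 by rewrite gt_eqF// exprn_gt0.
    by field; rewrite X0 D0 gt_eqF.
  have h2 : pr P (\bigcup_(k in `I_M) \bigcup_(l in `I_M) A2 k l) <=
      K ^+ 2 * (x * F (dl * x)) ^+ 2.
    apply: (@le_trans _ _ (M%:R * (M%:R * F (dl * x) ^+ 2))).
      apply: pr_bigcup_ord_cst => // k kM; apply: pr_bigcup_ord_cst => // l lM.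
      rewrite /A2; case: ifPn => [_|kl]; first by rewrite /pr measure0 sqr_ge0.
      by rewrite pr_two_long.
    rewrite mulrA -expr2 -!exprMn ler_sqr ?nnegrE ?mulr_ge0 ?pr_ge0 ?(ltW K0) ?(ltW x0)//.
    by rewrite mulrA ler_wpM2r ?pr_ge0.
  have h3 : pr P (\bigcup_(n in `I_M.+1) \bigcup_(k in `I_M.+1) A3 n k) <=
      2 * (K + 1) ^+ 2 / x ^+ m0.+1.
    apply: (@le_trans _ _ (M.+1%:R * (M.+1%:R * (2 * (x ^+ m)^-1)))).
      apply: pr_bigcup_ord_cst => // n nM; apply: pr_bigcup_ord_cst => // k kM.
      rewrite /A3; case: ifPn => [nM'|_]; last first.
        by rewrite /pr measure0 mulr_ge0// invr_ge0 exprn_ge0// ltW.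
      apply: le_trans (pr_setU_le P _ _) _ => //.
      have us : uniq (s n k) by rewrite filter_uniq// iota_uniq.
      have sK : (size (s n k))%:R <= K * x.
        apply: le_trans MK; rewrite ler_nat; apply: leq_trans nM'.
        by rewrite size_filter; apply: leq_trans (count_size _ _) _; rewrite size_iota.
      by rewrite mulr_natl mulr2n; apply: lerD; [exact: hp|exact: hm].
    have -> : 2 * (K + 1) ^+ 2 / x ^+ m0.+1 = ((K + 1) * x) ^+ 2 * (2 * (x ^+ m)^-1).
      have -> : x ^+ m = x ^+ 2 * x ^+ m0.+1 by rewrite -exprD.
      set X := x ^+ m0.+1; have X0 : X != 0 by rewrite gt_eqF// exprn_gt0.
      by field; rewrite X0 gt_eqF.
    rewrite mulrA -expr2; apply: ler_wpM2r.
      by rewrite mulr_ge0// invr_ge0 exprn_ge0// ltW.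
    by rewrite ler_sqr ?nnegrE// mulr_ge0 ?addr_ge0 ?(ltW x0) ?(ltW K0).
  apply: le_trans (pr_setU_le P _ _) _ => //; first exact: measurableU.
  rewrite addrA; apply: lerD; first exact: h1.
  by apply: le_trans (pr_setU_le P _ _) _ => //; apply: lerD.
- move=> w nD.
  have nA1 i : (i < M)%N -> ~ A1 i w by move=> iM Aw; apply: nD; left; exists i.
  have gS i : (i < M)%N -> Sn i w <= dl * x.
    by move=> /nA1 nA; rewrite leNgt; apply/negP => h; apply: nA; right; right.
  split => //.
  + move=> i t /nA1 nA t0; rewrite leNgt; apply/negP => h; apply: nA; left.
    by exists t.
  + move=> i t /nA1 nA t0; rewrite leNgt; apply/negP => h; apply: nA; right; left.
    by exists t.
  + move=> k l kM lM kl Tk; rewrite leNgt; apply/negP => Tl; apply: nD; right; left.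
    by exists k => //; exists l => //; rewrite /A2 (negbTE kl).
  + move=> n k nM kM Tsmall.
    have nE sg : sg = 1 \/ sg = -1 -> \sum_(i <- s n k) sg * (inc j i w + c j) <= eps * x.
      move=> sg1; rewrite leNgt; apply/negP => h; apply: nD; right; right.
      exists n; first by rewrite /= ltnS.
      exists k; first by rewrite /= ltnS.
      have Ew : E sg n k w.
        split => // i; rewrite mem_filter mem_iota /= add0n => /andP[ik ni]; split.
          exact: Tsmall.
        by apply: gS; exact: leq_trans nM.
      by rewrite /A3 nM; case: sg1 Ew => ->; [left|right].
    have := nE 1 (or_introl erefl); have := nE (-1) (or_intror erefl).
    rewrite -!mulr_sumr mul1r mulN1r.
    have -> : \sum_(i <- s n k) (inc j i w + c j) =
        \sum_(i < n | i != k :> nat) (inc j i w + c j).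
      by rewrite /s big_filter -(subn0 n) -/(index_iota 0 n) big_mkord subn0.
    by move=> h1 h2; rewrite ler_norml h2 andbT lerNl.
Unshelve. all: by end_near. Qed.

Lemma good_event_likely (eps K : R) : 0 < eps -> 0 < K ->
  exists2 d0 : R, 0 < d0 <= 1 & forall dl : R, 0 < dl <= d0 ->
  forall e : R, 0 < e ->
  \forall x \near +oo, forall M : nat, M%:R <= K * x ->
  exists D : set Omega, [/\ measurable D, pr P D <= e * (x * F x) &
    forall w, ~ D w -> forall j, good j eps dl x M w].
Proof.
move=> eps0 K0.
have [d1 /andP[d10 d11] H1] := good_event_likely_proj ord0 eps0 K0.
have [d2 /andP[d20 d21] H2] := good_event_likely_proj ord_max eps0 K0.
exists (minr d1 d2); first by rewrite lt_min d10 d20 ge_min d11.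
move=> dl /andP[dl0]; rewrite le_min => /andP[dl1 dl2] e e0.
have e20 : 0 < e / 2 by rewrite divr_gt0.
have {}H1 := H1 dl (introT andP (conj dl0 dl1)) _ e20.
have {}H2 := H2 dl (introT andP (conj dl0 dl2)) _ e20.
apply: filterS2 H1 H2 => x H1 H2 M MK.
have [D1 [mD1 pD1 g1]] := H1 M MK; have [D2 [mD2 pD2 g2]] := H2 M MK.
exists (D1 `|` D2); split; first exact: measurableU.
- apply: le_trans (pr_setU_le P mD1 mD2) _.
  rewrite [leRHS](_ : _ = e / 2 * (x * F x) + e / 2 * (x * F x)); last by field.
  exact: lerD.
- move=> w nD j; have [n1 n2] : ~ D1 w /\ ~ D2 w by split => h; apply: nD; [left|right].
  case: j => -[|[|//]] i.
    by rewrite (_ : Ordinal i = ord0); [exact: g1|exact: val_inj].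
  by rewrite (_ : Ordinal i = ord_max); [exact: g2|exact: val_inj].
Qed.

(** * Crossing a level within one block *)

Definition level j n w : R := \sum_(i < n) inc j i w.

Lemma epochS n w : epoch Tn Sn n.+1 w = epoch Tn Sn n w + Tn n w + Sn n w.
Proof. by rewrite /epoch big_ord_recr /= addrA. Qed.

Lemma Z_epoch j n w : Z j (epoch Tn Sn n w) w = level j n w.
Proof.
elim: n => [|n IH]; first by rewrite /epoch /level !big_ord0 (model_Z0 model).
have T0 := model_T_gt0 model n w; have S0 := model_S_gt0 model n w.
rewrite (model_ZS model (i := n)); last by rewrite lexx andbT epochS ltrDl.
rewrite IH /level big_ord_recr /= -addrA; congr (_ + (_ + Yn n j _ w)).
by rewrite epochS; ring.
Qed.

Definition crosses (j : 'I_2) (n : nat) (x : R) (w : Omega) : Prop :=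
  [\/ x < level j n w,
      exists t, 0 <= t <= Tn n w /\ x < level j n w + Xn n j t w |
      exists t, 0 <= t <= Sn n w /\
        x < level j n w + Xn n j (Tn n w) w + Yn n j t w].

Let continuous_shift (r : R) (f : R -> R) :
  {within `[0, +oo[, continuous f} -> {within `[0, +oo[, continuous (fun t => r + f t)}.
Proof.
move=> cf; apply/subspace_continuousP => t At; apply: cvgD; first exact: cvg_cst.
by move/subspace_continuousP : cf; apply.
Qed.

Let cX i j w : {within `[0, +oo[, continuous (fun t => Xn i j t w)}.
Proof. by have [_ _] := model_X model; apply. Qed.

Let cY i j w : {within `[0, +oo[, continuous (fun t => Yn i j t w)}.
Proof. by have [_ _] := model_Y model; apply. Qed.

(** [crosses] allows the inner time 0 of each stage, where [model_ZT] and [model_ZS] say nothing;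
    [positive_witness] moves such a crossing to a positive time. *)
Lemma crossesP (j : 'I_2) (n : nat) (x : R) (w : Omega) :
  (x%:E < ereal_sup [set (Z j t w)%:E | t in
       `[epoch Tn Sn n w, epoch Tn Sn n.+1 w]])%E <-> crosses j n x w.
Proof.
have T0 := model_T_gt0 model n w; have S0 := model_S_gt0 model n w.
split.
  move=> /ereal_sup_gtP[_ [t + <-]]; rewrite /= in_itv/= epochS => /andP[Vt tV].
  rewrite lte_fin => xZ.
  move: Vt; rewrite le_eqVlt => /predU1P[Vt|Vt].
    by move: xZ; rewrite -Vt Z_epoch => ?; constructor 1.
  have [tT|Tt] := leP t (epoch Tn Sn n w + Tn n w).
    constructor 2; exists (t - epoch Tn Sn n w).
    rewrite subr_ge0 (ltW Vt) lerBlDl tT; split => //.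
    by move: xZ; rewrite (model_ZT model (i := n)) ?Vt// Z_epoch.
  constructor 3; exists (t - epoch Tn Sn n w - Tn n w).
  rewrite -addrA -opprD subr_ge0 (ltW Tt) lerBlDl tV; split => //.
  move: xZ; rewrite (model_ZS model (i := n)) ?Tt ?epochS// Z_epoch.
  by rewrite -[t - _ - _]addrA -opprD.
have hit t : epoch Tn Sn n w <= t <= epoch Tn Sn n.+1 w -> x < Z j t w ->
    (x%:E < ereal_sup [set (Z j t w)%:E | t in
       `[epoch Tn Sn n w, epoch Tn Sn n.+1 w]])%E.
  move=> tI xZ; apply/ereal_sup_gtP; exists (Z j t w)%:E; last by rewrite lte_fin.
  by exists t => //; rewrite /= in_itv.
have V0 : 0 <= epoch Tn Sn n w.
  by apply: sumr_ge0 => k _; rewrite addr_ge0// ltW ?(model_T_gt0 model) ?(model_S_gt0 model).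
case=> [xl|[t [tT xX]]|[t [tS xY]]].
- apply: (hit (epoch Tn Sn n w)); last by rewrite Z_epoch.
  by rewrite lexx epochS -addrA lerDl addr_ge0 ?ltW.
- have [|s /andP[s0 sT]] := positive_witness
    (@continuous_shift (level j n w - x) _ (@cX n j w)) T0 tT.
    by rewrite addrAC subr_gt0.
  rewrite addrAC subr_gt0 => xs.
  have Vs : epoch Tn Sn n w < epoch Tn Sn n w + s <= epoch Tn Sn n w + Tn n w.
    by rewrite ltrDl s0 lerD2l.
  apply: (hit (epoch Tn Sn n w + s)); last first.
    by rewrite (model_ZT model j Vs) Z_epoch addrAC subrr add0r.
  case/andP: Vs => /ltW -> h /=; apply: (le_trans h).
  by rewrite epochS lerDl ltW.
- have [|s /andP[s0 sS]] := positive_witness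
    (@continuous_shift (level j n w + Xn n j (Tn n w) w - x)
      _ (@cY n j w)) S0 tS.
    by rewrite addrAC subr_gt0.
  rewrite addrAC subr_gt0 => xs.
  have Vs : epoch Tn Sn n w + Tn n w < epoch Tn Sn n w + Tn n w + s <= epoch Tn Sn n.+1 w.
    by rewrite epochS ltrDl s0 lerD2l.
  apply: (hit (epoch Tn Sn n w + Tn n w + s)); last first.
    rewrite (model_ZS model j Vs) Z_epoch.
    by rewrite (_ : _ - _ - _ = s)//; ring.
  case/andP: Vs => /ltW h -> /=; rewrite andbT; apply: le_trans h.
  by rewrite lerDl ltW.
Qed.

Lemma measurable_level j n : measurable_fun setT (level j n).
Proof. by apply: measurable_sum => i; exact: (measurable_increment). Qed.

(** The horizon is random, but a dyadic witness to the left of [t] cannot leave it. *)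
Let measurable_hit (U G : Omega -> R) (f : R -> Omega -> R) :
  measurable_fun setT U -> measurable_fun setT G ->
  (forall t, 0 <= t -> measurable_fun setT (f t)) ->
  (forall w, {within `[0, +oo[, continuous (fun t => f t w)}) ->
  measurable [set w | exists t, 0 <= t <= U w /\ 0 < G w + f t w].
Proof.
move=> mU mG mf cf.
have g0 l i : 0 <= i%:R * (1 / 2 ^+ l) :> R by rewrite mulr_ge0// divr_ge0// exprn_ge0.
rewrite (_ : [set w | _] = \bigcup_l \bigcup_i
   (~` [set w | U w < i%:R * (1 / 2 ^+ l)] `&`
    [set w | 0 < G w + f (i%:R * (1 / 2 ^+ l)) w])).
  apply: bigcup_measurable => l _; apply: bigcup_measurable => i _; apply: measurableI.
    apply: measurableC; rewrite -[X in measurable X]setTI.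
    exact: measurable_fun_ltr.
  by apply: measurable_gt; apply: measurable_funD => //; exact: mf.
apply/seteqP; split => w.
  move=> [t [/andP[t0 tU] Gf]].
  have [l [i [it fi]]] := dyadic_witness (@continuous_shift (G w) _ (@cf w)) ltr01 t0 Gf.
  exists l => //; exists i => //; split => //=; apply/negP; rewrite -leNgt.
  exact: le_trans tU.
move=> [l _ [i _ [/= /negP]]]; rewrite -leNgt => iU Gf.
by exists (i%:R * (1 / 2 ^+ l)); rewrite iU g0.
Qed.

Lemma measurable_crosses j n x : measurable [set w | crosses j n x w].
Proof.
rewrite (_ : [set w | _] = [set w | x < level j n w] `|`
  ([set w | exists t, 0 <= t <= Tn n w /\ 0 < (level j n w - x) + Xn n j t w] `|`
   [set w | exists t, 0 <= t <= Sn n w /\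
      0 < (level j n w + Xn n j (Tn n w) w - x) + Yn n j t w])).
  apply: measurableU; first by apply: measurable_gt; exact: measurable_level.
  apply: measurableU; apply: measurable_hit => //.
    by apply: measurable_funB => //; exact: measurable_level.
  apply: measurable_funB => //; apply: measurable_funD; first exact: measurable_level.
  exact: (measurable_random_time (f := fun t => Xn n j t) (U := Tn n)).
apply/seteqP; split => w.
  case=> [h|[t [tT h]]|[t [tS h]]]; [by left|right; left|right; right].
    by exists t; split => //; rewrite addrAC subr_gt0.
  by exists t; split => //; rewrite addrAC subr_gt0.
case=> [h|[[t [tT h]]|[t [tS h]]]]; [by constructor 1|constructor 2|constructor 3].
  by exists t; split => //; rewrite -subr_gt0 -addrAC.
by exists t; split => //; rewrite -subr_gt0 -addrAC.
Qed.

Variable a : 'I_2 -> R.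

Definition ruin_at (u : R) (n : nat) : set Omega :=
  [set w | forall j, crosses j n (a j * u) w].

Lemma measurable_ruin_at u n : measurable (ruin_at u n).
Proof.
rewrite (_ : ruin_at u n = \bigcap_(j in [set: 'I_2]) [set w | crosses j n (a j * u) w]).
  apply: fin_bigcap_measurable => // j _; exact: measurable_crosses.
by apply/seteqP; split => w h j //=; exact: h.
Qed.

Lemma ruin_probE u : ruin_prob Tn Sn Z a u = pr P (\bigcup_n ruin_at u n).
Proof.
congr (pr P _); apply/seteqP; split => w.
  by move=> [n h]; exists n => // j; apply/crossesP; exact: h.
by move=> [n _ h]; exists n => j; apply/crossesP; exact: h.
Qed.

(** * Deterministic consequences of the good event *)

Section pathwise.
Variables (eps dl x u : R) (M : nat) (w : Omega).
Hypothesis eps0 : 0 < eps.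
Hypothesis dx0 : 0 <= dl * x.
Hypothesis epsq : forall j, eps <= q j.
Hypothesis w_good : forall j, good j eps dl x M w.

Let Tw0 i : 0 <= Tn i w. Proof. exact: ltW (model_T_gt0 model i w). Qed.
Let Sw0 i : 0 <= Sn i w. Proof. exact: ltW (model_S_gt0 model i w). Qed.
Let pe0 j : 0 <= p j + eps. Proof. by rewrite addr_ge0// ltW// (model_p_gt0 model). Qed.

Lemma good_X_le j i t : (i < M)%N -> 0 <= t -> Xn i j t w <= (p j + eps) * t + dl * x.
Proof.
move=> iM t0; have := good_X (w_good j) iM t0; rewrite /noiseX ler_norml => /andP[_].
by rewrite mulrDl; lra.
Qed.

Lemma good_X_ge j i t : (i < M)%N -> 0 <= t -> (p j - eps) * t - dl * x <= Xn i j t w.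
Proof.
move=> iM t0; have := good_X (w_good j) iM t0; rewrite /noiseX ler_norml => /andP[+ _].
by rewrite mulrBl; lra.
Qed.

(** The downward drift [q j] absorbs the linear part of the noise bound, because [eps <= q j]. *)
Lemma good_Y_le j i t : (i < M)%N -> 0 <= t -> Yn i j t w <= dl * x.
Proof.
move=> iM t0; have := good_Y (w_good j) iM t0; rewrite /noiseY ler_norml => /andP[_].
have : eps * t <= q j * t by rewrite ler_wpM2r.
lra.
Qed.

Lemma crosses_le j n y : (n < M)%N -> crosses j n y w ->
  y < level j n w + (p j + eps) * Tn n w + 2 * (dl * x).
Proof.
have dx := dx0; move=> nM; have pT : 0 <= (p j + eps) * Tn n w by rewrite mulr_ge0.
case=> [h|[t [/andP[t0 tT] h]]|[t [/andP[t0 tS] h]]].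
- lra.
- have := good_X_le j nM t0; have : (p j + eps) * t <= (p j + eps) * Tn n w by rewrite ler_wpM2l.
  lra.
- have := good_X_le j nM (Tw0 n); have := good_Y_le j nM t0.
  lra.
Qed.

Lemma level_shift j n : \sum_(i < n) (inc j i w + c j) = level j n w + n%:R * c j.
Proof. by rewrite big_split /= sumr_const card_ord mulr_natl. Qed.

Lemma crosses_no_long j n y : (n < M)%N ->
  (forall i, (i < n)%N -> Tn i w <= dl * x) -> crosses j n y w ->
  y + n%:R * c j < (p j + eps) * Tn n w + (eps * x + 2 * (dl * x)).
Proof.
have dx := dx0; move=> nM Tsmall /(crosses_le nM) h.
(* The excluded index [M] lies beyond [n], so the sum runs over all preceding blocks. *)
have /(_ (fun i ni _ => Tsmall i ni)) := good_sum (w_good j) (ltnW nM) (leqnn M).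
rewrite ler_norml => /andP[_].
under eq_bigl => i do rewrite (ltn_eqF (ltn_trans (ltn_ord i) nM)).
rewrite level_shift; lra.
Qed.

(** Ruin in a later block [n] is charged to the long block [k]. The multiples of [dl * x] are: 2
    from [crosses_le], 2 from the noises of block [k], and [p j + eps] from the short stage
    [Tn n]. *)
Lemma crosses_long j n k y : (n < M)%N -> (k < n)%N -> dl * x < Tn k w ->
  0 <= c j -> crosses j n y w ->
  y + k%:R * c j < (p j + eps) * Tn k w + (eps * x + (4 + p j + eps) * (dl * x)).
Proof.
have dx := dx0; move=> nM kn Tk c0 /(crosses_le nM) h.
have kM : (k < M)%N by apply: ltn_trans nM.
have Tsmall i : (i < n.+1)%N -> i != k -> Tn i w <= dl * x.
  move=> i_n ik; apply: (good_T (w_good j) kM) => //; last by rewrite eq_sym.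
  exact: leq_trans nM.
have := good_sum (w_good j) (ltnW nM) (ltnW kM) (fun i ni => Tsmall i (ltnW ni)).
rewrite ler_norml => /andP[_ hs].
have Tn_le : (p j + eps) * Tn n w <= (p j + eps) * (dl * x).
  by rewrite ler_wpM2l// Tsmall// gt_eqF.
have := level_shift j n; rewrite (bigD1 (Ordinal kn))//= => E.
have hX := good_X_le j kM (Tw0 k); have hY := good_Y_le j kM (Sw0 k).
(* Drift accumulated after block [k] only makes crossing harder; the extra [c j] in [k.+1] cancels
   the compensator of block [k] itself. *)
have kc : k.+1%:R * c j <= n%:R * c j by rewrite ler_wpM2r// ler_nat.
move: kc E; rewrite -natr1 mulrDl mul1r /increment.
set s := \sum_(_ < n | _) _ in hs *; move: s hs => s hs.
rewrite (_ : (4 + p j + eps) * (dl * x) = 4 * (dl * x) + (p j + eps) * (dl * x)); last by ring.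
lra.
Qed.

(** The index is the earlier long block if there is one, and [n] otherwise. This choice looks at
    stage lengths only, so the same [k] serves both coordinates. *)
Lemma ruin_long_stage n : (n < M)%N -> (forall j, 0 <= c j) -> ruin_at u n w ->
  exists2 k : nat, (k < M)%N & forall j,
    a j * u + k%:R * c j < (p j + eps) * Tn k w + (eps * x + (4 + p j + eps) * (dl * x)).
Proof.
move=> nM c0 h; have [[k [kn Tk]]|nlong] := pselect (exists k, (k < n)%N /\ dl * x < Tn k w).
  exists k; first exact: ltn_trans nM.
  by move=> j; exact: (crosses_long nM kn Tk (c0 j) (h j)).
exists n => // j; apply: lt_le_trans (crosses_no_long nM _ (h j)) _.
  by move=> i ni; rewrite leNgt; apply/negP => Ti; apply: nlong; exists i.
rewrite lerD2l lerD2l ler_wpM2r//; have := pe0 j; lra.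
Qed.

(** Without a long stage, the accumulated drift of at least [c ord0 * x] exceeds all errors and
    keeps the first coordinate below even the level 0. *)
Lemma ruin_far_long_stage n : (n < M)%N -> 0 < x -> x <= n%:R -> 0 <= u -> (forall j, 0 < a j) ->
  eps + (2 + p ord0 + eps) * dl <= c ord0 ->
  ruin_at u n w -> exists2 k : nat, (k < M)%N & dl * x < Tn k w.
Proof.
have e0 := eps0; have dx := dx0; move=> nM x0 xn u0 a0 small h; apply: contrapT => nlong.
have Tsmall i : (i < M)%N -> Tn i w <= dl * x.
  by move=> iM; rewrite leNgt; apply/negP => Ti; apply: nlong; exists i.
have := crosses_no_long nM (fun i ni => Tsmall i (ltn_trans ni nM)) (h ord0).
have : 0 <= a ord0 * u by rewrite mulr_ge0// ltW.
have : (p ord0 + eps) * Tn n w <= (p ord0 + eps) * (dl * x).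
  by rewrite ler_wpM2l// Tsmall.
have sx : (eps + (2 + p ord0 + eps) * dl) * x <= c ord0 * x by rewrite ler_wpM2r// ltW.
have cx : c ord0 * x <= n%:R * c ord0.
  rewrite mulrC ler_wpM2r//; apply: le_trans small.
  rewrite addr_ge0 ?(ltW eps0)// mulr_ge0 ?addr_ge0 ?(ltW eps0) ?(ltW (model_p_gt0 model _))//.
  by move: dx0; rewrite pmulr_lge0.
rewrite (_ : (eps + (2 + p ord0 + eps) * dl) * x =
  eps * x + 2 * (dl * x) + (p ord0 + eps) * (dl * x)) in sx; last by ring.
lra.
Qed.

(** Both coordinates are above their levels at the end of the same [T]-stage; the earlier stages are
    short because [k] is long. *)
Lemma long_stage_ruin k : (k < M)%N -> dl * x < Tn k w ->
  (forall j, a j * u + k%:R * c j + (eps * x + dl * x) < (p j - eps) * Tn k w) ->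
  ruin_at u k w.
Proof.
move=> kM Tk h j; constructor 2; exists (Tn k w); rewrite lexx Tw0; split => //.
have Tsmall i : (i < k)%N -> i != k -> Tn i w <= dl * x.
  move=> ik _; apply: (good_T (w_good j) kM) => //; last by rewrite gt_eqF.
  exact: ltn_trans kM.
have := good_sum (w_good j) (ltnW kM) (ltnW kM) Tsmall.
rewrite ler_norml => /andP[+ _].
under eq_bigl => i do rewrite (ltn_eqF (ltn_ord i)).
rewrite level_shift; have := h j; have := good_X_ge j kM (Tw0 k); lra.
Qed.

End pathwise.

(** * Two-sided bounds for the ruin probability *)

Hypothesis a0 : forall j, 0 < a j.

Local Notation ruin := ruin_at.
Local Notation level_at := (barrier a c p).

Let p0 j : 0 < p j. Proof. exact: (model_p_gt0 model). Qed.
Let q0 j : 0 < q j. Proof. exact: (model_q_gt0 model). Qed.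
Let c0 j : 0 < c j. Proof. exact: (net_drift_gt0). Qed.
Let rF : regular_tail F lambda. Proof. exact: regular_tail_T. Qed.
Let mruin u n : measurable (ruin u n). Proof. exact: (measurable_ruin_at). Qed.
Let mT i x : measurable [set w | x < Tn i w]. Proof. exact: measurable_gt. Qed.

(** All errors of the pathwise estimates become at most a quarter of [theta] times the main terms
    [p j * T] and [a j * u]. *)
Let parameters (theta : R) : 0 < theta < 1 ->
  exists2 eps : R, 0 < eps & exists2 d1 : R, 0 < d1 & forall j,
  [/\ eps <= q j, 4 * eps <= theta * p j, 4 * eps <= theta * a j &
      4 * ((4 + p j + eps) * d1) <= theta * a j].
Proof.
move=> /andP[t0 t1].
have [m1 m10 h1] := positive_lower_bound q0.
have [m2 m20 h2] := positive_lower_bound p0.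
have [m3 m30 h3] := positive_lower_bound a0.
pose eps := minr m1 (theta / 4 * minr m2 m3).
have e0 : 0 < eps by rewrite !(lt_min, m10, mulr_gt0, divr_gt0, m20).
have e1 : eps <= m1 by rewrite ge_min lexx.
have e2 : eps <= theta / 4 * minr m2 m3 by rewrite ge_min lexx orbT.
have e3 : eps <= theta / 4 * m2.
  by apply: le_trans e2 _; rewrite ler_pM2l ?divr_gt0// ge_min lexx.
have e4 : eps <= theta / 4 * m3.
  by apply: le_trans e2 _; rewrite ler_pM2l ?divr_gt0// ge_min lexx orbT.
have pe j : 0 < 4 + p j + eps by rewrite addr_gt0// addr_gt0.
have [d1 d10 h4] := positive_lower_bound
  (fun j => divr_gt0 (mulr_gt0 t0 (a0 j)) (mulr_gt0 (ltr0Sn R 3) (pe j))).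
exists eps => //; exists d1 => // j.
have hp := ler_wpM2l (ltW t0) (h2 j); have ha := ler_wpM2l (ltW t0) (h3 j).
split; [exact: le_trans (h1 j)|lra|lra|].
have := h4 j; rewrite ler_pdivlMr ?mulr_gt0//.
by rewrite [d1 * _]mulrC -mulrA.
Qed.

Lemma ruin_near_le (theta K e : R) : 0 < theta < 1 -> 0 < K -> 0 < e ->
  \forall u \near +oo, forall M : nat, M%:R <= K * u ->
  pr P (\bigcup_(n in `I_M) ruin u n) <=
    \sum_(k < M) F ((1 - theta) * u * level_at (k%:R / u)) + e * (u * F u).
Proof.
move=> t01 K0 e0; have [eps eps0 [d1 d10 hd]] := parameters t01.
case/andP: t01 => t0 t1.
have [d0 /andP[d00 d01] HD] := good_event_likely eps0 K0.
pose dl := minr d0 d1.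
have dl0 : 0 < dl by rewrite lt_min d00.
have dld : dl <= d0 by rewrite ge_min lexx.
have dl1 : dl <= d1 by rewrite ge_min lexx orbT.
have {}HD := HD dl (introT andP (conj dl0 dld)) e e0.
near=> u => M MK.
have u0 : 0 < u by near: u; apply: nbhs_pinfty_gt; exact: num_real.
have HDu : forall M : nat, M%:R <= K * u -> exists D : set Omega, [/\ measurable D,
    pr P D <= e * (u * F u) & forall w, ~ D w -> forall j, good j eps dl u M w].
  by near: u.
have [D [mD pD gD]] := HDu M MK.
pose A k := [set w | (1 - theta) * u * level_at (k%:R / u) < Tn k w].
have mA k : measurable (A k) by exact: mT.
have mU : measurable (\bigcup_(k in `I_M) A k) by exact: bigcup_measurable.
apply: (@le_trans _ _ (pr P (\bigcup_(k in `I_M) A k `|` D))); last first.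
  apply: le_trans (pr_setU_le P _ _) _ => //; apply: lerD => //.
  apply: le_trans (pr_bigcup_ord_le P _ mA) _.
  by apply: ler_sum => k _; rewrite (tail_T).
apply: le_pr; [exact: bigcup_measurable|exact: measurableU|].
move=> w [n /= nM rn]; have [Dw|nDw] := pselect (D w); [by right|left].
have dlu : 0 <= dl * u by rewrite mulr_ge0 ?ltW.
have epsq j : eps <= q j by case: (hd j).
have [k kM hk] := ruin_long_stage eps0 dlu epsq (gD w nDw) nM (fun j => ltW (c0 j)) rn.
exists k => //; apply: barrier_lt => //; first by rewrite subr_gt0.
move=> j; have [_ h1 h2 h3] := hd j.
have T0 := ltW (model_T_gt0 model k w).
have kc : 0 <= k%:R * c j by rewrite mulr_ge0// ltW.
have h4 : (4 + p j + eps) * dl * u <= (4 + p j + eps) * d1 * u.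
  by rewrite ler_pM2r// ler_pM2l// !addr_gt0.
have h5 := ler_wpM2r (ltW u0) h3; have h6 := ler_wpM2r (ltW u0) h2.
have h7 := ler_wpM2r T0 h1.
have hkj := hk j; set t := Tn k w in T0 h7 hkj *.
have au : 0 < a j * u by rewrite mulr_gt0.
have h8 : theta * (k%:R * c j) >= 0 by rewrite mulr_ge0// ltW.
(* The errors in [u] cost the factor [1 - theta / 2] of [h10]; multiplying [h10] by [1 - theta],
   which also absorbs the error in the slope, lets this factor cancel. *)
have h9 : (1 - theta) * ((p j + eps) * t) <= (1 - theta / 2) * (p j * t).
  have : 0 <= theta * (eps * t) by rewrite mulr_ge0 ?(ltW t0)// mulr_ge0 ?(ltW eps0).
  have : (1 - theta) * ((p j + eps) * t) = p j * t - theta * p j * t + eps * t - theta * (eps * t).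
    by ring.
  have : 0 <= theta * p j * t by rewrite mulr_ge0// mulr_ge0 ?(ltW t0) ?(ltW (p0 _)).
  move: h7; rewrite -!mulrA; set x1 := theta * (p j * t); lra.
have h10 : (1 - theta / 2) * (a j * u + k%:R * c j) < (p j + eps) * t.
  rewrite !mulrA in hkj h4 h5 h6 h8 h9 au kc *; lra.
have t2 : 0 < 1 - theta / 2 by lra.
rewrite -(ltr_pM2l t2); apply: lt_le_trans h9.
by rewrite mulrCA ltr_pM2l// subr_gt0.
Unshelve. all: by end_near. Qed.

Lemma ruin_ge (theta K e : R) : 0 < theta < 1 -> 0 < K -> 0 < e ->
  \forall u \near +oo, forall M : nat, M%:R <= K * u ->
  \sum_(k < M) F ((1 + theta) * u * level_at (k%:R / u)) - e * (u * F u) <=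
    ruin_prob Tn Sn Z a u.
Proof.
move=> t01 K0 e0; have [eps eps0 [d1 d10 hd]] := parameters t01.
case/andP: t01 => t0 t1.
have [d0 /andP[d00 d01] HD] := good_event_likely eps0 K0.
pose dl := minr d0 d1.
have dl0 : 0 < dl by rewrite lt_min d00.
have dld : dl <= d0 by rewrite ge_min lexx.
have dl1 : dl <= d1 by rewrite ge_min lexx orbT.
have e20 : 0 < e / 2 by rewrite divr_gt0.
have {}HD := HD dl (introT andP (conj dl0 dld)) (e / 2) e20.
have Hsq := negligible_sq rF lambda_gt1 dl0 (sqr_ge0 K) e20.
near=> u => M MK.
have u0 : 0 < u by near: u; apply: nbhs_pinfty_gt; exact: num_real.
have HDu : forall M : nat, M%:R <= K * u -> exists D : set Omega, [/\ measurable D,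
    pr P D <= e / 2 * (u * F u) & forall w, ~ D w -> forall j, good j eps dl u M w].
  by near: u.
have [D [mD pD gD]] := HDu M MK.
have Hsu : K ^+ 2 * (u * F (dl * u)) ^+ 2 <= e / 2 * (u * F u) by near: u.
pose A k := [set w | (1 + theta) * u * level_at (k%:R / u) < Tn k w].
have mA k : measurable (A k) by exact: mT.
have mU : measurable (\bigcup_(k in `I_M) A k) by exact: bigcup_measurable.
have t10 : 0 < 1 + theta by lra.
have longA k w j : A k w -> (1 + theta) * (a j * u + k%:R * c j) < p j * Tn k w.
  exact: lt_barrier.
(* Exceeding the barrier makes a stage long, so the overlaps in [bonferroni] are pairs of long
   stages. *)
have longT k w : A k w -> dl * u < Tn k w.
  move=> /(longA _ _ ord0); rewrite -(ltr_pM2l (p0 ord0)); apply: le_lt_trans.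
  have [_ h1 h2 h3] := hd ord0.
  have h4 : p ord0 * dl <= (4 + p ord0 + eps) * d1.
    apply: ler_pM; [exact: ltW|exact: ltW| |exact: dl1].
    by have := p0 ord0; move: eps0; lra.
  have h6 : p ord0 * dl <= a ord0.
    have : theta * a ord0 <= 1 * a ord0 by rewrite ler_wpM2r ?ltW.
    have := a0 ord0; lra.
  rewrite mulrA; apply: (@le_trans _ _ (a ord0 * u)); first by rewrite ler_wpM2r// ltW.
  have au : 0 <= a ord0 * u by rewrite mulr_ge0 ?ltW.
  apply: (@le_trans _ _ (a ord0 * u + k%:R * c ord0)).
    by rewrite lerDl mulr_ge0// ltW.
  apply: ler_peMl; last by rewrite lerDl ltW.
  by rewrite addr_ge0// mulr_ge0// ltW.
have F0 := ltW (rt_gt0 rF (dl * u)).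
have := @bonferroni _ _ _ P M A (F (dl * u) ^+ 2) mA (sqr_ge0 _) _.
move=> /(_ _)/wrap[].
  move=> i k ik; rewrite -(pr_two_long _ ik).
  by apply: le_pr; [exact: measurableI|exact: measurableI|move=> w [/longT ? /longT ?]].
under eq_bigr do rewrite (tail_T).
have sqle : M%:R ^+ 2 * F (dl * u) ^+ 2 <= K ^+ 2 * (u * F (dl * u)) ^+ 2.
  rewrite -!exprMn ler_sqr ?nnegrE ?mulr_ge0 ?(ltW K0) ?(ltW u0)//.
  by rewrite mulrA ler_wpM2r.
have Ule : pr P (\bigcup_(k in `I_M) A k) <= ruin_prob Tn Sn Z a u + pr P D.
  rewrite (ruin_probE).
  have mR : measurable (\bigcup_n ruin u n) by exact: bigcup_measurable.
  apply: le_trans (pr_setU_le P mR mD).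
  apply: le_pr => //; first exact: measurableU.
  move=> w [k /= kM Ak]; have [Dw|nDw] := pselect (D w); [by right|left].
  exists k => //; apply: (long_stage_ruin (gD w nDw) kM (longT _ _ Ak)) => j.
  have [_ h1 h2 h3] := hd j.
  have T0 := ltW (model_T_gt0 model k w).
  have kc : 0 <= k%:R * c j by rewrite mulr_ge0// ltW.
  have := longA _ _ j Ak; set t := Tn k w in T0 *; move=> hk.
  have h5 := ler_wpM2r (ltW u0) h3; have h6 := ler_wpM2r (ltW u0) h2.
  have h7 := ler_wpM2r T0 h1.
  have h4 : 4 * (dl * u) <= 4 * ((4 + p j + eps) * d1) * u.
    rewrite -mulrA ler_pM2l// ler_pM2r//; apply: le_trans dl1 _.
    by apply: ler_peMl; first exact: ltW; have := p0 j; move: eps0; lra.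
  have au : 0 < a j * u by rewrite mulr_gt0.
  set A1 := a j * u + k%:R * c j in hk *.
  have A10 : a j * u <= A1 by rewrite /A1 lerDl.
  have tA : theta * (a j * u) <= theta * A1 by rewrite ler_pM2l.
  have pt : 0 <= p j * t by rewrite mulr_ge0// ltW.
  have h8 : (1 - theta / 4) * (p j * t) <= (p j - eps) * t.
    by move: h7; rewrite mulrBl -!mulrA; lra.
  apply: lt_le_trans h8.
  have t4 : 0 < 1 - theta / 4 by lra.
  apply: le_lt_trans (_ : (1 - theta / 4) * ((1 + theta) * A1) < _); last by rewrite ltr_pM2l.
  have h9 : theta * theta * A1 <= theta * A1.
    by rewrite ler_wpM2r ?(le_trans (ltW au))// -[leRHS]mulr1 ler_pM2l// ltW.
  (* As [theta ^ 2 <= theta], this is at least [(1 + theta / 2) * A1], and the two errors use up at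
     most [theta / 2 * A1]. *)
  have : (1 - theta / 4) * ((1 + theta) * A1) =
    A1 + 3 / 4 * (theta * A1) - (theta * theta * A1) / 4 by field.
  rewrite !mulrA in tA h9 h4 h5 h6 *; lra.
lra.
Unshelve. all: by end_near. Qed.

(** Ruin in a block of index between [x] and [2 * x], for [x = 2 ^ i * M], requires a long stage
    among the first [2 * x] ones, at cost [O(x * F x)]. By [rt_halving] this decays geometrically in
    [i] with ratio [z = 2 ^ (1 - mu)], uniformly in [u]. *)
Lemma ruin_far_le : exists2 C : R, 0 < C & exists x0 : R, forall (u : R) (M : nat),
  0 <= u -> x0 <= M%:R ->
  pr P (\bigcup_(n in [set n | (M <= n)%N]) ruin u n) <= C * (M%:R * F M%:R).
Proof.
have [m mp hm] := positive_lower_bound q0.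
have l1 := lambda_gt1.
pose mu := (1 + lambda) / 2.
have mu1 : 1 < mu by rewrite /mu; lra.
have mul : mu < lambda by rewrite /mu; lra.
pose eps := minr m (c ord0 / 2).
have eps0 : 0 < eps by rewrite lt_min mp divr_gt0.
have epsm : eps <= m by rewrite ge_min lexx.
have epsc : eps <= c ord0 / 2 by rewrite ge_min lexx orbT.
have epsq j : eps <= q j by exact: le_trans (hm j).
have pe : 0 < 2 + p ord0 + eps by rewrite addr_gt0// addr_gt0.
(* Here [K = 2]: a dyadic range starting at [x] ends at [2 * x]. *)
have [d0 /andP[d00 d01] HD] := good_event_likely eps0 (ltr0Sn R 1).
pose dl := minr d0 (c ord0 / 2 / (2 + p ord0 + eps)).
have dl0 : 0 < dl by rewrite lt_min d00 !divr_gt0.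
have dld : dl <= d0 by rewrite ge_min lexx.
have small : eps + (2 + p ord0 + eps) * dl <= c ord0.
  have : dl <= c ord0 / 2 / (2 + p ord0 + eps) by rewrite ge_min lexx orbT.
  rewrite ler_pdivlMr// [dl * _]mulrC; lra.
have {}HD := HD dl (introT andP (conj dl0 dld)) 1 ltr01.
have [C C0 HC] := rt_ratio_bounded rF dl0.
have [x1 x11 H1] := near_pinfty_ex HD.
have [x2 x21 H2] := near_pinfty_ex HC.
have [x3 x31 H3] := near_pinfty_ex (rt_halving rF mul).
pose z : R := 2 * 2 `^ (- mu).
have z0 : 0 < z by rewrite mulr_gt0 ?powR_gt0.
have z1 : z < 1.
  rewrite /z -[X in X * _]powRr1// -powRD; last by rewrite (gt_eqF (ltr0Sn R 1)) implybT.
  by rewrite /powR (gt_eqF (ltr0Sn R 1)) expR_lt1 pmulr_llt0 ?ln_gt0 ?ltr1n//; lra.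
have D0 : 0 < (2 * C + 1) / (1 - z) by rewrite divr_gt0 ?subr_gt0// addr_gt0// mulr_gt0.
exists ((2 * C + 1) / (1 - z)) => //; exists (maxr x1 (maxr x2 x3)) => u M u0.
rewrite !ge_max => /and3P[Mx1 Mx2 Mx3].
have M1 : 1 <= M%:R :> R by apply: le_trans Mx1.
have Mp : 0 < M%:R :> R by apply: lt_le_trans M1.
pose A i := \bigcup_(n in [set n | (2 ^ i * M <= n < 2 ^ i.+1 * M)%N]) ruin u n.
have mA i : measurable (A i) by exact: bigcup_measurable.
have prA i : pr P (A i) <= (2 * C + 1) * (M%:R * F M%:R) * z ^+ i.
  pose x : R := (2 ^ i * M)%:R.
  have Mx : M%:R <= x by rewrite ler_nat leq_pmull// expn_gt0.
  have x0 : 0 < x by apply: lt_le_trans Mx.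
  have M2 : (2 ^ i.+1 * M)%:R <= 2 * x by rewrite /x -natrM mulnA -expnS.
  have [D [mD pD gD]] := H1 x (le_trans Mx1 Mx) _ M2.
  apply: (@le_trans _ _ ((2 * C + 1) * (x * F x))); last first.
    rewrite -!mulrA; apply: ler_wpM2l; first by rewrite addr_ge0// mulr_ge0// ltW.
    have := H3 M%:R Mx3 i; rewrite -natrX -natrM -/x => h.
    apply: le_trans (ler_wpM2l (ltW x0) h) _.
    rewrite /x natrM natrX /z exprMn le_eqVlt; apply/orP; left; apply/eqP; ring.
  pose G := \bigcup_(k in `I_(2 ^ i.+1 * M)%N) [set w | dl * x < Tn k w].
  have mG : measurable G by exact: bigcup_measurable.
  apply: (@le_trans _ _ (pr P (G `|` D))); last first.
    apply: le_trans (pr_setU_le P mG mD) _; rewrite mulrDl mul1r in pD *; apply: lerD => //.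
    apply: (@le_trans _ _ ((2 ^ i.+1 * M)%:R * F (dl * x))).
      by apply: pr_bigcup_ord_cst => // k _; rewrite (tail_T).
    have := H2 x (le_trans Mx2 Mx); set f := F (dl * x) => h.
    have f0 : 0 <= f by exact: ltW (rt_gt0 rF _).
    apply: le_trans (ler_wpM2r f0 M2) _.
    by rewrite -!mulrA ler_pM2l// [leRHS]mulrCA ler_pM2l.
  apply: le_pr => //; first exact: measurableU.
  move=> w [n /= /andP[n1 n2] rn]; have [Dw|nDw] := pselect (D w); [by right|left].
  have dlx : 0 <= dl * x by rewrite mulr_ge0 ?ltW.
  have xn : x <= n%:R by rewrite ler_nat.
  by have [k kM hk] := ruin_far_long_stage eps0 dlx epsq (gD w nDw) n2 x0 xn u0
    a0 small rn; exists k.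
have c10 : 0 <= (2 * C + 1) * (M%:R * F M%:R).
  by rewrite !mulr_ge0 ?addr_ge0 ?mulr_ge0 ?(ltW C0) ?(ltW Mp)// ltW// (rt_gt0 rF).
rewrite mulrAC; apply: le_trans (pr_bigcup_geometric mA c10 _ prA); last by rewrite z0.
apply: le_pr; [exact: bigcup_measurable|exact: bigcup_measurable|].
move=> w [n /= Mn rn].
have M0 : (0 < M)%N by rewrite -(ltr_nat R).
have q1 : (0 < n %/ M)%N by rewrite divn_gt0.
exists (trunc_log 2 (n %/ M)) => //; exists n => //=.
have /andP[n1 n2] := trunc_log_bounds (isT : (1 < 2)%N) q1.
by rewrite -leq_divRL// n1 -ltn_divLR.
Qed.

Let lambda_gt0 : 0 < lambda. Proof. exact: lt_trans lambda_gt1. Qed.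
Let lambda_ge0 : 0 <= lambda. Proof. exact: ltW. Qed.

Lemma barrier_gt0 v : 0 <= v -> 0 < level_at v.
Proof.
move=> v0; apply: lt_le_trans (barrier_ge a c p ord0 v).
by rewrite divr_gt0// ltr_wpDr// mulr_ge0// ltW.
Qed.

Lemma barrier_nondecreasing v v' : v <= v' -> level_at v <= level_at v'.
Proof.
move=> vv; rewrite ge_max; apply/andP; split.
  by apply: le_trans (barrier_ge a c p ord0 v'); rewrite ler_pM2r ?invr_gt0// lerD2l ler_pM2l.
by apply: le_trans (barrier_ge a c p ord_max v'); rewrite ler_pM2r ?invr_gt0// lerD2l ler_pM2l.
Qed.

(** For [0 <= v], the limit of [F (u * level_at v) / F u]. *)
Definition barrier_tail (v : R) : R := level_at v `^ (- lambda).

Local Notation G := barrier_tail.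

Let G_ge0 v : 0 <= v -> 0 <= G v. Proof. by move=> _; exact: powR_ge0. Qed.

Let G_nonincreasing v v' : 0 <= v -> v <= v' -> G v' <= G v.
Proof.
move=> v0 vv; have v'0 := le_trans v0 vv.
rewrite /G !powRN lef_pV2 ?posrE ?powR_gt0 ?barrier_gt0//.
by apply: ge0_ler_powR; rewrite ?nnegrE ?(ltW (barrier_gt0 _))// barrier_nondecreasing.
Qed.

Lemma measurable_barrier_tail : measurable_fun setT G.
Proof.
apply: (@measurableT_comp _ _ _ _ _ _ (@powR R ^~ (- lambda))) => //.
by apply: measurable_maxr; apply: measurable_funM => //; apply: measurable_funD => //;
  exact: measurable_funM.
Qed.

Let uF_gt0 u : 0 < u -> 0 < u * F u.
Proof. by move=> u0; rewrite mulr_gt0// (rt_gt0 rF). Qed.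

Lemma ruin_prob_le : exists2 C : R, 0 < C & forall (theta h eta : R) (L : nat),
  0 < theta < 1 -> 0 < h -> 0 < eta -> (0 < L)%N ->
  \forall u \near +oo, ruin_prob Tn Sn Z a u <=
    ((1 + theta) * (1 - theta) `^ (- lambda) * upper_sum G h L +
     C * (L%:R * h) `^ (1 - lambda) + eta) * (u * F u).
Proof.
have [C C0 [x0 Hfar]] := ruin_far_le.
(* One factor 2 bounds [M] by [2 * (L * h * u)], the other bounds the tail ratio at [L * h] by twice
   its limit. *)
exists (4 * C); first by rewrite mulr_gt0.
move=> theta h eta L t01 h0 eta0 L0; case/andP: (t01) => t0 t1.
have s0 : 0 < 1 - theta by rewrite subr_gt0.
have t10 : 0 < 1 + theta by lra.
have Lp : 0 < L%:R :> R by rewrite ltr0n.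
have Lh0 : 0 < L%:R * h by rewrite mulr_gt0.
have eta20 : 0 < eta / 2 by rewrite divr_gt0.
have K0 : 0 < L%:R * ((1 + theta) * h) by rewrite !mulr_gt0.
have Hnear := ruin_near_le t01 K0 eta20.
pose b (r : nat) := level_at (r%:R * h).
have b0 r : 0 < b r by rewrite barrier_gt0// mulr_ge0// ltW.
pose lim := (1 - theta) `^ (- lambda) * \sum_(r < L) b r `^ (- lambda).
pose eta' := eta / 2 / ((1 + theta) * h).
have eta'0 : 0 < eta' by rewrite !divr_gt0// mulr_gt0.
have Hsum : \forall u \near +oo,
    (\sum_(r < L) F ((1 - theta) * u * b r)) / F u <= lim + eta'.
  have := scaled_sum_cvg rF (L := L) s0 b0 => /cvgr_le; apply; rewrite -/lim.
  by rewrite ltrDl.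
have Hratio : \forall u \near +oo, F (L%:R * h * u) <= 2 * (L%:R * h) `^ (- lambda) * F u.
  apply: (rt_ratio_le rF) => //.
  by rewrite ltr_pMl ?powR_gt0// ltr1n.
near=> u.
have u0 : 0 < u by near: u; apply: nbhs_pinfty_gt; exact: num_real.
have hu : theta^-1 <= h * u.
  by rewrite -ler_pdivrMl// [X in X <= _]mulrC; near: u; apply: nbhs_pinfty_ge; exact: num_real.
have x0u : x0 <= L%:R * h * u.
  by rewrite -ler_pdivrMl//; near: u; apply: nbhs_pinfty_ge; exact: num_real.
have hu1 : 1 <= theta * (h * u) by rewrite -ler_pdivrMl// mulr1.
have hu0 : 0 <= h * u by rewrite mulr_ge0 ?ltW.
(* Rounding up makes block [r] start at an index at least [r * h * u] and the far part at least at
   [L * h * u]; the excess is at most the factor [1 + theta] once [theta * h * u >= 1]. *)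
pose m := (truncn (h * u)).+1; pose M := (L * m)%N.
have /andP[m2 m1] := truncn_itv hu0.
have m_le : m%:R <= (1 + theta) * (h * u) by rewrite /m -natr1 mulrDl mul1r lerD.
have m_ge : h * u <= m%:R by exact: ltW.
have Fu : 0 < F u := rt_gt0 rF u.
have MK : M%:R <= L%:R * ((1 + theta) * h) * u by rewrite natrM -!mulrA ler_pM2l// !mulrA in m_le *.
have Mge : L%:R * h * u <= M%:R by rewrite natrM -mulrA ler_pM2l.
rewrite (ruin_probE).
have mnear : measurable (\bigcup_(n in `I_M) ruin u n) by exact: bigcup_measurable.
have mfar : measurable (\bigcup_(n in [set n | (M <= n)%N]) ruin u n) by exact: bigcup_measurable.
apply: (@le_trans _ _ (pr P (\bigcup_(n in `I_M) ruin u n) +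
    pr P (\bigcup_(n in [set n | (M <= n)%N]) ruin u n))).
  apply: le_trans (pr_setU_le P mnear mfar).
  apply: le_pr; [exact: bigcup_measurable|exact: measurableU|].
  by move=> w [n _ rn]; have [Mn|nM] := leqP M n; [right|left]; exists n.
have near_le : pr P (\bigcup_(n in `I_M) ruin u n) <=
    \sum_(k < M) F ((1 - theta) * u * level_at (k%:R / u)) + eta / 2 * (u * F u).
  by move: M MK {Mge mnear mfar}; near: u.
have far_le : pr P (\bigcup_(n in [set n | (M <= n)%N]) ruin u n) <=
    4 * C * (L%:R * h) `^ (1 - lambda) * (u * F u).
  apply: le_trans (Hfar u M (ltW u0) (le_trans x0u Mge)) _.
  have F1 : F M%:R <= 2 * (L%:R * h) `^ (- lambda) * F u.
    by apply: le_trans (rt_nonincreasing rF Mge) _; near: u.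
  have M2 : M%:R <= 2 * (L%:R * h * u).
    apply: le_trans MK _; rewrite -!mulrA [leRHS]mulrCA ler_pM2l//.
    by rewrite mulrA -mulrA ler_wpM2r//; lra.
  apply: (@le_trans _ _ (C * (2 * (L%:R * h * u) * (2 * (L%:R * h) `^ (- lambda) * F u)))).
    apply: ler_wpM2l; first exact: ltW.
    by apply: ler_pM => //; exact: ltW (rt_gt0 rF _).
  rewrite powRD; last by rewrite (gt_eqF Lh0) implybT.
  by rewrite powRr1 ?(ltW Lh0)// le_eqVlt; apply/orP; left; apply/eqP; ring.
have sum_le : \sum_(k < M) F ((1 - theta) * u * level_at (k%:R / u)) <=
    ((1 + theta) * (1 - theta) `^ (- lambda) * upper_sum G h L + eta / 2) * (u * F u).
  have Hu : (\sum_(r < L) F ((1 - theta) * u * b r)) / F u <= lim + eta' by near: u.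
  apply: (@le_trans _ _ (m%:R * \sum_(r < L) F ((1 - theta) * u * b r))).
    apply: (@sum_blocks_le _ (fun k => F ((1 - theta) * u * level_at (k%:R / u)))
      (fun r => F ((1 - theta) * u * b r))) => r k rL /andP[rk _]; apply: (rt_nonincreasing rF).
    rewrite ler_pM2l ?mulr_gt0//; apply: barrier_nondecreasing.
    rewrite ler_pdivlMr//; apply: (@le_trans _ _ (r * m)%:R); last by rewrite ler_nat.
    by rewrite natrM -mulrA ler_wpM2l.
  rewrite ler_pdivrMr// in Hu.
  apply: (@le_trans _ _ ((1 + theta) * (h * u) * ((lim + eta') * F u))).
    apply: ler_pM => //; apply: sumr_ge0 => r _; exact: ltW (rt_gt0 rF _).
  rewrite /upper_sum -mulr_sumr le_eqVlt; apply/orP; left; apply/eqP.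
  rewrite /eta' /lim; set s1 := \sum_(_ < _) _.
  by field; rewrite !gt_eqF.
lra.
Unshelve. all: by end_near. Qed.

Lemma ruin_prob_ge (theta h eta : R) (L : nat) :
  0 < theta < 1 -> 0 < h -> 0 < eta ->
  \forall u \near +oo,
    ((1 - theta) * (1 + theta) `^ (- lambda) * lower_sum G h L - eta) * (u * F u) <=
    ruin_prob Tn Sn Z a u.
Proof.
move=> t01 h0 eta0; case/andP: (t01) => t0 t1.
have s0 : 0 < 1 - theta by rewrite subr_gt0.
have t10 : 0 < 1 + theta by lra.
have eta20 : 0 < eta / 2 by rewrite divr_gt0.
(* The successor keeps this constant positive when [L = 0]. *)
have K0 : 0 < L.+1%:R * h by rewrite mulr_gt0.
have Hnear := ruin_ge t01 K0 eta20.
pose b (r : nat) := level_at (r.+1%:R * h).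
have b0 r : 0 < b r by rewrite barrier_gt0// mulr_ge0// ltW.
pose lim := (1 + theta) `^ (- lambda) * \sum_(r < L) b r `^ (- lambda).
pose eta' := eta / 2 / ((1 - theta) * h).
have eta'0 : 0 < eta' by rewrite !divr_gt0// mulr_gt0.
have Hsum : \forall u \near +oo,
    lim - eta' <= (\sum_(r < L) F ((1 + theta) * u * b r)) / F u.
  have := scaled_sum_cvg rF (L := L) t10 b0 => /cvgr_ge; apply; rewrite -/lim.
  by rewrite gtrBl.
near=> u.
have u0 : 0 < u by near: u; apply: nbhs_pinfty_gt; exact: num_real.
have hu : theta^-1 <= h * u.
  by rewrite -ler_pdivrMl// [X in X <= _]mulrC; near: u; apply: nbhs_pinfty_ge; exact: num_real.
have hu1 : 1 <= theta * (h * u) by rewrite -ler_pdivrMl// mulr1.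
have hu0 : 0 <= h * u by rewrite mulr_ge0 ?ltW.
(* Rounding down keeps block [r] below the index [r.+1 * h * u], at the price of a factor
   [1 - theta]. *)
pose m := truncn (h * u); pose M := (L * m)%N.
have /andP[m1 m2] := truncn_itv hu0.
have m_ge : (1 - theta) * (h * u) <= m%:R by move: m2; rewrite -natr1 -/m; lra.
have Fu : 0 < F u := rt_gt0 rF u.
have MK : M%:R <= L.+1%:R * h * u.
  rewrite natrM -mulrA; apply: (@le_trans _ _ (L.+1%:R * m%:R)); last by rewrite ler_pM2l.
  by rewrite ler_wpM2r// ler_nat.
have Hn : \sum_(k < M) F ((1 + theta) * u * level_at (k%:R / u)) - eta / 2 * (u * F u) <=
    ruin_prob Tn Sn Z a u.
  by move: M MK; near: u.
apply: le_trans Hn.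
have Hu : lim - eta' <= (\sum_(r < L) F ((1 + theta) * u * b r)) / F u by near: u.
rewrite ler_pdivlMr// in Hu.
have sum_ge : m%:R * \sum_(r < L) F ((1 + theta) * u * b r) <=
    \sum_(k < M) F ((1 + theta) * u * level_at (k%:R / u)).
  apply: (@sum_blocks_ge _ (fun k => F ((1 + theta) * u * level_at (k%:R / u)))
    (fun r => F ((1 + theta) * u * b r))) => r k rL /andP[_ rk]; apply: (rt_nonincreasing rF).
  rewrite ler_pM2l ?mulr_gt0//; apply: barrier_nondecreasing.
  rewrite ler_pdivrMr//; apply: (@le_trans _ _ (r.+1 * m)%:R); first by rewrite ler_nat ltnW.
  by rewrite natrM -mulrA ler_wpM2l.
have sum_ge' : (1 - theta) * (h * u) * ((lim - eta') * F u) <=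
    m%:R * \sum_(r < L) F ((1 + theta) * u * b r).
  apply: (@le_trans _ _ ((1 - theta) * (h * u) * \sum_(r < L) F ((1 + theta) * u * b r))).
    by rewrite ler_wpM2l// mulr_ge0// ltW.
  apply: ler_wpM2r => //; apply: sumr_ge0 => r _; exact: ltW (rt_gt0 rF _).
have E : (1 - theta) * (h * u) * ((lim - eta') * F u) =
  ((1 - theta) * (1 + theta) `^ (- lambda) * lower_sum G h L - eta / 2) * (u * F u).
  rewrite /lower_sum -mulr_sumr /eta' /lim; set s1 := \sum_(_ < _) _.
  by field; rewrite !gt_eqF.
lra.
Unshelve. all: by end_near. Qed.

Local Notation I := (\int[lebesgue_measure]_(v in `[0%R, +oo[) (G v)%:E)%E.

Lemma ruin_prob_asymptotic : exists2 i : R, 0 < i & I = i%:E /\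
  ruin_prob Tn Sn Z a u / (u * F u) @[u --> +oo] --> i.
Proof.
have [C C0 Hle] := ruin_prob_le.
have lower_le h := @lower_sum_le _ _ measurable_barrier_tail G_ge0 G_nonincreasing h.
(* Playing both bounds for the ruin probability against each other shows that
   the integral is finite. *)
have [C' HC'] : exists C' : R, forall L, lower_sum G 1 L <= C'.
  have [theta t01 [_ t2]] := powR_perturbation lambda_gt0 (ltr1n R 2).
  have H1 := Hle theta 1 1 1%N t01 ltr01 ltr01 isT.
  set A := _ + _ + _ in H1; exists (2 * (A + 1)) => L.
  have H2 := @ruin_prob_ge theta 1 1 L t01 ltr01 ltr01.
  have [x1 x11 H12] := near_pinfty_ex (filterI H1 H2).
  have [h1 h2] := H12 x1 (lexx _).
  have x10 : 0 < x1 by apply: lt_le_trans x11.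
  have := le_trans h2 h1; rewrite ler_pM2r ?uF_gt0//.
  have l0 : 0 <= lower_sum G 1 L.
    by apply: sumr_ge0 => r _; rewrite mul1r G_ge0// mulr_ge0.
  have := ler_wpM2r l0 t2; lra.
have Ifin : (I <= (1 * G 0 + C')%:E)%E 
  by exact: (integral_le_of_lower_sums measurable_barrier_tail G_ge0 G_nonincreasing ltr01 HC').
pose i := fine I.
have I0 : (0 <= I)%E by apply: integral_ge0 => v _; rewrite lee_fin powR_ge0.
have Ii : I = i%:E.
  by rewrite fineK// ge0_fin_numE//; apply: le_lt_trans Ifin _; exact: ltry.
have i0 : 0 < i.
  rewrite -lte_fin -Ii; apply: lt_le_trans (lower_le 1 ltr01 1%N).
  by rewrite lte_fin /lower_sum big_ord1 !mul1r powR_gt0// barrier_gt0.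
exists i => //; split => //.
have G00 : 0 <= G 0 by exact: G_ge0.
have main (eta : R) : 0 < eta -> \forall u \near +oo,
    (i - eta) * (u * F u) <= ruin_prob Tn Sn Z a u <= (i + eta) * (u * F u).
  move=> eta0.
  have eta40 : 0 < eta / 4 by rewrite divr_gt0.
  (* The mesh makes [h * G 0], the gap between lower and upper sums, at most [eta / 4]. *)
  pose h := eta / 4 / (G 0 + 1).
  have h0 : 0 < h by rewrite divr_gt0// ltr_wpDl.
  have hG : h * G 0 <= eta / 4.
    by rewrite /h -mulrA ler_piMr ?(ltW eta40)// ler_pdivrMl ?ltr_wpDl// mulr1 lerDl.
  (* Multiplying [i + eta / 4] by [rho] gives [i + eta / 2], and dividing a lower sum, which is at
     most [i], by [rho] loses at most [eta / 4]. *)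
  pose rho := (i + eta / 2) / (i + eta / 4).
  have rho1 : 1 < rho by rewrite ltr_pdivlMr ?mul1r; lra.
  have [theta t01 [t1 t2]] := powR_perturbation lambda_gt0 rho1.
  have [L HL] := lower_sum_near measurable_barrier_tail G_ge0 G_nonincreasing h0 Ii eta40.
  have H2 := @ruin_prob_ge theta h (eta / 4) L t01 h0 eta40.
  (* The upper bound needs its own number of blocks, large enough to make the far contribution
     small; [1 < lambda] provides it. *)
  have [L' L'0 HL'] : exists2 L' : nat, (0 < L')%N & C * (L'%:R * h) `^ (1 - lambda) <= eta / 4.
    have l10 : 0 < lambda - 1 by rewrite subr_gt0.
    have [x1 x11 Hx] := near_pinfty_ex (powRN_small l10 (divr_gt0 eta40 C0)).
    have x10 : 0 < x1 by apply: lt_le_trans x11.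
    exists (truncn (x1 / h)).+1 => //.
    have := truncn_itv (divr_ge0 (ltW x10) (ltW h0)) => /andP[_].
    rewrite ltr_pdivrMr// => /ltW/Hx; rewrite opprB => hx.
    by rewrite mulrC -ler_pdivlMr.
  have H1 := Hle theta h (eta / 4) L' t01 h0 eta40 L'0.
  have up : upper_sum G h L' <= i + eta / 4.
    apply: (@le_trans _ _ (upper_sum G h L'.+1)).
      rewrite [leRHS]/upper_sum big_ord_recr lerDl mulr_ge0 ?(ltW h0)//.
      by rewrite G_ge0// mulr_ge0// ltW.
    rewrite upper_sumS addrC lerD// -lee_fin -Ii; exact: lower_le.
  have up0 : 0 <= upper_sum G h L'.
    by apply: sumr_ge0 => r _; rewrite mulr_ge0 ?(ltW h0)// G_ge0// mulr_ge0// ltW.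
  have low : lower_sum G h L <= i by rewrite -lee_fin -Ii; exact: lower_le.
  have low0 : 0 <= lower_sum G h L.
    by apply: sumr_ge0 => r _; rewrite mulr_ge0 ?(ltW h0)// G_ge0// mulr_ge0// ltW.
  near=> u.
  have u0 : 0 < u by near: u; apply: nbhs_pinfty_gt; exact: num_real.
  have uF0 := ltW (uF_gt0 u0).
  apply/andP; split.
    have h2 : ((1 - theta) * (1 + theta) `^ (- lambda) * lower_sum G h L - eta / 4) * (u * F u) <=
      ruin_prob Tn Sn Z a u by near: u.
    apply: le_trans h2; apply: ler_wpM2r => //.
    have h3 := ler_wpM2r low0 t2.
    have h4 : rho^-1 = 1 - (eta / 4) / (i + eta / 2).
      by rewrite /rho; field; rewrite !gt_eqF//; lra.
    have h5 : (eta / 4) / (i + eta / 2) * lower_sum G h L <= eta / 4.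
      rewrite mulrAC ler_pdivrMr; last by lra.
      by rewrite ler_pM2l//; lra.
    rewrite h4 mulrBl mul1r in h3; lra.
  have h1 : ruin_prob Tn Sn Z a u <=
      ((1 + theta) * (1 - theta) `^ (- lambda) * upper_sum G h L' +
       C * (L'%:R * h) `^ (1 - lambda) + eta / 4) * (u * F u) by near: u.
  apply: le_trans h1 _; apply: ler_wpM2r => //.
  have h3 : (1 + theta) * (1 - theta) `^ (- lambda) * upper_sum G h L' <= i + eta / 2.
    apply: (@le_trans _ _ (rho * (i + eta / 4))).
      by apply: ler_pM => //; rewrite mulr_ge0 ?powR_ge0//; case/andP: t01; lra.
    by rewrite /rho mulfVK// gt_eqF//; lra.
  lra.
apply/cvgrPdist_le => eta eta0; near=> u.
have u0 : 0 < u by near: u; apply: nbhs_pinfty_gt; exact: num_real.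
have /andP[h1 h2] : (i - eta) * (u * F u) <= ruin_prob Tn Sn Z a u <= (i + eta) * (u * F u).
  by near: u; exact: main.
rewrite ler_distlC; have uF0 := uF_gt0 u0.
by rewrite ler_pdivlMr// ler_pdivrMr// h1.
Unshelve. all: by end_near. Qed.

End model.

(** * The limiting measure of a quadrant *)

Section extended_plane.
Context (R : realType).

(** The extended line is the image of the segment from -1 to 1 under [expand], continuous because
    the distance on it is read through [contract]. *)
Lemma ereal_compact : compact [set: \bar R].
Proof.
have -> : [set: \bar R] = [set expand r | r in `[(-1 : R), 1]].
  apply/seteqP; split => // e _; exists (contract e); last exact: contractK.
  by rewrite /= in_itv/= -ler_norml contract_le1.
apply: continuous_compact; last exact: segment_compact.
apply/subspace_continuousP => x x1; apply/cvg_ballP => e e0.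
rewrite near_withinE; apply/nbhs_ballP; exists e => //= y xy y1.
by rewrite /ball/= /ereal_ball !expandK ?inE ?ler_norml.
Qed.

Lemma ereal_plane_compact : compact [set: \bar R * \bar R].
Proof. by rewrite -setXTT; apply: compact_setX; exact: ereal_compact. Qed.

(** For [y < z], piecewise linear from 0 at [y] to 1 at [z]; cutting before [fine] avoids its
    default value at the infinities. *)
Definition ramp (y z : R) (e : \bar R) : R :=
  (fine (mine (maxe e y%:E) z%:E) - y) / (z - y).

Section ramp.
Variables y z : R.
Hypothesis yz : y < z.

Let zy0 : 0 < z - y. Proof. by rewrite subr_gt0. Qed.

Let cut (e : \bar R) : \bar R := mine (maxe e y%:E) z%:E.

Let cut_itv e : (y%:E <= cut e <= z%:E)%E.
Proof. by rewrite le_min le_max lexx orbT lee_fin (ltW yz) ge_min lexx orbT. Qed.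

Let cut_fin e : cut e \is a fin_num.
Proof.
have /andP[h1 h2] := cut_itv e.
by rewrite fin_real// (lt_le_trans (ltNyr y) h1) (le_lt_trans h2 (ltry z)).
Qed.

Lemma ramp_ge0 e : 0 <= ramp y z e.
Proof.
have /andP[h1 _] := cut_itv e.
by rewrite divr_ge0 ?(ltW zy0)// subr_ge0 -lee_fin fineK ?cut_fin.
Qed.

Lemma ramp_le1 e : ramp y z e <= 1.
Proof.
have /andP[_ h2] := cut_itv e.
by rewrite ler_pdivrMr// mul1r lerD2r -lee_fin fineK ?cut_fin.
Qed.

Lemma ramp_eq1 e : (z%:E <= e)%E -> ramp y z e = 1.
Proof.
move=> ze; rewrite /ramp min_r /= ?divff ?gt_eqF//.
by rewrite le_max ze.
Qed.

Lemma ramp_eq0 e : (e <= y%:E)%E -> ramp y z e = 0.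
Proof.
move=> ey; rewrite /ramp max_r// min_l /= ?subrr ?mul0r//.
by rewrite lee_fin ltW.
Qed.

Lemma ramp_continuous : continuous (ramp y z).
Proof.
move=> e; apply: cvgMl; apply: cvgB; last exact: cvg_cst.
have -> : (fun e => fine (cut e)) = fine \o cut by [].
apply: fine_cvg; rewrite fineK; last exact: cut_fin.
have h1 : maxe x y%:E @[x --> e] --> maxe e y%:E.
  apply: (@continuous2_cvg _ _ _ _ _ _ id (cst y%:E) (fun a b => maxe a b)).
  - exact: (@max_continuous _ (\bar R) (e, y%:E)).
  - exact: cvg_id.
  - exact: cvg_cst.
apply: (@continuous2_cvg _ _ _ _ _ _ (fun x => maxe x y%:E) (cst z%:E) (fun a b => mine a b)).
- exact: (@min_continuous _ (\bar R) (maxe e y%:E, z%:E)).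
- exact: h1.
- exact: cvg_cst.
Qed.

Lemma measurable_ramp : measurable_fun setT (ramp y z).
Proof.
apply: measurable_funM => //; apply: measurable_funB => //.
apply: (measurableT_comp (fine_measurable measurableT)).
by apply: measurable_mine => //; exact: measurable_maxe.
Qed.

End ramp.

Lemma measurable_upper_quadrant (x : 'I_2 -> R) : measurable (upper_quadrant x).
Proof.
apply: measurableI; rewrite -[X in measurable X]setTI; exact: emeasurable_fun_o_infty.
Qed.

Lemma upper_quadrant_origin (x : 'I_2 -> R) : 0 < x ord0 -> ~ upper_quadrant x (origin R).
Proof. by move=> x0 [/= h _]; move: h; rewrite lte_fin ltNge ltW. Qed.

Lemma upper_quadrant_scale (x : 'I_2 -> R) (s : R) : 0 < s ->
  [set (s%:E * y.1, s%:E * y.2)%E | y in upper_quadrant x] =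
  upper_quadrant (fun j => s * x j).
Proof.
move=> s0; apply/seteqP; split => [_ [y [y1 y2] <-]|[e1 e2] [/= h1 h2]].
  by split; rewrite /= EFinM lte_pmul2l.
exists (s^-1%:E * e1, s^-1%:E * e2)%E.
  by split; rewrite /= lte_pdivlMl// -EFinM.
by rewrite /= !muleA -EFinM divff ?gt_eqF// !mul1e.
Qed.

(** A test function squeezed between the indicators of the quadrants at [x'] and at [x]. *)
Definition bump (x x' : 'I_2 -> R) (y : \bar R * \bar R) : R :=
  ramp (x ord0) (x' ord0) y.1 * ramp (x ord_max) (x' ord_max) y.2.

Section bump.
Variables x x' : 'I_2 -> R.
Hypothesis x0 : 0 < x ord0.
Hypothesis xx' : forall j, x j < x' j.

Lemma bump_ge0 y : 0 <= bump x x' y.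
Proof. by rewrite mulr_ge0// ramp_ge0. Qed.

Lemma bump_continuous : continuous (bump x x').
Proof.
move=> y; apply: cvgM.
  apply: (@cvg_comp _ _ _ fst (ramp (x ord0) (x' ord0))); first exact: cvg_fst.
  exact: ramp_continuous.
apply: (@cvg_comp _ _ _ snd (ramp (x ord_max) (x' ord_max))); first exact: cvg_snd.
exact: ramp_continuous.
Qed.

Lemma measurable_bump : measurable_fun setT (bump x x').
Proof.
by apply: measurable_funM; apply: measurableT_comp => //; exact: measurable_ramp.
Qed.

Lemma bump_ge_indic y : \1_(upper_quadrant x') y <= bump x x' y.
Proof.
rewrite indicE; have [/set_mem [h1 h2]|_] := boolP (y \in _); last exact: bump_ge0.
by rewrite /bump !ramp_eq1 ?mulr1// ltW.
Qed.

Lemma bump_le_indic y : bump x x' y <= \1_(upper_quadrant x) y.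
Proof.
rewrite indicE; have [_|/negP nxy] := boolP (y \in _).
  by rewrite /bump mulr_ile1 ?ramp_ge0 ?ramp_le1.
have [h1|h1] := leP y.1 (x ord0)%:E; first by rewrite /bump ramp_eq0 ?mul0r.
have [h2|h2] := leP y.2 (x ord_max)%:E; first by rewrite /bump [X in _ * X]ramp_eq0 ?mulr0.
by exfalso; apply: nxy; apply/mem_set; split.
Qed.

(** This closed half-plane avoids the origin since [0 < x ord0]; compactness of the support is
    automatic in the compact plane. *)
Let support_sub : closure [set y | bump x x' y != 0] `<=` [set y | ((x ord0)%:E <= y.1)%E].
Proof.
have cl : closed [set y : \bar R * \bar R | ((x ord0)%:E <= y.1)%E].
  apply: (@preimage_closed _ _ fst [set e | ((x ord0)%:E <= e)%E]).
    by move=> y _; exact: cvg_fst.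
  exact: closed_ereal_le_ereal.
rewrite [X in _ `<=` X](proj1 (closure_id _) cl); apply: closureS => y /= b0.
have [//|/ltW h] := leP (x ord0)%:E y.1.
by move: b0; rewrite /bump ramp_eq0 ?mul0r ?eqxx.
Qed.

Lemma bump_support_compact : compact (closure [set y | bump x x' y != 0]).
Proof.
apply: (@subclosed_compact _ _ [set: \bar R * \bar R]) => //; first exact: closed_closure.
exact: ereal_plane_compact.
Qed.

Lemma bump_support_origin : ~ closure [set y | bump x x' y != 0] (origin R).
Proof. by move=> /support_sub /=; rewrite lee_fin leNgt x0. Qed.

End bump.

End extended_plane.

Section limit_measure.
Context (d : measure_display) (Omega : measurableType d) (R : realType)
  (P : probability Omega R) (T : {RV P >-> R}) (p : 'I_2 -> R) (N : R * R -> R)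
  (lambda n : R) (mu : {measure set (\bar R * \bar R) -> \bar R}).

Local Notation F := (tail P T).
Local Notation W := (fun w => (p ord0 * T w, p ord_max * T w)).

Hypothesis rF : regular_tail F lambda.
Hypothesis lambda0 : 0 < lambda.
Hypothesis p0 : forall j, 0 < p j.
Hypothesis n0 : 0 < n.
Hypothesis tail_N : forall u, 0 < u -> tail P (N \o W) u = F (u / n).
Hypothesis rvW : regularly_varying_vector P N W lambda mu.

(** The vector [(p_1 T, p_2 T)] lies on a line through the origin and enters the quadrant at [x]
    exactly when [T] exceeds this value. *)
Definition quadrant_level (x : 'I_2 -> R) : R := maxr (x ord0 / p ord0) (x ord_max / p ord_max).

Lemma quadrant_level_scale (x : 'I_2 -> R) (s : R) : 0 <= s ->
  quadrant_level (fun j => s * x j) = s * quadrant_level x.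
Proof. by move=> s0; rewrite /quadrant_level -!mulrA maxr_pMr. Qed.

Lemma quadrant_level_gt0 x : 0 < x ord0 -> 0 < quadrant_level x.
Proof. by move=> x0; rewrite lt_max divr_gt0. Qed.

Let limit_value (x : 'I_2 -> R) : R := (n * quadrant_level x) `^ (- lambda).

Let embed (u : R) (w : Omega) : \bar R * \bar R :=
  ((u^-1 * (p ord0 * T w))%:E, (u^-1 * (p ord_max * T w))%:E).

Let measurable_embed u : measurable_fun setT (embed u).
Proof.
by apply: measurable_fun_pair; apply/measurable_EFinP; apply: measurable_funM => //;
  exact: measurable_funM.
Qed.

Let embed_quadrant x u : 0 < u ->
  embed u @^-1` upper_quadrant x = [set w | u * quadrant_level x < T w].
Proof.
move=> u0.
have E y r t : 0 < r -> ((y%:E < (u^-1 * (r * t))%:E)%E = (u * (y / r) < t)).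
  by move=> r0; rewrite lte_fin ltr_pdivlMl// mulrA ltr_pdivrMr// [t * r]mulrC.
apply/seteqP; split => w; rewrite /preimage /upper_quadrant /=.
  move=> []; rewrite !E// => h1 h2.
  by rewrite mulrC -ltr_pdivlMr// gt_max !ltr_pdivlMr// [_ * u]mulrC h1 [_ * u]mulrC h2.
rewrite mulrC -ltr_pdivlMr// gt_max !ltr_pdivlMr// => /andP[h1 h2].
by split; rewrite E// mulrC.
Qed.

Let normalized_integral (f : \bar R * \bar R -> R) u : 0 < u ->
  measurable_fun setT f -> (forall y, 0 <= f y) ->
  (\int[normalized_law P N W u]_y (f y)%:E =
   ((F (u / n))^-1)%:E * \int[P]_w (f (embed u w))%:E)%E.
Proof.
move=> u0 mf f0.
have k0 : 0 <= (F (u / n))^-1 by rewrite invr_ge0 ltW// (rt_gt0 rF).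
(* [normalized_law] is a bare set function; as the pushforward of a scaled measure it admits a
   change of variables. *)
have -> : normalized_law P N W u = pushforward (mscale (NngNum k0) P) (embed u).
  by apply/funext => A; rewrite /normalized_law tail_N.
rewrite ge0_integral_pushforward//; last 2 first.
- exact/measurable_EFinP.
- by move=> y _; rewrite lee_fin.
rewrite preimage_setT ge0_integral_mscale//.
- by apply/measurable_EFinP; exact: measurableT_comp.
- by move=> w _; rewrite /= lee_fin.
Qed.

Let bump_integral_bounds x x' u : 0 < u -> (forall j, x j < x' j) ->
  ((F (u * quadrant_level x') / F (u / n))%:E <=
     \int[normalized_law P N W u]_y (bump x x' y)%:E <=
   (F (u * quadrant_level x) / F (u / n))%:E)%E.
Proof.
move=> u0 xx'.
have mb := measurable_bump x x'; have b0 := bump_ge0 xx'.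
rewrite normalized_integral//.
have mE : measurable_fun setT (fun w => (bump x x' (embed u w))%:E).
  by apply/measurable_EFinP; exact: (measurableT_comp mb).
have mQ z : measurable [set w | u * quadrant_level z < T w] by exact: measurable_gt.
have PQ z : (\int[P]_w (\1_(upper_quadrant z) (embed u w))%:E =
    (F (u * quadrant_level z))%:E)%E.
  rewrite /tail -(pr_fin P (mQ z)) (prob_integral P (mQ z)) -(embed_quadrant z u0).
  by apply: eq_integral => w _; rewrite !indicE; congr (_%:R%:E); apply/idP/idP => /set_mem h;
    apply/mem_set.
have k0 : (0 <= ((F (u / n))^-1)%:E)%E by rewrite lee_fin invr_ge0 ltW// (rt_gt0 rF).
have mI z : measurable_fun setT (fun w => (\1_(upper_quadrant z) (embed u w) : R)%:E).
  apply/measurable_EFinP; apply: measurableT_comp (measurable_embed u).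
  by apply: measurable_indic; exact: measurable_upper_quadrant.
rewrite -!(mulrC (F (u / n))^-1) !EFinM -!PQ; apply/andP; split; apply: lee_wpmul2l => //.
- apply: ge0_le_integral => //.
  by move=> w _; rewrite lee_fin; exact: bump_ge_indic.
- apply: ge0_le_integral => //; first by move=> w _; rewrite lee_fin.
  by move=> w _; rewrite lee_fin; exact: bump_le_indic.
Qed.

Let ratio_le x c : 0 < x ord0 -> limit_value x < c ->
  \forall u \near +oo, F (u * quadrant_level x) / F (u / n) <= c.
Proof.
move=> x0 xc; have m0 := quadrant_level_gt0 x0.
have H := rt_ratio_le rF (mulr_gt0 n0 m0) xc.
have n1 : 0 < n^-1 by rewrite invr_gt0.
apply: filterS (near_pinfty_scale n1 H) => u.
rewrite ler_pdivrMr ?(rt_gt0 rF)// [n^-1 * u]mulrC.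
by rewrite (_ : n * quadrant_level x * (u / n) = u * quadrant_level x)//; field; rewrite gt_eqF.
Qed.

Let ratio_ge x c : 0 < x ord0 -> c < limit_value x ->
  \forall u \near +oo, c <= F (u * quadrant_level x) / F (u / n).
Proof.
move=> x0 xc; have m0 := quadrant_level_gt0 x0.
have H := rt_ratio_ge rF (mulr_gt0 n0 m0) xc.
have n1 : 0 < n^-1 by rewrite invr_gt0.
apply: filterS (near_pinfty_scale n1 H) => u.
rewrite ler_pdivlMr ?(rt_gt0 rF)// [n^-1 * u]mulrC.
by rewrite (_ : n * quadrant_level x * (u / n) = u * quadrant_level x)//; field; rewrite gt_eqF.
Qed.

Let mu_bump_bounds x x' : 0 < x ord0 -> (forall j, x j < x' j) ->
  (mu (upper_quadrant x') <= \int[mu]_y (bump x x' y)%:E <= mu (upper_quadrant x))%E.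
Proof.
move=> x0 xx'; have mE : measurable_fun setT (fun y => (bump x x' y)%:E).
  by apply/measurable_EFinP; exact: measurable_bump.
have muQ z : mu (upper_quadrant z) = (\int[mu]_y (\1_(upper_quadrant z) y)%:E)%E.
  by rewrite integral_indic ?setIT//; exact: measurable_upper_quadrant.
have mI z : measurable_fun setT (fun y => (\1_(upper_quadrant z) y : R)%:E).
  by apply/measurable_EFinP; apply: measurable_indic; exact: measurable_upper_quadrant.
rewrite !muQ; apply/andP; split.
  apply: ge0_le_integral => //; first exact: mI.
  by move=> y _; rewrite lee_fin; exact: bump_ge_indic.
apply: ge0_le_integral => //.
- by move=> y _; rewrite lee_fin; exact: bump_ge0.
- exact: mI.
by move=> y _; rewrite lee_fin; exact: bump_le_indic.
Qed.

Let bump_limit_bounds x x' : 0 < x ord0 -> (forall j, x j < x' j) ->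
  ((limit_value x')%:E <= \int[mu]_y (bump x x' y)%:E <= (limit_value x)%:E)%E.
Proof.
move=> x0 xx'.
have x'0 : 0 < x' ord0 by apply: lt_trans (xx' ord0).
have H := rvv_cvg rvW (bump_continuous xx') (bump_ge0 xx') (@bump_support_compact _ x x')
  (bump_support_origin x0 xx').
apply/andP; split.
  apply/lee_addgt0Pr => e e0; rewrite -leeBlDr// -EFinB.
  apply: cvge_ge H; near=> u.
  have u0 : 0 < u by near: u; apply: nbhs_pinfty_gt; exact: num_real.
  have /andP[h _] := bump_integral_bounds u0 xx'; apply: le_trans h.
  by rewrite lee_fin; near: u; apply: ratio_ge => //; rewrite gtrBl.
apply/lee_addgt0Pr => e e0; rewrite -EFinD.
apply: cvge_le H; near=> u.
have u0 : 0 < u by near: u; apply: nbhs_pinfty_gt; exact: num_real.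
have /andP[_ h] := bump_integral_bounds u0 xx'; apply: le_trans h _.
by rewrite lee_fin; near: u; apply: ratio_le => //; rewrite ltrDl.
Unshelve. all: by end_near. Qed.

(** Vague convergence only determines bump integrals, which lie between the masses of the quadrants
    at [x] and at [t * x]. The scaling of [mu] relates these masses by [t ^ - lambda], so the gap
    closes as [t] tends to 1. *)
Lemma mu_upper_quadrant x : (forall j, 0 < x j) ->
  mu (upper_quadrant x) = ((n * quadrant_level x) `^ (- lambda))%:E.
Proof.
move=> x0; pose k := limit_value x.
have m0 := quadrant_level_gt0 (x0 ord0).
have k0 : 0 < k by rewrite powR_gt0// mulr_gt0.
have bounds rho : 1 < rho -> ((rho^-1 * k)%:E <= mu (upper_quadrant x) <= (rho * k)%:E)%E.
  move=> r1; have r0 : 0 < rho by apply: lt_trans r1.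
  (* Chosen so that scaling by [t] divides masses by [rho]. *)
  pose t := rho `^ lambda^-1.
  have tl : t `^ (- lambda) = rho^-1.
    by rewrite /t -powRrM mulrN mulVf ?gt_eqF// powRN powRr1// ltW.
  have t0 : 0 < t by exact: powR_gt0.
  have t1 : 1 < t.
    by rewrite /t /powR gt_eqF// expR_gt1 mulr_gt0 ?invr_gt0// ln_gt0.
  have xt j : x j < t * x j by rewrite ltr_pMl.
  have lt : limit_value (fun j => t * x j) = rho^-1 * k.
    rewrite /limit_value quadrant_level_scale ?(ltW t0)// mulrCA powRM ?(ltW t0)//.
      by rewrite tl.
    by rewrite mulr_ge0 ?ltW.
  have mt : mu (upper_quadrant (fun j => t * x j)) = (rho^-1%:E * mu (upper_quadrant x))%E.
    rewrite -upper_quadrant_scale// (rvv_scaling rvW) ?tl//.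
      exact: measurable_upper_quadrant.
    exact: upper_quadrant_origin.
  have /andP[h1 h2] := mu_bump_bounds (x0 ord0) xt.
  have /andP[h3 h4] := bump_limit_bounds (x0 ord0) xt.
  rewrite mt in h1; rewrite lt in h3.
  rewrite (le_trans h3 h2) /=.
  by move: (le_trans h1 h4); rewrite lee_pdivrMl//.
have [m E] : exists m, mu (upper_quadrant x) = m%:E.
  exists (fine (mu (upper_quadrant x))); rewrite fineK//.
  have /andP[h1 h2] := bounds 2 (ltr1n R 2).
  by rewrite fin_real// (lt_le_trans _ h1) ?ltNyr//=; exact: le_lt_trans h2 (ltry _).
rewrite E; congr (_%:E); apply/eqP; rewrite eq_le -/(limit_value x) -/k.
apply/andP; split; apply/ler_addgt0Pr => e e0.
  have r1 : 1 < 1 + e / k by rewrite ltrDl divr_gt0.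
  have /andP[_] := bounds _ r1; rewrite E lee_fin => /le_trans; apply.
  by rewrite mulrDl mul1r mulfVK ?gt_eqF.
have r1 : 1 < 1 + e / k by rewrite ltrDl divr_gt0.
have /andP[] := bounds _ r1; rewrite E !lee_fin ler_pdivrMl ?(lt_trans ltr01)//.
move=> h1 h2.
have : (1 + e / k) * m = m + e * (m / k) by field; rewrite gt_eqF.
have [mk|km] := lerP m k; last by move=> _; lra.
have : e * (m / k) <= e by rewrite ler_piMr ?(ltW e0)// ler_pdivrMr// mul1r.
lra.
Qed.

End limit_measure.

(** Nonnegativity is not a field of [is_norm]; it follows from [0 = N (x - x) <= 2 * N x]. *)
Lemma norm_gt0 (R : realType) (N : R * R -> R) (x : R * R) :
  is_norm N -> x.1 != 0 -> 0 < N x.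
Proof.
move=> nN x0; have h := norm_homogeneous nN.
have N0 : N 0 = 0 by have := h 0 x; rewrite normr0 !mul0r.
have : 0 <= N x.
  have := norm_triangle nN x (-1 * x.1, -1 * x.2); rewrite h normrN1 mul1r.
  rewrite (_ : x + _ = 0) ?N0; last first.
    by case: x {x0} => x1 x2 /=; rewrite !mulN1r -[RHS](subrr (x1, x2)).
  by rewrite -mulr2n pmulrn_lge0.
rewrite le_eqVlt => /predU1P[/esym/(norm_definite nN) E|//].
by move: x0; rewrite E eqxx.
Qed.

(** Homogeneity produces the absolute value of [T], which is removed by passing to the positive copy
    [Tn 0] of the same law. *)
Lemma tail_norm (d : measure_display) (Omega : measurableType d) (R : realType)
    (P : probability Omega R) (H Ht p q : 'I_2 -> R) (B Bt : 'I_2 -> R -> {RV P >-> R})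
    (T S : {RV P >-> R}) (Tn Sn : nat -> {RV P >-> R})
    (Xn Yn : nat -> 'I_2 -> R -> {RV P >-> R}) (Z : 'I_2 -> R -> Omega -> R)
    (N : R * R -> R) (u : R) :
  regenerative_model H Ht p q B Bt T S Tn Sn Xn Yn Z -> is_norm N ->
  tail P (N \o (fun w => (p ord0 * T w, p ord_max * T w))) u =
  tail P T (u / N (p ord0, p ord_max)).
Proof.
move=> model nN; set n := N _.
have n0 : 0 < n by apply: norm_gt0 => //=; rewrite gt_eqF// (model_p_gt0 model).
pose A := [set t : R | u < `|t| * n].
have mA : measurable A.
  apply: (@measurable_gt _ _ _ (fun t : R => `|t| * n) u).
  by apply: measurable_funM => //; exact: measurable_normr.
have -> : tail P (N \o (fun w => (p ord0 * T w, p ord_max * T w))) u = pr P (T @^-1` A).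
  congr (pr P _); apply/seteqP; split => w; rewrite /A /=;
    by rewrite ![_ * T w]mulrC (norm_homogeneous nN (T w) (p ord0, p ord_max)).
rewrite /pr -(law_T model 0 mA) -(tail_T model 0); congr (fine (P _)).
apply/seteqP; split => w; rewrite /A /= ltr_pdivrMr// gtr0_norm//;
  exact: (model_T_gt0 model).
Qed.

Theorem theorem4p1
    (d : measure_display) (Omega : measurableType d) (R : realType)
    (P : probability Omega R)
    (H Ht p q : 'I_2 -> R) (B Bt : 'I_2 -> R -> {RV P >-> R})
    (T S : {RV P >-> R}) (Tn Sn : nat -> {RV P >-> R})
    (Xn Yn : nat -> 'I_2 -> R -> {RV P >-> R}) (Z : 'I_2 -> R -> Omega -> R)
    (model : regenerative_model H Ht p q B Bt T S Tn Sn Xn Yn Z)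
    (lambda : R) (lambda_gt1 : 1 < lambda)
    (T_rv : regularly_varying T lambda)
    (S_tail : tail P S x / tail P T x @[x --> +oo] --> (0 : R))
    (drift : forall j : 'I_2,
      ((p j)%:E * 'E_P[T] < (q j)%:E * 'E_P[S])%E /\
      ((q j)%:E * 'E_P[S] < +oo)%E)
    (a : 'I_2 -> R) (a_gt0 : forall j : 'I_2, 0 < a j)
    (N : R * R -> R) (N_norm : is_norm N)
    (mu : {measure set (\bar R * \bar R) -> \bar R}) :
  let c : 'I_2 -> R := fun j => q j * fine 'E_P[S]%E - p j * fine 'E_P[T]%E in
  let Ttilde : Omega -> R * R := fun w => (p ord0 * T w, p ord_max * T w) in
  regularly_varying_vector P N Ttilde lambda mu ->
  asymp_equiv
    (fun u : R => ruin_prob Tn Sn Z a u)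
    (fun u : R =>
      fine (\int[lebesgue_measure]_(v in `[0%R, +oo[)
              mu (upper_quadrant (fun j => v * c j + a j)%R))
      * (u * tail P (N \o Ttilde) u)).
Proof.
move=> c Ttilde rvW.
set F := tail P T; set n := N (p ord0, p ord_max).
have p0 := model_p_gt0 model.
have n0 : 0 < n by apply: norm_gt0 => //=; rewrite gt_eqF.
have l0 : 0 < lambda by apply: lt_trans lambda_gt1.
have rF : regular_tail F lambda := regular_tail_T T_rv.
have tailN u : tail P (N \o Ttilde) u = F (u / n) := tail_norm u model N_norm.
have [i i0 [Ii Hi]] := ruin_prob_asymptotic model lambda_gt1 T_rv S_tail drift a_gt0.
have c0 j : 0 < c j by exact: net_drift_gt0 model drift j.
have -> : fine (\int[lebesgue_measure]_(v in `[0%R, +oo[)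
              mu (upper_quadrant (fun j => v * c j + a j)%R)) = n `^ (- lambda) * i.
  rewrite (_ : (\int[_]_(v in _) _ = (n `^ (- lambda))%:E * i%:E)%E)// -Ii.
  rewrite -ge0_integralZl//; last 3 first.
  - by apply/measurable_EFinP; apply: measurable_funTS; exact: measurable_barrier_tail.
  - by move=> v _; rewrite lee_fin powR_ge0.
  - by rewrite lee_fin powR_ge0.
  apply: eq_integral => v /set_mem; rewrite /= in_itv/= andbT => v0.
  rewrite (mu_upper_quadrant rF l0 p0 n0 (fun u _ => tailN u) rvW); last first.
    by move=> j; rewrite ltr_wpDl// mulr_ge0// ltW.
  have E : quadrant_level p (fun j => v * c j + a j) = barrier a c p v.
    by rewrite /quadrant_level /barrier ![v * _]mulrC ![_ + a _]addrC.
  by rewrite -EFinM E powRM ?(ltW n0)// ltW// (barrier_gt0 model drift).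
rewrite /asymp_equiv.
have n1 : 0 < n^-1 by rewrite invr_gt0.
have nl : n^-1 `^ (- lambda) = (n `^ (- lambda))^-1.
  by rewrite -(powR_inv1 (ltW n0)) -powRrM mulN1r opprK powRN invrK.
have nl0 : 0 < n `^ (- lambda) by exact: powR_gt0.
have H1 : F (n^-1 * u) / F u @[u --> +oo] --> (n `^ (- lambda))^-1.
  by rewrite -nl; exact: (rt_ratio rF n1).
have H2 : (F (n^-1 * u) / F u)^-1 @[u --> +oo] --> n `^ (- lambda).
  by rewrite -[X in _ --> X]invrK; apply: cvgV => //; rewrite invr_neq0// gt_eqF.
(* The quotient in question, with [u * F (u / n)] factored through [u * F u]; the factor
   [n ^ (- lambda)] of the integral cancels the limit of the tail ratio. *)
have : ruin_prob Tn Sn Z a u / (u * F u) * (n `^ (- lambda) * i)^-1 *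
    (F (n^-1 * u) / F u)^-1 @[u --> +oo] -->
    i * (n `^ (- lambda) * i)^-1 * n `^ (- lambda).
  by apply: cvgM => //; exact: cvgMl.
rewrite (_ : i * _ * _ = 1); last by field; rewrite !gt_eqF.
apply: cvg_trans; apply: near_eq_cvg; near=> u.
have u0 : 0 < u by near: u; apply: nbhs_pinfty_gt; exact: num_real.
rewrite /= tailN [u / n]mulrC.
have F1 : F u != 0 by rewrite gt_eqF// (rt_gt0 rF).
have F2 : F (n^-1 * u) != 0 by rewrite gt_eqF// (rt_gt0 rF).
rewrite -/F; field.
by rewrite F1 F2 !gt_eqF.
Unshelve. all: by end_near. Qed.
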